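(* Let $N=2n$ and consider $$(P)\qquad -\Delta u+\lambda u=a(|x|)u^{p-1}\ \text{ in }\Omega,\qquad u>0\ \text{ in }\Omega,\qquad u=0\ \text{ on }\partial\Omega,$$ in one of the following three settings: (a) $\Omega=\{x\in\mathbb{R}^N:R_1<|x|<R_2\}$ with $0<R_1<R_2<\infty$, $\lambda=0$, $a$ is radial, positive and sufficiently smooth, and $2<p<\infty$; (b) $N\ge4$, $\Omega=B_1$ is the unit ball centered at the origin, $\lambda=0$, $a(x)=|x|^\alpha$ with $\alpha>0$, and $2<p<\frac{2N+2\alpha}{N-2}$; (c) $N\ge4$, $\Omega=\mathbb{R}^N$ (no boundary condition), $\lambda=1$, $a(x)=|x|^\alpha$ with $\alpha>0$, and $\frac{2N+2\alpha-4}{N-2}<p<\frac{2N+2\alpha}{N-2}$. Let $u$ be a $K_+$ ground state solution of (P). If $p-2>\frac{4(N+2)}{\beta_\lambda(\Omega)}$, then $u$ is a nonradial function.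
   Context: Write $\mathbb{R}^N=\mathbb{R}^n\times\mathbb{R}^n$, $s=(x_1^2+\cdots+x_n^2)^{1/2}$, $t=(x_{n+1}^2+\cdots+x_N^2)^{1/2}$, with polar coordinates $s=r\cos\theta$, $t=r\sin\theta$, $r=|x|$, $0<\theta<\frac{\pi}{2}$. Let $G=O(n)\times O(n)$ and $H^1_{0,G}(\Omega)=\{u\in H^1_0(\Omega):u(g^{-1}x)=u(x)\ \forall g\in G\}$ (with $H^1_0(\mathbb{R}^N)=H^1(\mathbb{R}^N)$); such functions depend only on $(r,\theta)$. $K_+$ is the set of $0\le u\in H^1_{0,G}(\Omega)$ that are even across $\theta=\frac{\pi}{4}$ (that is, $u(r,\theta)=u(r,\frac{\pi}{2}-\theta)$) with $u_\theta\ge0$ a.e. for $0<\theta<\frac{\pi}{4}$. With $K=K_+$ and $V=\{u\in H^1_0(\Omega):\int_\Omega a|u|^pdx<\infty\}$ (norm: sum of the $H^1$ norm and the weighted $L^p$ norm), define $E_K(u)=\frac12\int_\Omega(|\nabla u|^2+\lambda u^2)dx-\frac1p\int_\Omega a|u|^pdx$ for $u\in K$ and $E_K=+\infty$ on $V\setminus K$. A $K_+$ ground state solution is a weak solution $u\in K_+$ of (P) with $E_K(u)=c>0$, where $c=\inf_{\gamma\in\Gamma}\max_{\tau\in[0,1]}E_K(\gamma(\tau))$ and $\Gamma=\{\gamma\in C([0,1],V):\gamma(0)=0\ne\gamma(1),\ E_K(\gamma(1))\le0\}$. $\beta_\lambda(\Omega)=\inf_{0\ne u\in H^1_0(\Omega)}\frac{\int_\Omega|\nabla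 u|^2dx+\lambda\int_\Omega u^2dx}{\int_\Omega u^2/|x|^2dx}$. ''Sufficiently smooth'' means $a\in C^k(\overline\Omega)$ for a sufficiently large $k$. *)

(* Defs.v *)
From HB Require Import structures.
From mathcomp Require Import all_boot all_order all_algebra.
From mathcomp Require Import all_classical all_reals all_analysis.

Set Implicit Arguments.
Unset Strict Implicit.
Unset Printing Implicit Defensive.

Import Order.TTheory GRing.Theory Num.Theory.
Import numFieldNormedType.Exports.

Local Open Scope classical_set_scope.
Local Open Scope ring_scope.

(* Points of R^N are row vectors.  The library has Lebesgue measure on R only:
   R^N gets the product sigma-algebra (the one generated by the coordinates, as
   for the library's n.-tuple R), and Lebesgue measure on R^(1+N) is the image
   of the product measure under (x, v) |-> row_mx x v. *)

Section measurable_rV.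
Context {R : realType} (N : nat).

Let coor (i : 'I_N) (x : 'rV[R]_N) : R := x ord0 i.

Let rV_set0 : g_sigma_preimage coor set0.
Proof. exact: sigma_algebra0. Qed.

Let rV_setC A : g_sigma_preimage coor A -> g_sigma_preimage coor (~` A).
Proof. exact: sigma_algebraC. Qed.

Let rV_bigcup (F : (set 'rV[R]_N)^nat) :
  (forall i, g_sigma_preimage coor (F i)) ->
  g_sigma_preimage coor (\bigcup_i (F i)).
Proof. exact: sigma_algebra_bigcup. Qed.

HB.instance Definition _ :=
  @isMeasurable.Build (measure_tuple_display default_measure_display)
    'rV[R]_N (g_sigma_preimage coor) rV_set0 rV_setC rV_bigcup.

Lemma measurable_coor (i : 'I_N) :
  measurable_fun [set: 'rV[R]_N] (fun x : 'rV[R]_N => x ord0 i).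
Proof.
move=> _ Y mY; rewrite setTI; apply: sub_sigma_algebra => /=.
rewrite -bigcup_seq/=; exists i => /=; first by rewrite mem_index_enum.
by exists Y => //; rewrite setTI.
Qed.

Lemma measurable_fun_coorP d (T : measurableType d) (f : T -> 'rV[R]_N) :
  (forall i, measurable_fun [set: T] (fun x => f x ord0 i)) ->
  measurable_fun [set: T] f.
Proof.
move=> mf _ A mA; rewrite setTI.
have : preimage_set_system [set: T] f (g_sigma_preimage coor) (f @^-1` A).
  by exists A => //; rewrite setTI.
rewrite -g_sigma_preimage_comp; apply: smallest_sub.
  exact: sigma_algebra_measurable.
rewrite -bigcup_seq/=; apply: bigcup_sub => i _ _ [B mB <-].
exact: mf.
Qed.

End measurable_rV.

Section lebesgue_rV.
Context {R : realType}.

Definition rV_cons N (x : measurableTypeR R * 'rV[R]_N) : 'rV[R]_N.+1 :=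
  row_mx (x.1)%:M x.2.

Let rV_uncons N (v : 'rV[R]_N.+1) : measurableTypeR R * 'rV[R]_N :=
  (v ord0 ord0, @rsubmx R 1 1 N v).

Let rV_unconsK N : cancel (@rV_uncons N) (@rV_cons N).
Proof.
move=> v; rewrite /rV_cons /=; apply/rowP => i.
rewrite -[in RHS](@hsubmxK R 1 1 N v).
congr (row_mx _ _ _ _); apply/rowP => j; rewrite !ord1 !mxE/= mulr1n.
by congr (v _ _); exact/val_inj.
Qed.

Let rV_consK N : cancel (@rV_cons N) (@rV_uncons N).
Proof.
move=> [x v]; rewrite /rV_uncons /rV_cons /= row_mxKr; congr pair.
have := @row_mxEl R 1 1 N x%:M v ord0 ord0.
rewrite [RHS]mxE eqxx mulr1n => e; rewrite -[RHS]e.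
by congr (fun_of_matrix _ _ _); exact/val_inj.
Qed.

Let measurable_rV_cons N : measurable_fun setT (@rV_cons N).
Proof.
apply: measurable_fun_coorP => i.
case: (@splitP 1 N i) => j ij.
  rewrite (_ : i = lshift N j); last exact/val_inj.
  rewrite (_ : (fun _ => _) = fst); first exact: measurable_fst.
  apply/funext => x; apply: etrans (@row_mxEl R 1 1 N _ _ ord0 j) _.
  by rewrite (ord1 j) mxE eqxx mulr1n.
rewrite (_ : i = rshift 1 j); last exact/val_inj.
rewrite (_ : (fun _ => _) =
  (fun v : 'rV[R]_N => v ord0 j) \o (snd : measurableTypeR R * _ -> _)).
  by apply: measurableT_comp; [exact: measurable_coor|exact: measurable_snd].
by apply/funext => x; exact: (@row_mxEr R 1 1 N _ _ ord0 j).
Qed.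

Let measurable_rV_uncons N : measurable_fun setT (@rV_uncons N).
Proof.
apply/measurable_fun_pairP; split; first exact: measurable_coor.
apply: measurable_fun_coorP => j.
rewrite (_ : (fun _ => _) = (fun v : 'rV[R]_N.+1 => v ord0 (rshift 1 j))).
  exact: measurable_coor.
by apply/funext => v; rewrite /= mxE.
Qed.

Section step.
Variables (N : nat) (m : {sigma_finite_measure set 'rV[R]_N -> \bar R}).

Definition lebesgue_rV_step : set 'rV[R]_N.+1 -> \bar R :=
  pushforward (lebesgue_measure \x m)%E (@rV_cons N).

Let step0 : lebesgue_rV_step set0 = 0%E.
Proof. by rewrite /lebesgue_rV_step /pushforward preimage_set0 measure0. Qed.

Let step_ge0 A : (0 <= lebesgue_rV_step A)%E.
Proof. exact: (measure_ge0 (lebesgue_measure \x m)%E). Qed.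

Let step_sigma_additive : semi_sigma_additive lebesgue_rV_step.
Proof.
exact: (@measure_semi_sigma_additive _ _ _
  (measure_function_pushforward__canonical__measure_function_Measure
    (lebesgue_measure \x m)%E (@measurable_rV_cons N))).
Qed.

HB.instance Definition _ := isMeasure.Build _ _ _
  lebesgue_rV_step step0 step_ge0 step_sigma_additive.

Let step_sigma_finite : sigma_finite setT lebesgue_rV_step.
Proof.
have /sigma_finiteP[F [FT ndF Foo]] := sigma_finiteT (@lebesgue_measure R).
have /sigma_finiteP[G [GT ndG Goo]] := sigma_finiteT m.
exists (fun k => @rV_uncons N @^-1` (F k `*` G k)).
  rewrite -preimage_bigcup (_ : \bigcup_k _ = setT) ?preimage_setT//.
  apply/seteqP; split => // -[x v] _ /=.
  have : [set: measurableTypeR R] x by []. rewrite FT => -[i _ Fix].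
  have : [set: 'rV[R]_N] v by []. rewrite GT => -[j _ Gjv].
  exists (maxn i j) => //; split => /=.
    by move: x Fix; exact/subsetPset/ndF/leq_maxl.
  by move: v Gjv; exact/subsetPset/ndG/leq_maxr.
move=> k; have [mF Fk] := Foo k; have [mG Gk] := Goo k; split.
  rewrite -[X in measurable X]setTI; apply: measurable_rV_uncons => //.
  exact: measurableX.
rewrite /lebesgue_rV_step /pushforward -comp_preimage.
rewrite (_ : _ \o _ = id); last by apply/funext => x; exact: rV_consK.
rewrite preimage_id product_measure1E// lte_mul_pinfty//.
by rewrite ge0_fin_numE.
Qed.

HB.instance Definition _ :=
  Measure_isSigmaFinite.Build _ _ _ lebesgue_rV_step step_sigma_finite.

End step.

Fixpoint lebesgue_rV (N : nat) : {sigma_finite_measure set 'rV[R]_N -> \bar R} :=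
  match N with
  | 0 => \d_(0 : 'rV[R]_0)
  | N'.+1 => lebesgue_rV_step (lebesgue_rV N')
  end.

End lebesgue_rV.

Section sobolev.
Context {R : realType} {N : nat}.
Implicit Types (Omega : set 'rV[R]_N) (x y : 'rV[R]_N) (f u : 'rV[R]_N -> R).

Local Notation mu := (@lebesgue_rV R N).

(* The library norm of 'rV[R]_N is the max norm. *)
Definition enorm x : R := Num.sqrt (\sum_i x ord0 i ^+ 2).

Definition dotrV x y : R := \sum_i x ord0 i * y ord0 i.

Definition partial (i : 'I_N) f x : R := 'D_(delta_mx ord0 i) f x.

Fixpoint Ck (k : nat) f : Prop :=
  if k is k'.+1 then
    continuous f /\
    forall i, (forall x, derivable f x (delta_mx ord0 i)) /\ Ck k' (partial i f)
  else continuous f.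

(* C^k of the closure of an open set: the derivatives of order at most k in
   Omega extend continuously to the closure. *)
Fixpoint Ck_closure (k : nat) Omega f : Prop :=
  if k is k'.+1 then
    {within closure Omega, continuous f} /\
    forall i,
      (forall x, Omega x -> derivable f x (delta_mx ord0 i)) /\
      exists g, (forall x, Omega x -> g x = partial i f x) /\
                Ck_closure k' Omega g
  else {within closure Omega, continuous f}.

Definition test_fun Omega f :=
  [/\ forall k, Ck k f,
      compact (closure [set x | f x != 0]) &
      closure [set x | f x != 0] `<=` Omega].

(* Elements of function spaces are represented by functions on R^N that only
   matter almost everywhere in Omega. *)
Definition ae_in Omega (P : 'rV[R]_N -> Prop) :=
  {ae mu, forall x, Omega x -> P x}.

Definition L2 Omega u :=
  measurable_fun Omega u /\ (\int[mu]_(x in Omega) (u x ^+ 2)%:E < +oo)%E.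

Definition is_wgrad Omega u (g : 'rV[R]_N -> 'rV[R]_N) :=
  forall i, L2 Omega (fun x => g x ord0 i) /\
    forall phi, test_fun Omega phi ->
      \int[mu]_(x in Omega) (u x * partial i phi x) =
      - \int[mu]_(x in Omega) (g x ord0 i * phi x).

Definition H1 Omega u := L2 Omega u /\ exists g, is_wgrad Omega u g.

(* Junk value 0 outside H^1; unique up to a.e. equality on H^1. *)
Definition wgrad Omega u : 'rV[R]_N -> 'rV[R]_N :=
  xget (fun=> 0) [set g | is_wgrad Omega u g].

Definition H1norm Omega u : \bar R :=
  ((\int[mu]_(x in Omega)
      (enorm (wgrad Omega u x) ^+ 2 + u x ^+ 2)%:E) `^ 2^-1)%E.

(* For Omega = R^N this closure is all of H^1(R^N). *)
Definition H10 Omega u :=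
  H1 Omega u /\
  forall e : R, 0 < e ->
    exists2 phi, test_fun Omega phi & (H1norm Omega (u \- phi)%R < e%:E)%E.

Definition hardy_quotient Omega (lambda : R) u : \bar R :=
  ((\int[mu]_(x in Omega) (enorm (wgrad Omega u x) ^+ 2)%:E
    + lambda%:E * \int[mu]_(x in Omega) (u x ^+ 2)%:E)
   / \int[mu]_(x in Omega) (u x ^+ 2 / enorm x ^+ 2)%:E)%E.

Definition beta Omega (lambda : R) : \bar R :=
  ereal_inf [set hardy_quotient Omega lambda u |
             u in [set u | H10 Omega u /\ ~ ae_in Omega (fun x => u x = 0)]].

Definition radial Omega u :=
  exists f : R -> R, ae_in Omega (fun x => u x = f (enorm x)).

End sobolev.

Section double_revolution.
Context {R : realType} {n : nat}.
Implicit Types (Omega : set 'rV[R]_(n + n)) (x : 'rV[R]_(n + n)).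
Implicit Types u : 'rV[R]_(n + n) -> R.

Definition s_of x : R := enorm (lsubmx x).
Definition t_of x : R := enorm (rsubmx x).

(* theta in [0, pi/2] with s = r cos theta and t = r sin theta. *)
Definition theta x : R := acos (s_of x / enorm x).

(* On row vectors, g^-1 x reads x *m g for orthogonal g. *)
Definition G_invariant Omega u :=
  forall A B : 'M[R]_n, A *m A^T = 1%:M -> B *m B^T = 1%:M ->
    ae_in Omega (fun x => u (x *m block_mx A 0 0 B) = u x).

Definition even_theta Omega u :=
  exists U : R -> R -> R,
    ae_in Omega (fun x => u x = U (enorm x) (theta x)) /\
    forall r th, 0 < r -> 0 < th < pi / 2 -> U r th = U r (pi / 2 - th).

(* x = (r cos theta w1, r sin theta w2) with w1, w2 unit vectors, hence
   d x / d theta = (- (t / s) y, (s / t) z) for x = (y, z), and u_theta is the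
   derivative of u along this field. *)
Definition theta_field x : 'rV[R]_(n + n) :=
  row_mx (- (t_of x / s_of x) *: lsubmx x) ((s_of x / t_of x) *: rsubmx x).

Definition u_theta Omega u x : R := dotrV (wgrad Omega u x) (theta_field x).

Definition K_plus Omega u :=
  [/\ H10 Omega u, G_invariant Omega u, ae_in Omega (fun x => 0 <= u x),
      even_theta Omega u &
      ae_in Omega (fun x => 0 < theta x < pi / 4 -> 0 <= u_theta Omega u x)].

End double_revolution.

Section ground_state.
Context {R : realType} {n : nat}.
Variables (Omega : set 'rV[R]_(n + n)) (lambda : R).
Variables (a : 'rV[R]_(n + n) -> R) (p : R).
Implicit Types u : 'rV[R]_(n + n) -> R.

Local Notation mu := (@lebesgue_rV R (n + n)).

Definition weighted_int u : \bar R :=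
  \int[mu]_(x in Omega) (a x * `|u x| `^ p)%:E.

Definition V u := H10 Omega u /\ (weighted_int u < +oo)%E.

Definition Vnorm u : \bar R := (H1norm Omega u + weighted_int u `^ p^-1)%E.

Definition E_K u : \bar R :=
  if `[< K_plus Omega u >] then
    (2^-1%:E * \int[mu]_(x in Omega)
                  (enorm (wgrad Omega u x) ^+ 2 + lambda * u x ^+ 2)%:E
     - p^-1%:E * weighted_int u)%E
  else +oo%E.

Definition continuous_path (gamma : R -> 'rV[R]_(n + n) -> R) :=
  forall tau, tau \in `[0, 1] -> forall e : R, 0 < e ->
    exists2 d : R, 0 < d &
      forall sigma, sigma \in `[0, 1] -> `|sigma - tau| < d ->
        (Vnorm (gamma sigma \- gamma tau)%R < e%:E)%E.

Definition Gamma (gamma : R -> 'rV[R]_(n + n) -> R) :=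
  [/\ forall tau, tau \in `[0, 1] -> V (gamma tau),
      continuous_path gamma,
      ae_in Omega (fun x => gamma 0 x = 0),
      ~ ae_in Omega (fun x => gamma 1 x = 0) &
      (E_K (gamma 1%R) <= 0)%E].

(* The supremum over tau is a maximum: along a path of V, E_K is continuous if
   the path stays in K_+, and otherwise it takes the value +oo. *)
Definition mountain_pass_level : \bar R :=
  ereal_inf [set ereal_sup [set E_K (gamma tau) | tau in `[0, 1]] |
             gamma in Gamma].

Definition weak_solution u :=
  [/\ V u, ae_in Omega (fun x => 0 < u x) &
      forall eta, V eta ->
        \int[mu]_(x in Omega)
          (dotrV (wgrad Omega u x) (wgrad Omega eta x)
           + lambda * (u x * eta x)) =
        \int[mu]_(x in Omega) (a x * u x `^ (p - 1) * eta x)].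

Definition ground_state u :=
  [/\ K_plus Omega u, weak_solution u,
      E_K u = mountain_pass_level & (0 < mountain_pass_level)%E].

Definition setting_a (k : nat) :=
  [/\ exists R1 R2 : R,
        0 < R1 < R2 /\ Omega = [set x | R1 < enorm x < R2],
      lambda = 0,
      exists f : R -> R, forall x, closure Omega x -> a x = f (enorm x),
      (forall x, closure Omega x -> 0 < a x) /\ Ck_closure k Omega a &
      2 < p].

Definition setting_b :=
  [/\ (4 <= n + n)%N, Omega = [set x | enorm x < 1], lambda = 0 &
      exists2 alpha : R, 0 < alpha &
        a = (fun x => enorm x `^ alpha) /\
        2 < p < (2 * (n + n)%:R + 2 * alpha) / ((n + n)%:R - 2)].

Definition setting_c :=
  [/\ (4 <= n + n)%N, Omega = setT, lambda = 1 &
      exists2 alpha : R, 0 < alpha &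
        a = (fun x => enorm x `^ alpha) /\
        (2 * (n + n)%:R + 2 * alpha - 4) / ((n + n)%:R - 2) < p <
          (2 * (n + n)%:R + 2 * alpha) / ((n + n)%:R - 2)].

End ground_state.

(* Main.v *)
Require Import Defs.
From mathcomp Require Import all_boot all_order all_algebra.
From mathcomp Require Import all_classical all_reals all_analysis.
From mathcomp Require Import measurable_realfun ring lra.

Set Implicit Arguments.
Unset Strict Implicit.
Unset Printing Implicit Defensive.

Import Order.TTheory GRing.Theory Num.Theory.
Import numFieldNormedType.Exports.

Local Open Scope classical_set_scope.
Local Open Scope ring_scope.

(** Suppose that the ground state [u] is radial.  Let [psi] be the spherical
    harmonic of degree 4 that is a function of [s] and [t] alone,
      [psi = 4 (n + 1) / n * s ^ 2 * t ^ 2 / r ^ 4 - 1].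
    It is even across [theta = pi / 4] and increases with [theta] up to there, so
    [(1 + sg * psi) u] stays in the cone for small [sg > 0].  The half-line of
    this function carries an admissible path, and the claim is that the energy on
    it stays below the energy of [u], which is the mountain pass level.

    Write [Q] for the quadratic form of the energy at [u].  The equation tested
    with [u] says that [Q] is also the integral of [a u ^ p]; tested with
    [(1 + sg psi) ^ 2 u], it gives the quadratic form at [(1 + sg psi) u]
    ([energy_multiplier]):
      the integral of [a u ^ p (1 + sg psi) ^ 2 + sg ^ 2 u ^ 2 |grad psi| ^ 2].
    Since [u] is radial, every angular factor may be replaced by its average over
    directions ([radial_average]).  The average of [psi] is 0; let [m] be that of
    [psi ^ 2].  The harmonic has eigenvalue [4 (N + 2)], so the average of
    [r ^ 2 |grad psi| ^ 2] is [4 (N + 2) m].  With [S = m sg ^ 2] and [J] the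
    integral of [u ^ 2 / r ^ 2], the quadratic form is
      [Q + S (Q + 4 (N + 2) J) < Q (1 + (p - 1) S)],
    by the hypothesis on [beta] ([hardy_bound]), while the integral of
    [a ((1 + sg psi) u) ^ p] is [Q (1 + p (p - 1) / 2 * S)] to second order in
    [sg] ([powR_taylor2]).  On a half-line where these two integrals are [A] and
    [B], the maximum of the energy is [1/2 - 1/p] times the power of
    [A ^ (p / 2) / B] that is [Q] for [A = B = Q] ([fibering_max]).
    Up to terms of higher order [(A / Q) ^ (p / 2)] is smaller than [B / Q]
    ([powR_first_order]), so the maximum is below [(1/2 - 1/p) Q], the energy
    of [u].

    Two points need more care.  The function [psi] is not smooth at the origin,
    which belongs to two of the three domains; [r ^ 2] is therefore replaced by
    [r ^ 2 + e] in its denominator, and [e] tends to 0 by dominated convergence,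
    the dominating functions being [a u ^ p] and [u ^ 2 / r ^ 2].  The averages
    are computed without spherical measure: polar coordinates are replaced by
    dilations of a shell ([polar_coordinates]), and the moments of the direction
    come from the effect of dilating only one block of [n] coordinates
    ([moment_recursion]). *)

(** * Lebesgue measure on R^N: Tonelli and scaling *)

Section rV_measure.
Context {R : realType}.
Implicit Types N : nat.

Lemma rV_cons0 N (z : measurableTypeR R * 'rV[R]_N) : rV_cons z ord0 ord0 = z.1.
Proof.
rewrite /rV_cons; have := @row_mxEl R 1 1 N (z.1)%:M z.2 ord0 ord0.
rewrite [RHS]mxE eqxx mulr1n => e; rewrite -[RHS]e.
by congr (fun_of_matrix _ _ _); exact/val_inj.
Qed.

Lemma rV_consS N (z : measurableTypeR R * 'rV[R]_N) (j : 'I_N) :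
  rV_cons z ord0 (lift ord0 j) = z.2 ord0 j.
Proof.
rewrite /rV_cons -rshift1; exact: (@row_mxEr R 1 1 N (z.1)%:M z.2 ord0 j).
Qed.

Lemma measurable_rV_cons N : measurable_fun setT (@rV_cons R N).
Proof.
apply: measurable_fun_coorP => i.
case: (unliftP ord0 i) => [j|] ->.
  under eq_fun do rewrite rV_consS.
  apply: (measurableT_comp (f := fun v : 'rV[R]_N => v ord0 j)
      (g := snd : measurableTypeR R * _ -> _)).
    exact: measurable_coor.
  exact: measurable_snd.
under eq_fun do rewrite rV_cons0.
exact: measurable_fst.
Qed.

Lemma ge0_integral_rVS N (f : 'rV[R]_N.+1 -> \bar R) :
  measurable_fun [set: 'rV[R]_N.+1] f -> (forall x, 0 <= f x)%E ->
  (\int[lebesgue_rV N.+1]_x f x =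
   \int[lebesgue_measure]_x \int[lebesgue_rV N]_v f (rV_cons (x, v)))%E.
Proof.
move=> mf f0.
have -> : (\int[lebesgue_rV N.+1]_x f x =
  \int[pushforward (lebesgue_measure \x lebesgue_rV N) (@rV_cons R N)]_x f x)%E by [].
rewrite ge0_integral_pushforward//; last exact: measurable_rV_cons.
rewrite preimage_setT fubini_tonelli1//.
  by apply: measurableT_comp => //; exact: measurable_rV_cons.
by move=> z; exact: f0.
Qed.

Lemma ge0_integral_scale (c : R) (f : R -> \bar R) : 0 < c ->
  measurable_fun [set: measurableTypeR R] f -> (forall x, 0 <= f x)%E ->
  (\int[lebesgue_measure]_x f (c * x)%R = c^-1%:E * \int[lebesgue_measure]_x f x)%E.
Proof.
move=> c0 mf f0.
have mc : measurable_fun [set: measurableTypeR R]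
    (fun x : measurableTypeR R => (c * x : measurableTypeR R)).
  exact: mulrl_measurable.
pose C : {nonneg R} := NngNum (ltW c0).
pose m := mscale C
  (measure_function_pushforward__canonical__measure_function_Measure
     (@lebesgue_measure R) mc).
have mE A : measurable A -> lebesgue_measure A = m A.
  apply: lebesgue_measure_unique => _ [[a b] _ <-] /=; rewrite -/(m _).
  have -> : m `]a, b]%classic = (c%:E * (@lebesgue_measure R)
    ((fun x : measurableTypeR R => (c * x)%R) @^-1` `]a, b]%classic))%E.
    reflexivity.
  have -> : (fun x : measurableTypeR R => c * x) @^-1` `]a, b]%classic
      = `]a / c, b / c]%classic.
    by apply/seteqP; split => x /=; rewrite !in_itv/= ltr_pdivrMr// ler_pdivlMr// mulrC.
  rewrite !lebesgue_measure_itv/= !lte_fin ltr_pM2r ?invr_gt0//.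
  case: ifP => _; last by rewrite mule0.
  by rewrite -EFinD -EFinM -mulrBl mulrCA mulfV ?gt_eqF// mulr1.
have -> : (\int[lebesgue_measure]_x f x = \int[m]_x f x)%E.
  by apply: eq_measure_integral => A mA _; exact: mE.
rewrite (ge0_integral_mscale _ measurableT)//.
rewrite (ge0_integral_pushforward mc)//.
rewrite preimage_setT muleA -EFinM mulVf ?gt_eqF// mul1e.
by [].
Qed.

(** Anisotropic dilations: the isotropic ones produce the radial averages, and
    those of the first block alone produce the moments of the sphere. *)
Definition dilate N (d : 'I_N -> R) (x : 'rV[R]_N) : 'rV[R]_N :=
  \row_i (d i * x ord0 i).

Lemma measurable_dilate N (d : 'I_N -> R) : measurable_fun setT (dilate d).
Proof.
apply: measurable_fun_coorP => i; under eq_fun do rewrite mxE.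
by apply: measurable_funM => //; exact: measurable_coor.
Qed.

Lemma ge0_integral_dilate N (d : 'I_N -> R) (f : 'rV[R]_N -> \bar R) :
  (forall i, 0 < d i) -> measurable_fun [set: 'rV[R]_N] f -> (forall x, 0 <= f x)%E ->
  (\int[lebesgue_rV N]_x f (dilate d x) =
   (\prod_i d i)^-1%:E * \int[lebesgue_rV N]_x f x)%E.
Proof.
elim: N d f => [|N IH] d f d0 mf f0.
  rewrite big_ord0 invr1 mul1e; apply: eq_integral => x _.
  by congr f; apply/rowP => -[].
rewrite !ge0_integral_rVS//; last first.
  by apply: measurableT_comp => //; exact: measurable_dilate.
have mfx x : measurable_fun setT (fun v => f (rV_cons (x, v))).
  apply: measurableT_comp => //; apply: measurableT_comp => //.
  exact: measurable_rV_cons.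
under eq_integral => x _.
  under eq_integral => v _.
    have -> : dilate d (rV_cons (x, v)) =
        rV_cons (d ord0 * x : measurableTypeR R, dilate (d \o lift ord0) v).
      apply/rowP => i; rewrite mxE; case: (unliftP ord0 i) => [j|] ->.
        by rewrite !rV_consS/= mxE.
      by rewrite !rV_cons0.
    over.
  rewrite (IH (d \o lift ord0) (fun v => f (rV_cons (d ord0 * x : measurableTypeR R, v))))//;
    last by move=> i; exact: d0.
  over.
pose H (x : measurableTypeR R) := (\int[lebesgue_rV N]_v f (rV_cons (x, v)))%E.
have mF : measurable_fun [set: measurableTypeR R] H.
  apply: (@measurable_fun_fubini_tonelli_F _ _ _ _ _ _ (fun z => f (rV_cons z))).
    by apply: measurableT_comp => //; exact: measurable_rV_cons.
  by move=> z; exact: f0.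
have H0 x : (0 <= H x)%E by apply: integral_ge0.
transitivity (\int[lebesgue_measure]_x
    ((\prod_(i < N) (d \o lift ord0) i)^-1%:E * H (d ord0 * x)%R))%E.
  reflexivity.
transitivity ((\prod_i d i)^-1%:E * \int[lebesgue_measure]_x H x)%E; last first.
  reflexivity.
move: (H) mF H0 => {}H mF H0.
have k0 : 0 <= (\prod_(i < N) (d \o lift ord0) i)^-1.
  by rewrite invr_ge0 prodr_ge0// => i _; rewrite ltW//; exact: d0.
have mH : measurable_fun setT (fun x : measurableTypeR R => H (d ord0 * x)).
  by apply: (measurableT_comp mF); exact: mulrl_measurable.
rewrite (ge0_integralZl_EFin _ measurableT _ mH k0); last by move=> x _; exact: H0.
rewrite (ge0_integral_scale (d0 ord0) mF H0).
by rewrite muleA -EFinM big_ord_recl invfM mulrC.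
Qed.

End rV_measure.

(** * Boxes, orthants and the product sigma-algebra *)

Section boxes.
Context {R : realType} {N : nat}.
Implicit Types (c d x : 'rV[R]_N) (Omega A : set 'rV[R]_N).
Local Notation mu := (@lebesgue_rV R N).

Definition obox c d : set 'rV[R]_N :=
  [set x | forall i, c ord0 i < x ord0 i < d ord0 i].

Definition cbox c d : set 'rV[R]_N :=
  [set x | forall i, c ord0 i <= x ord0 i <= d ord0 i].

Definition orthant c : set 'rV[R]_N := [set x | forall i, x ord0 i < c ord0 i].

Lemma measurable_coor_set (B : 'I_N -> set R) : (forall i, measurable (B i)) ->
  measurable [set x : 'rV[R]_N | forall i, B i (x ord0 i)].
Proof.
move=> mB; have -> : [set x : 'rV[R]_N | forall i, B i (x ord0 i)] =
    \big[setI/setT]_(i < N) ((fun x : 'rV[R]_N => x ord0 i) @^-1` B i).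
  rewrite -bigcap_seq; apply/seteqP; split => [x Bx i _|x Bx i]; first exact: Bx.
  by apply: Bx; rewrite /= mem_index_enum.
apply: bigsetI_measurable => i _; rewrite -[X in measurable X]setTI.
by apply: measurable_coor => //; exact: mB.
Qed.

Lemma coor_le_norm x i : `|x ord0 i| <= `|x|.
Proof.
by rewrite [leRHS]/Num.norm /= mx_normrE; apply/bigmax_geP; right => /=; exists (ord0, i).
Qed.

Lemma measurable_obox c d : measurable (obox c d).
Proof.
apply: (@measurable_coor_set (fun i => `]c ord0 i, d ord0 i[%classic)) => i.
exact: measurable_itv.
Qed.

Lemma measurable_orthant c : measurable (orthant c).
Proof.
apply: (@measurable_coor_set (fun i => `]-oo, c ord0 i[%classic)) => i.
exact: measurable_itv.
Qed.

Lemma open_measurable_rV A : open A -> measurable A.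
Proof.
move=> oA.
pose B (qk : 'rV[rat]_N * nat) : set 'rV[R]_N :=
  [set x | forall i, ball (ratr (qk.1 ord0 i) : R) (qk.2.+1%:R^-1) (x ord0 i)].
pose F qk := if `[< B qk `<=` A >] then B qk else set0.
have -> : A = \bigcup_qk F qk.
  apply/seteqP; split => [x Ax|x [qk _]]; last first.
    by rewrite /F; case: asboolP => // /(_ x).
  have /nbhs_ballP[e /= e0 xeA] : nbhs x A by move: oA; rewrite openE; apply.
  have [k ke] : exists k : nat, k.+1%:R^-1 < e / 2.
    have [k _ /(_ k (leqnn k)) ke] := near_infty_natSinv_lt (PosNum (divr_gt0 e0 (@ltr0Sn R 1))).
    by exists k.
  have hk : 0 < k.+1%:R^-1 :> R by rewrite invr_gt0.
  have /choice[q hq] (i : 'I_N) : exists q : rat, ball (ratr q : R) k.+1%:R^-1 (x ord0 i).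
    have xk : x ord0 i - k.+1%:R^-1 < x ord0 i + k.+1%:R^-1 by rewrite ltrD2l gtrN.
    have [q] := rat_in_itvoo xk.
    rewrite in_itv/= => /andP[q1 q2]; exists q.
    by rewrite /ball/= ltr_distl q1 q2.
  exists (\row_i q i, k) => //; rewrite /F asboolT.
    by move=> i /=; rewrite mxE; exact: hq.
  move=> y By; apply: xeA; split => // i j.
  have -> : i = ord0 by apply/val_inj; case: i => -[].
  have := hq j; have := By j; rewrite /ball/= mxE !ltr_distlC => /andP[a b] /andP[a' b'].
  move: (k.+1%:R^-1) (ratr _) ke a b a' b' => h r ke a b a' b'.
  by apply/andP; split; lra.
apply: countable_bigcupT_measurable => // qk.
rewrite /F; case: asboolP => // _.
apply: (@measurable_coor_set (fun i => ball (ratr (qk.1 ord0 i) : R) qk.2.+1%:R^-1)) => i.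
exact: measurable_ball.
Qed.

Lemma continuous_measurable_rV Omega (f : 'rV[R]_N -> R) : open Omega ->
  (forall x, Omega x -> {for x, continuous f}) -> measurable_fun Omega f.
Proof.
move=> oO cf; apply: (measurability _ (RGenOpens.measurableE R)).
move=> _ [_ [a [b ->] <-]]; apply: open_measurable_rV.
rewrite openE => x [Ox fx]; apply: filterI; first by move: oO; rewrite openE; apply.
by apply: (cf x Ox); apply: open_nbhs_nbhs; split => //; exact: interval_open.
Qed.

Lemma setI_closed_orthant : setI_closed (range orthant).
Proof.
move=> _ _ [c _ <-] [d _ <-].
exists (\row_i Num.min (c ord0 i) (d ord0 i)) => //.
apply/seteqP; split => [x /= H|x /= [H1 H2] i].
  by split => i; have := H i; rewrite mxE lt_min => /andP[].
by rewrite mxE lt_min H1 H2.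
Qed.

(** A half-space is the increasing union of the orthants with the same bound on
    its coordinate. *)
Lemma measurable_rV_orthants : @measurable _ 'rV[R]_N = <<s range orthant >>.
Proof.
apply/seteqP; split; last first.
  apply: smallest_sub; first exact: sigma_algebra_measurable.
  by move=> _ [c _ <-]; exact: measurable_orthant.
apply: smallest_sub; first exact: smallest_sigma_algebra.
rewrite -bigcup_seq => A [i _ [B mB <-]].
have SA : sigma_algebra setT
    (image_set_system setT (fun x : 'rV[R]_N => x ord0 i) <<s range orthant >>).
  exact/sigma_algebra_image/smallest_sigma_algebra.
have mE : @measurable _ R = (@RGenInftyO.G R).-sigma.-measurable.
  exact: RGenInftyO.measurableE.
suff : @measurable _ R `<=` image_set_system setT (fun x : 'rV[R]_N => x ord0 i)
    <<s range orthant >> by apply.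
rewrite mE; apply: smallest_sub => // _ [b ->].
rewrite /image_set_system /= setTI.
have -> : (fun x : 'rV[R]_N => x ord0 i) @^-1` `]-oo, b[%classic =
    \bigcup_k orthant (\row_j (if j == i then b else k%:R)).
  apply/seteqP; split => [x /=|x [k _] /(_ i)]; last by rewrite mxE eqxx /= in_itv.
  rewrite in_itv/= => xb.
  have [k hk] : exists k : nat, `|x| < k%:R.
    by exists (Num.truncn `|x|).+1; exact: truncnS_gt.
  exists k => // j; rewrite mxE; case: eqP => [->//|_].
  apply: le_lt_trans hk; apply: le_trans (ler_norm _) _.
  exact: (coor_le_norm x j).
pose T : measurableType _ := g_sigma_algebraType (range orthant).
apply: (@bigcupT_measurable _ T) => k.
by apply: sub_sigma_algebra; exists (\row_j (if j == i then b else k%:R)).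
Qed.

(** The sets on which the integral vanishes form a Dynkin system, and the traces
    of the orthants on a box are boxes. *)
Lemma obox_integral_eq0 c d (g : 'rV[R]_N -> R) :
  mu.-integrable (obox c d) (EFin \o g) ->
  (forall c' d', (forall i, c ord0 i <= c' ord0 i) ->
     (forall i, d' ord0 i <= d ord0 i) ->
     (\int[mu]_(x in obox c' d') (g x)%:E = 0)%E) ->
  {ae mu, forall x, obox c d x -> g x = 0}.
Proof.
move=> ig g0.
have mQ := measurable_obox c d.
have gE A : measurable A -> (\int[mu]_(x in obox c d `&` A) (g x)%:E = 0)%E.
  rewrite measurable_rV_orthants; move: A; apply: dynkin_induction.
  - exact: measurable_rV_orthants.
  - exact: setI_closed_orthant.
  - by rewrite setIT; exact: g0.
  - move=> _ [b _ <-].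
    rewrite (_ : _ `&` _ = obox c (\row_i Num.min (d ord0 i) (b ord0 i))).
      by apply: g0 => // i; rewrite mxE ge_min lexx.
    apply/seteqP; split => [x [/= xQ xb] i|x xQ].
      by rewrite mxE lt_min (xb i) andbT; exact: (xQ i).
    by split => i; have := xQ i; rewrite mxE lt_min => /and3P[] ? ? ?; [apply/andP|].
  - move=> S mS S0.
    have := integral_setU mu (measurableI _ _ mQ mS) (measurableI _ _ mQ (measurableC mS)) (f := EFin \o g).
    rewrite -setIUr setUCr setIT S0 add0e => <- //; first exact: g0.
      exact: (measurable_int _ ig).
    by apply/disj_setPS; rewrite setIACA setICr setI0.
  - move=> F mF tF F0; rewrite setI_bigcupr integral_bigcup.
    + by rewrite eseries0// => k _ _; exact: F0.
    + exact: trivIset_setIl.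
    + by move=> k; exact: measurableI.
    + apply: integrableS ig => //; first by apply: bigcupT_measurable => k; exact: measurableI.
      by apply: bigcup_sub => k _; exact: subIsetl.
have : ae_eq mu (obox c d) (EFin \o g) (cst 0%E).
  apply: integral_ae_eq => // E EQ mE; rewrite integral_cst// mul0e.
  by rewrite -(gE _ mE) setIidr.
by apply: filterS => x /= H xQ; have [] := H xQ.
Qed.

End boxes.

Lemma measurable_cbox (R : realType) (N : nat) (c d : 'rV[R]_N) :
  measurable (cbox c d).
Proof.
apply: (@measurable_coor_set _ _ (fun i => `[c ord0 i, d ord0 i]%classic)) => i.
exact: measurable_itv.
Qed.

Lemma lebesgue_rV_cbox (R : realType) (N : nat) (c d : 'rV[R]_N) :
  (forall i, c ord0 i <= d ord0 i) ->
  lebesgue_rV N (cbox c d) = (\prod_i (d ord0 i - c ord0 i))%:E.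
Proof.
elim: N c d => [|N IH] c d cd.
  by rewrite big_ord0 /= diracE mem_set// => -[].
rewrite /= /lebesgue_rV_step /pushforward.
pose c' : 'rV[R]_N := \row_i c ord0 (lift ord0 i).
pose d' : 'rV[R]_N := \row_i d ord0 (lift ord0 i).
have -> : @rV_cons R N @^-1` cbox c d =
    `[c ord0 ord0, d ord0 ord0]%classic `*` cbox c' d'.
  apply/seteqP; split => [z /= H|z /= [H1 H2] i].
    split; first by have := H ord0; rewrite rV_cons0 in_itv.
    by move=> i; have := H (lift ord0 i); rewrite rV_consS !mxE.
  case: (unliftP ord0 i) => [j|] ->; last by rewrite rV_cons0; move: H1; rewrite in_itv.
  by rewrite rV_consS; have := H2 j; rewrite !mxE.
rewrite product_measure1E.
- rewrite IH; last by move=> i; rewrite !mxE.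
  have E : @lebesgue_measure R [set` `[c ord0 ord0, d ord0 ord0]] =
      (d ord0 ord0 - c ord0 ord0)%:E.
    rewrite lebesgue_measure_itv/= lte_fin; case: ltP => // h.
    by rewrite (@le_anti _ _ (d ord0 ord0) (c ord0 ord0)) ?subrr// h cd.
  rewrite big_ord_recl EFinM -E; congr (_ * _%:E)%E.
  by apply: eq_bigr => i _; rewrite !mxE.
- exact: (@measurable_itv R).
- exact: measurable_cbox.
Qed.

Lemma cbox_lty (R : realType) (N : nat) (c d : 'rV[R]_N) :
  (lebesgue_rV N (cbox c d) < +oo)%E.
Proof.
pose d' : 'rV[R]_N := \row_i Num.max (c ord0 i) (d ord0 i).
have : (lebesgue_rV N (cbox c d) <= lebesgue_rV N (cbox c d'))%E.
  apply: le_measure; rewrite ?inE; [exact: measurable_cbox..|].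
  by move=> x H i; have /andP[a b] := H i; rewrite mxE le_max b orbT a.
move/le_lt_trans; apply; rewrite lebesgue_rV_cbox ?ltry// => i.
by rewrite mxE le_max lexx.
Qed.

(** * Radial averages *)

Lemma ae_imp2 d (T : measurableType d) (R : realType)
    (m : {measure set T -> \bar R}) (P Q S : T -> Prop) :
  (forall x, P x -> Q x -> S x) -> {ae m, forall x, P x} ->
  {ae m, forall x, Q x} -> {ae m, forall x, S x}.
Proof. by move=> H; exact: filterS2. Qed.

Section polar.
Context {R : realType}.
Local Notation mu N := (@lebesgue_rV R N).
Local Notation leb := (@lebesgue_measure R).

Lemma measurable_fun_sqrt : measurable_fun setT (@Num.sqrt R).
Proof. by apply: continuous_measurable_fun; exact: sqrt_continuous. Qed.

Lemma measurable_enorm N : measurable_fun setT (@enorm R N).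
Proof.
apply: (measurableT_comp measurable_fun_sqrt).
apply: measurable_sum => i; apply: measurable_funX; exact: measurable_coor.
Qed.

Lemma enorm_ge0 N (x : 'rV[R]_N) : 0 <= enorm x.
Proof. exact: sqrtr_ge0. Qed.

Lemma sqr_enorm N (x : 'rV[R]_N) : enorm x ^+ 2 = \sum_i x ord0 i ^+ 2.
Proof. by rewrite sqr_sqrtr// sumr_ge0// => i _; exact: sqr_ge0. Qed.

Lemma enormZ N (t : R) (x : 'rV[R]_N) : 0 <= t -> enorm (t *: x) = t * enorm x.
Proof.
move=> t0; rewrite /enorm.
under eq_bigr do rewrite mxE exprMn.
by rewrite -mulr_sumr sqrtrM ?sqr_ge0// sqrtr_sqr ger0_norm.
Qed.

Lemma coor_le_enorm N (x : 'rV[R]_N) i : `|x ord0 i| <= enorm x.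
Proof.
rewrite -sqrtr_sqr; apply: ler_wsqrtr.
by rewrite (bigD1 i)//= lerDl sumr_ge0// => j _; exact: sqr_ge0.
Qed.

Lemma enorm_eq0 N (x : 'rV[R]_N) : (enorm x == 0) = (x == 0).
Proof.
apply/eqP/eqP => [x0|->].
  apply/rowP => i; rewrite mxE; apply/eqP; rewrite -normr_le0 -x0.
  exact: coor_le_enorm.
rewrite /enorm big1 ?sqrtr0// => i _; by rewrite mxE expr0n.
Qed.

Lemma enorm_gt0 N (x : 'rV[R]_N) : (0 < enorm x) = (x != 0).
Proof. by rewrite lt_neqAle enorm_ge0 andbT eq_sym enorm_eq0. Qed.

Lemma dilate_cst N (t : R) (x : 'rV[R]_N) : dilate (fun=> t) x = t *: x.
Proof. by apply/rowP => i; rewrite !mxE. Qed.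

Lemma measurable_rV_set1 N (x : 'rV[R]_N) : measurable [set x].
Proof.
have -> : [set x] = [set y | forall i, [set x ord0 i] (y ord0 i)].
  apply/seteqP; split => [y -> //|y /= H].
  by apply/rowP => i; exact: H.
by apply: (@measurable_coor_set _ _ (fun i => [set x ord0 i])) => i; exact: measurable_set1.
Qed.

(** Dilation by 2 fixes the origin but multiplies measures by a power of 2. *)
Lemma lebesgue_rV_set0 N : mu N.+1 [set 0] = 0%E.
Proof.
have m0 := measurable_rV_set1 (0 : 'rV[R]_N.+1).
have H0 (x : 'rV[R]_N.+1) : (0 <= (\1_[set 0] x : R)%:E)%E by rewrite lee_fin.
have mI : measurable_fun setT (fun x : 'rV[R]_N.+1 => (\1_[set 0] x : R)%:E).
  by apply/measurable_EFinP; exact: measurable_indic.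
have := ge0_integral_dilate (d := fun=> 2) (fun=> ltr0Sn _ _) mI H0.
rewrite prodr_const card_ord.
have iE : (\int[mu N.+1]_x (\1_[set 0] x)%:E)%E = mu N.+1 [set 0].
  by rewrite integral_indic// setIT.
have -> : (\int[mu N.+1]_x (\1_[set 0] (dilate (fun=> 2%R) x))%:E)%E = mu N.+1 [set 0].
  rewrite -iE; apply: eq_integral => x _; congr (_%:E); rewrite !indicE dilate_cst.
  congr (_%:R); congr nat_of_bool; apply/idP/idP; rewrite !inE => /eqP.
    by rewrite scaler_eq0 pnatr_eq0/= => /eqP.
  by move=> /eqP ->; rewrite scaler0.
rewrite iE.
have : (mu N.+1 [set (0 : 'rV[R]_N.+1)%R] < +oo)%E.
  apply: le_lt_trans (cbox_lty (0 : 'rV[R]_N.+1) 0).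
  apply: le_measure; rewrite ?inE//.
    by apply: (@measurable_coor_set _ _ (fun i => `[(0 : 'rV[R]_N.+1) ord0 i, (0 : 'rV[R]_N.+1) ord0 i]%classic)) => i; exact: measurable_itv.
  by move=> _ -> i; rewrite lexx.
have : (0 <= mu N.+1 [set (0 : 'rV[R]_N.+1)%R])%E by [].
case: (mu N.+1 [set 0]) => // r _ _; rewrite -EFinM => -[e]; congr (_%:E).
have : (1 - (2 ^+ N.+1)^-1) * r = 0 by rewrite mulrBl mul1r -e subrr.
move/eqP; rewrite mulf_eq0 subr_eq0 => /orP[|/eqP//].
rewrite eq_sym invr_eq1 => /eqP e1; exfalso.
have : (1 : R) < 2 ^+ N.+1 by rewrite exprn_egt1// ltr1n.
by rewrite e1 ltxx.
Qed.

Definition pos_ind (t : R) : R := \1_(`]0, +oo[%classic : set R) t.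

Definition shell N : set 'rV[R]_N := [set y | 1 <= enorm y < 2].

Definition shell1 : set R := `[1, 2[%classic.

(** The measure [dt / t] of the dilations that bring a given nonzero point into
    the shell, that is, the logarithm of 2. *)
Definition polar_const : \bar R :=
  (\int[leb]_t (pos_ind t * t^-1 * \1_shell1 t^-1)%:E)%E.

Lemma pos_ind_gt0 t : 0 < t -> pos_ind t = 1.
Proof. by move=> t0; rewrite /pos_ind indicE mem_set//= in_itv/= t0. Qed.

Lemma pos_ind_le0 t : t <= 0 -> pos_ind t = 0.
Proof. by move=> t0; rewrite /pos_ind indicE memNset//= in_itv/= andbT; apply/negP; rewrite -leNgt. Qed.

Lemma pos_ind_ge0 t : 0 <= pos_ind t.
Proof. by rewrite /pos_ind indicE. Qed.

Lemma measurable_pos_ind : measurable_fun setT pos_ind.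
Proof. by apply: measurable_indic; exact: measurable_itv. Qed.

Lemma measurable_inv : measurable_fun setT (fun t : R => t^-1).
Proof.
have -> : (fun t : R => t^-1) = (fun t => if t == 0 then 0 else t^-1).
  by apply/funext => t; case: eqP => // ->; rewrite invr0.
apply: measurable_fun_if => //.
- apply: (measurable_fun_bool true); rewrite setTI.
  rewrite (_ : _ @^-1` _ = [set 0]); first exact: measurable_set1.
  by apply/seteqP; split => t /= /eqP.
- rewrite setTI (_ : _ @^-1` _ = [set~ 0]); last first.
    by apply/seteqP; split => t /=; [move/negbT/eqP|move/eqP/negbTE].
  apply: open_continuous_measurable_fun.
    by apply: closed_openC; exact: closed_eq.
  by move=> t /[!inE]/= /eqP t0; exact: inv_continuous.
Qed.

Lemma indic_shellZ N (c : R) (z : 'rV[R]_N) : 0 < c ->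
  \1_(@shell N) (c *: z) = \1_shell1 (c * enorm z) :> R.
Proof.
move=> c0; rewrite !indicE /shell /shell1; congr (_%:R); congr nat_of_bool.
by apply/idP/idP; rewrite !inE/= enormZ ?(ltW c0)// in_itv.
Qed.

Lemma measurable_shell N : measurable (@shell N).
Proof.
have -> : @shell N = setT `&` @enorm R N @^-1` shell1.
  by rewrite setTI; apply/seteqP; split => x; rewrite /shell/shell1/= in_itv.
by apply: measurable_enorm => //; exact: measurable_itv.
Qed.

Lemma polar_const_bounds : (2^-1%:E <= polar_const <= 1)%E.
Proof.
have I1 : leb `]2^-1, 1]%classic = (2^-1)%:E.
  rewrite lebesgue_measure_itv/= lte_fin ifT; last lra.
  by rewrite -EFinD; congr (_%:E); lra.
have mI : measurable (`]2^-1, 1]%classic : set (measurableTypeR R)) by exact: measurable_itv.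
have E t : pos_ind t * t^-1 * \1_shell1 t^-1 = \1_(`]2^-1, 1]%classic : set R) t * t^-1.
  rewrite !indicE; case: (ltP 0 t) => t0; last first.
    rewrite pos_ind_le0// !mul0r memNset ?mul0r//= in_itv/= => /andP[+ _].
    by lra.
  rewrite pos_ind_gt0// mul1r mulrC; congr (_%:R * _); congr nat_of_bool.
  apply/idP/idP; rewrite !inE/shell1/= !in_itv/= => /andP[a b].
    rewrite invf_plt ?posrE// b/=; by rewrite -(invrK t) invf_le1// invr_gt0.
  by rewrite invf_ge1// b/= invf_plt ?posrE.
have mm : measurable_fun setT (fun t : measurableTypeR R => (\1_(`]2^-1, 1]%classic : set R) t * t^-1)%:E).
  by apply/measurable_EFinP; apply: measurable_funM; [exact: measurable_indic|exact: measurable_inv].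
rewrite /polar_const; under eq_integral do rewrite E.
apply/andP; split.
  rewrite -I1 -[in leLHS](setIT `]2^-1, 1]%classic) -integral_indic//.
  apply: ge0_le_integral => //.
  - by apply/measurable_EFinP; exact: measurable_indic.
  - move=> t _; rewrite lee_fin indicE; case: (boolP (t \in _)) => [|_]; last by rewrite !mul0r.
    by rewrite inE/= in_itv/= => /andP[a b]; rewrite mul1r invf_ge1//; lra.
apply: (@le_trans _ _ (\int[leb]_t (2%:E * (\1_(`]2^-1, 1]%classic : set R) t)%:E))%E).
  apply: ge0_le_integral => //.
  - move=> t _; rewrite lee_fin indicE; case: (boolP (t \in _)) => [|_]; last by rewrite mul0r.
    by rewrite inE/= in_itv/= => /andP[a b]; rewrite mul1r invr_ge0; lra.
  - by apply/measurable_EFinP; apply: measurable_funM => //; exact: measurable_indic.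
  - move=> t _; rewrite -EFinM lee_fin indicE; case: (boolP (t \in _)) => [|_]; last by rewrite mul0r mulr0.
    rewrite inE/= in_itv/= => /andP[a b]; rewrite mul1r mulr1 invf_ple ?posrE//; lra.
rewrite ge0_integralZl_EFin//; last by apply/measurable_EFinP; exact: measurable_indic.
rewrite (_ : (\int[_]_x _)%E = 2^-1%:E); last first.
  by rewrite -I1 -[in RHS](setIT `]2^-1, 1]%classic) -integral_indic.
by rewrite -EFinM divff.
Qed.

Lemma measurable_scale_pair N :
  measurable_fun setT (fun z : 'rV[R]_N * measurableTypeR R => (z.2 : R) *: z.1).
Proof.
apply: measurable_fun_coorP => i; under eq_fun do rewrite mxE.
apply: measurable_funM; first exact: measurable_snd.
apply: (measurableT_comp (f := fun v : 'rV[R]_N => v ord0 i)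
      (g := fst : _ * measurableTypeR R -> _)).
  exact: measurable_coor.
exact: measurable_fst.
Qed.

Lemma measurable_scaler N (t : R) : measurable_fun setT (fun x : 'rV[R]_N => t *: x).
Proof.
apply: measurable_fun_coorP => i; under eq_fun do rewrite mxE.
by apply: measurable_funM => //; exact: measurable_coor.
Qed.

Lemma measurable_scale_ray N (y : 'rV[R]_N) :
  measurable_fun setT (fun t : measurableTypeR R => (t : R) *: y).
Proof.
apply: measurable_fun_coorP => i; under eq_fun do rewrite mxE.
by apply: measurable_funM.
Qed.

Lemma measurable_indic_shell N : measurable_fun setT (\1_(@shell N) : 'rV[R]_N -> R).
Proof. by apply: measurable_indic; exact: measurable_shell. Qed.

Lemma measurable_enormV N j : measurable_fun setT (fun y : 'rV[R]_N => (enorm y ^+ j)^-1).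
Proof.
apply: (measurableT_comp measurable_inv); apply: measurable_funX.
exact: measurable_enorm.
Qed.

Definition polar_integrand N (G : 'rV[R]_N.+1 -> R)
    (z : 'rV[R]_N.+1 * measurableTypeR R) : \bar R :=
  (\1_(@shell N.+1) z.1 * (pos_ind z.2 * z.2 ^+ N) * G ((z.2 : R) *: z.1))%:E.

Lemma polar_integrand_ge0 N (G : 'rV[R]_N.+1 -> R) z : (forall x, 0 <= G x) ->
  (0 <= polar_integrand G z)%E.
Proof.
move=> G0; rewrite lee_fin; have [t0|t0] := ltP 0 (z.2 : R).
  by rewrite !mulr_ge0 ?pos_ind_ge0 ?exprn_ge0 ?(ltW t0)// indicE.
by rewrite pos_ind_le0// mul0r mulr0 mul0r.
Qed.

Lemma measurable_polar_integrand N (G : 'rV[R]_N.+1 -> R) :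
  measurable_fun setT G -> measurable_fun setT (polar_integrand G).
Proof.
move=> mG; apply/measurable_EFinP; apply: measurable_funM; last first.
  by apply: (measurableT_comp mG); exact: measurable_scale_pair.
apply: measurable_funM.
  by apply: (measurableT_comp (@measurable_indic_shell N.+1)); exact: measurable_fst.
apply: measurable_funM.
  by apply: (measurableT_comp measurable_pos_ind); exact: measurable_snd.
by apply: measurable_funX; exact: measurable_snd.
Qed.

(** Polar coordinates without spherical measure: the unit sphere is replaced by
    a shell, and the radial variable by a dilation, so that only Tonelli and
    the scaling of Lebesgue measure are involved. *)
Lemma polar_coordinates N (G : 'rV[R]_N.+1 -> R) :
  measurable_fun setT G -> (forall x, 0 <= G x) ->
  (\int[mu N.+1]_y \int[leb]_t
     (\1_(@shell N.+1) y * (pos_ind t * t ^+ N) * G (t *: y))%:E =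
   polar_const * \int[mu N.+1]_x (G x)%:E)%E.
Proof.
move=> mG G0.
have i0 (T : Type) (A : set T) x : 0 <= \1_A x :> R by rewrite indicE.
have mpos := measurable_pos_ind; have minv := measurable_inv.
have msh := @measurable_indic_shell N.+1.
pose F := polar_integrand G.
have F0 z : (0 <= F z)%E by exact: polar_integrand_ge0.
have mF : measurable_fun setT F by exact: measurable_polar_integrand.
transitivity (\int[leb]_t \int[mu N.+1]_y F (y, t))%E.
  exact: (fubini_tonelli (m1 := mu N.+1) (m2 := leb) F mF F0).
pose H (z : measurableTypeR R * 'rV[R]_N.+1) : \bar R :=
  (pos_ind z.1 * z.1^-1 * \1_(@shell N.+1) ((z.1^-1 : R) *: z.2) * G z.2)%:E.
have H0 z : (0 <= H z)%E.
  rewrite lee_fin; have [t0|t0] := ltP 0 (z.1 : R); last by rewrite pos_ind_le0// !mul0r.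
  by rewrite !mulr_ge0// ?pos_ind_ge0// invr_ge0 ltW.
have mH : measurable_fun setT H.
  apply/measurable_EFinP; apply: measurable_funM; last first.
    by apply: (measurableT_comp mG); exact: measurable_snd.
  apply: measurable_funM.
    apply: measurable_funM.
      by apply: (measurableT_comp mpos); exact: measurable_fst.
    by apply: (measurableT_comp minv); exact: measurable_fst.
  apply: (measurableT_comp msh).
  apply: (measurableT_comp (f := fun z : 'rV[R]_N.+1 * measurableTypeR R => (z.2 : R) *: z.1)
     (g := fun z : measurableTypeR R * 'rV[R]_N.+1 => (z.2, z.1^-1 : measurableTypeR R))).
    exact: measurable_scale_pair.
  apply/measurable_fun_pairP; split; first exact: measurable_snd.
  by apply: (measurableT_comp minv); exact: measurable_fst.
transitivity (\int[leb]_t \int[mu N.+1]_z H (t, z))%E.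
  apply: eq_integral => t _.
  have [t0|t0] := ltP 0 (t : R); last first.
    rewrite !integral0_eq// => x _; rewrite /F/polar_integrand/H/= pos_ind_le0// ?mul0r//.
    by rewrite mulr0 mul0r.
  pose f z := (\1_(@shell N.+1) ((t^-1 : R) *: z) * (pos_ind t * t ^+ N) * G z)%:E.
  have f0 z : (0 <= f z)%E.
    by rewrite lee_fin !mulr_ge0// ?pos_ind_ge0// exprn_ge0// ltW.
  have mf : measurable_fun setT f.
    apply/measurable_EFinP; apply: measurable_funM => //; apply: measurable_funM => //.
    by apply: (measurableT_comp msh); exact: measurable_scaler.
  have := ge0_integral_dilate (d := fun=> t : R) (fun=> t0) mf f0.
  rewrite prodr_const card_ord => e.
  transitivity (\int[mu N.+1]_x f (dilate (fun=> t : R) x))%E.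
    apply: eq_integral => x _; rewrite /f/F/polar_integrand/= dilate_cst scalerA mulVf ?gt_eqF//.
    by rewrite scale1r.
  rewrite e -ge0_integralZl_EFin//; last by rewrite invr_ge0 exprn_ge0// ltW.
  apply: eq_integral => x _; rewrite /f/H/= -EFinM; congr (_%:E).
  rewrite pos_ind_gt0// exprS; have : (t : R) != 0 by rewrite gt_eqF.
  have : (t : R) ^+ N != 0 by rewrite expf_neq0// gt_eqF.
  move: (\1__ _) (G x) (t ^+ N : R) => a b c c0 t0'.
  by field; rewrite c0 t0'.
transitivity (\int[mu N.+1]_z \int[leb]_t H (t, z))%E.
  exact: (fubini_tonelli (m1 := leb) (m2 := mu N.+1) H mH H0).
have [c1 c2] := andP polar_const_bounds.
have cfin : polar_const \is a fin_num.
  by rewrite fin_real// (lt_le_trans _ c1)//= ?ltNyr// (le_lt_trans c2)// ltry.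
rewrite -(fineK cfin) -ge0_integralZl_EFin//; last 3 first.
- by move=> x _; rewrite lee_fin.
- exact/measurable_EFinP.
- by rewrite fine_ge0// (le_trans _ c1)// lee_fin invr_ge0.
apply: ge0_ae_eq_integral => //.
- exact: (measurable_fun_fubini_tonelli_G (m1 := leb) H mH H0).
- by apply/measurable_EFinP; apply: measurable_funM.
- by move=> z _; exact: integral_ge0.
- move=> z _; rewrite lee_fin mulr_ge0// fine_ge0// (le_trans _ c1)// lee_fin invr_ge0//.
exists [set 0]; split.
- exact: measurable_rV_set1.
- exact: lebesgue_rV_set0.
move=> z /= H1; apply: contrapT => z0; apply: H1 => _.
have {}z0 : 0 < enorm z by rewrite enorm_gt0; apply/eqP => ?; exact: z0.
pose k (t : R) : \bar R := (pos_ind t * t^-1 * \1_shell1 t^-1)%:E.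
have k0 t : (0 <= k t)%E.
  rewrite lee_fin; have [t0|t0] := ltP 0 t; last by rewrite pos_ind_le0// !mul0r.
  by rewrite !mulr_ge0// ?pos_ind_ge0// invr_ge0 ltW.
have mk : measurable_fun [set: measurableTypeR R] k.
  apply/measurable_EFinP; apply: measurable_funM; first exact: measurable_funM.
  have m1 : measurable_fun setT (\1_shell1 : R -> R).
    by apply: measurable_indic; exact: measurable_itv.
  exact: (measurableT_comp m1 minv).
rewrite fineK//.
transitivity (\int[leb]_t ((G z * (enorm z)^-1)%R%:E * k ((enorm z)^-1 * t)%R))%E.
  apply: eq_integral => t _; rewrite /H/k/= -EFinM; congr (_%:E).
  have [t0|t0] := ltP 0 (t : R); last first.
    rewrite !pos_ind_le0// ?mul0r ?mulr0//.
    by rewrite mulrC pmulr_lle0// invr_gt0.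
  rewrite !pos_ind_gt0// ?mulr_gt0// ?invr_gt0// indic_shellZ ?invr_gt0//.
  rewrite invfM invrK [enorm z * _]mulrC.
  move: (\1__ _) => a; field.
  by rewrite (gt_eqF t0) (gt_eqF z0).
rewrite ge0_integralZl_EFin//; last 2 first.
- by apply: (measurableT_comp mk); exact: mulrl_measurable.
- by rewrite mulr_ge0// invr_ge0 ltW.
rewrite (ge0_integral_scale _ mk k0) ?invr_gt0// invrK muleA -EFinM.
by rewrite mulfVK ?gt_eqF// muleC.
Qed.

Definition shell_int N (w : 'rV[R]_N -> R) : \bar R :=
  (\int[mu N]_y (\1_(@shell N) y * w y * (enorm y ^+ N)^-1)%:E)%E.

Definition homogeneous0 N (w : 'rV[R]_N -> R) :=
  forall t x, 0 < t -> w (t *: x) = w x.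

(** On almost every ray a radial function is a function of the distance alone,
    so its radial moment does not depend on the ray. *)
Lemma radial_ray_moment N (g : 'rV[R]_N.+1 -> R) (f : R -> R) :
  measurable_fun setT g -> (forall x, 0 <= g x) ->
  {ae mu N.+1, forall x, g x = f (enorm x)} ->
  exists2 L : \bar R, (0 <= L)%E &
    {ae mu N.+1, forall y, shell y ->
      (\int[leb]_t (pos_ind t * t ^+ N * g (t *: y))%:E =
       ((enorm y ^+ N.+1)^-1)%:E * L)%E}.
Proof.
move=> mg g0 [Z [mZ Z0 gZ]].
have mpos := measurable_pos_ind.
pose iZ : 'rV[R]_N.+1 -> R := \1_Z.
have miZ : measurable_fun setT iZ by exact: measurable_indic.
have iZ0 x : 0 <= iZ x by rewrite /iZ indicE.
pose P y := {ae leb, forall t, 0 < t -> ~ Z (t *: y)}.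
have Pae : {ae mu N.+1, forall y, shell y -> P y}.
  have := polar_coordinates miZ iZ0.
  have -> : (\int[mu N.+1]_x (iZ x)%:E = 0)%E by rewrite integral_indic// setIT.
  rewrite mule0 => I0.
  pose F := polar_integrand iZ.
  have F0 z : (0 <= F z)%E by exact: polar_integrand_ge0.
  have mF : measurable_fun setT F by exact: measurable_polar_integrand.
  have /(ae_eq_integral_abs (mu N.+1) measurableT) : measurable_fun setT
      (fun y => \int[leb]_t F (y, t))%E.
    exact: (measurable_fun_fubini_tonelli_F (m2 := leb) F mF F0).
  move=> [+ _]; have -> : (\int[mu N.+1]_x `|\int[leb]_t F (x, t)| = 0)%E.
    rewrite -[RHS]I0; apply: eq_integral => y _; rewrite gee0_abs//.
    exact: integral_ge0.
  move=> /(_ erefl); apply: filterS => y /= /(_ I) I1 sy.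
  have mFy : measurable_fun [set: measurableTypeR R] (fun t => F (y, t)).
    by apply: measurableT_comp mF _; exact: measurable_pair1.
  have [+ _] := ae_eq_integral_abs leb measurableT mFy.
  have -> : (\int[leb]_x `|F (y, x)| = 0)%E.
    by rewrite -[RHS]I1; apply: eq_integral => t _; rewrite gee0_abs.
  move=> /(_ erefl); apply: filterS => t /= /(_ I) + t0 Zty.
  rewrite /F/polar_integrand/= /iZ !indicE (mem_set sy) (mem_set Zty) pos_ind_gt0// => -[].
  by move=> /eqP; rewrite !mul1r mulr1 expf_eq0 (gt_eqF t0) andbF.
have [[y0 [sy0 Py0]]|noP] := pselect (exists y0, shell y0 /\ P y0); last first.
  exists 0%E => //; apply: filterS Pae => y Py sy; exfalso; apply: noP.
  by exists y; split => //; exact: Py.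
pose h y (s : R) : \bar R := (pos_ind s * s ^+ N * g (s *: ((enorm y)^-1 *: y)))%:E.
have h0 y s : (0 <= h y s)%E.
  rewrite lee_fin; have [t0|t0] := ltP 0 s; last by rewrite pos_ind_le0// !mul0r.
  by rewrite !mulr_ge0// ?pos_ind_ge0 ?exprn_ge0 ?ltW.
have mh y : measurable_fun [set: measurableTypeR R] (h y).
  apply/measurable_EFinP; apply: measurable_funM.
    by apply: measurable_funM => //; exact: measurable_funX.
  by apply: (measurableT_comp mg); exact: measurable_scale_ray.
have hE y : shell y -> P y -> {ae leb, forall s, h y s = (pos_ind s * s ^+ N * f s)%:E}.
  move=> /andP[y1 _] [A [mA A0 AZ]].
  have y0' : 0 < enorm y by exact: lt_le_trans ltr01 y1.
  pose iA : R -> \bar R := EFin \o \1_A.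
  have iA0 s : (0 <= iA s)%E by rewrite lee_fin indicE.
  have miA : measurable_fun [set: measurableTypeR R] iA.
    by apply/measurable_EFinP; exact: measurable_indic.
  have yi0 : 0 < (enorm y)^-1 by rewrite invr_gt0.
  have := ge0_integral_scale yi0 miA iA0.
  have -> : (\int[leb]_x (iA x) = 0)%E by rewrite /iA integral_indic// setIT.
  rewrite mule0 => I0.
  have mB : measurable_fun [set: measurableTypeR R] (fun s => iA ((enorm y)^-1 * s)).
    by apply: (measurableT_comp miA); exact: mulrl_measurable.
  have [+ _] := ae_eq_integral_abs leb measurableT mB.
  have -> : (\int[leb]_x `|iA ((enorm y)^-1 * x)%R| = 0)%E.
    by rewrite -[RHS]I0; apply: eq_integral => t _; rewrite gee0_abs.
  move=> /(_ erefl); apply: filterS => s /= /(_ I) + .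
  rewrite /iA/= indicE; case: (boolP (_ \in A)) => [_ []/eqP|]; first by rewrite oner_eq0.
  rewrite notin_setE => nA _; rewrite /h; have [s0|s0] := ltP 0 s; last first.
    by rewrite pos_ind_le0// !mul0r.
  congr (_ * _)%:E; rewrite scalerA mulrC.
  have : ~ Z (((enorm y)^-1 * s) *: y).
    apply: contrapT => /contrapT Zs; apply: nA; apply: AZ => /= /(_ _).
    by apply => //; rewrite mulr_gt0.
  move=> nZ; apply: contrapT => gf; apply: nZ; apply: gZ => /=.
  by rewrite enormZ ?mulr_ge0 ?ltW// mulrAC mulVf ?gt_eqF// mul1r.
have hI y : shell y -> P y -> (\int[leb]_s h y s = \int[leb]_s h y0 s)%E.
  move=> sy Py; apply: ge0_ae_eq_integral => //.
  have A1 := hE y sy Py; have A2 := hE y0 sy0 Py0.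
  by apply: (ae_imp2 (m := leb) _ A1 A2) => s -> -> _.
exists (\int[leb]_s h y0 s)%E; first exact: integral_ge0.
apply: filterS Pae => y Py sy; rewrite -(hI y sy (Py sy)).
have y0' : 0 < enorm y by case/andP: sy => y1 _; exact: lt_le_trans ltr01 y1.
have := ge0_integral_scale y0' (mh y) (h0 y).
move=> /(congr1 (fun x => ((enorm y ^+ N)^-1)%:E * x)%E).
rewrite muleA -EFinM -invfM -exprSr => <-.
rewrite -ge0_integralZl_EFin//; last 2 first.
- by apply: (measurableT_comp (mh y)); exact: mulrl_measurable.
- by rewrite invr_ge0 exprn_ge0// ltW.
apply: eq_integral => t _; rewrite /h -EFinM; congr (_%:E).
rewrite scalerA [_ * t]mulrC mulfK ?gt_eqF//.
have [t0|t0] := ltP 0 (t : R); last first.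
  by rewrite !pos_ind_le0 ?mul0r ?mulr0// mulr_le0_ge0// ltW.
rewrite !pos_ind_gt0 ?mulr_gt0// exprMn.
have : enorm y ^+ N != 0 by rewrite expf_neq0// gt_eqF.
by move: (g _) (t ^+ N : R) => a b c0; field.
Qed.

Lemma radial_average_aux N (g w : 'rV[R]_N.+1 -> R) (f : R -> R) :
  measurable_fun setT g -> (forall x, 0 <= g x) ->
  {ae mu N.+1, forall x, g x = f (enorm x)} ->
  measurable_fun setT w -> (forall x, 0 <= w x) -> homogeneous0 w ->
  (\int[mu N.+1]_x (g x * w x)%:E * @shell_int N.+1 (cst 1%R) =
   \int[mu N.+1]_x (g x)%:E * shell_int w)%E.
Proof.
move=> mg g0 gf mw w0 hw.
have [L L0 HL] := radial_ray_moment mg g0 gf.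
have msh := @measurable_indic_shell N.+1.
have mi := @measurable_enormV N.+1 N.+1.
have key (v : 'rV[R]_N.+1 -> R) : measurable_fun setT v -> (forall x, 0 <= v x) ->
    homogeneous0 v ->
    (polar_const * \int[mu N.+1]_x (g x * v x)%:E = shell_int v * L)%E.
  move=> mv v0 hv.
  have mgv : measurable_fun setT (fun x => g x * v x) by exact: measurable_funM.
  have gv0 x : 0 <= g x * v x by exact: mulr_ge0.
  rewrite -polar_coordinates//.
  have s0 y : 0 <= \1_(@shell N.+1) y :> R by rewrite indicE.
  have q0 y : 0 <= (\1_(@shell N.+1) y * v y * (enorm y ^+ N.+1)^-1).
    by rewrite !mulr_ge0// invr_ge0 exprn_ge0// enorm_ge0.
  have mq : measurable_fun setT (fun y => (\1_(@shell N.+1) y * v y * (enorm y ^+ N.+1)^-1)%:E).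
    by apply/measurable_EFinP; apply: measurable_funM => //; exact: measurable_funM.
  rewrite -ge0_integralZr//; last by move=> y _; rewrite lee_fin.
  have mF : measurable_fun setT (fun y => (\int[leb]_t
     (\1_(@shell N.+1) y * (pos_ind t * t ^+ N) * (g (t *: y) * v (t *: y)))%:E)%E).
    apply: (measurable_fun_fubini_tonelli_F (m2 := leb)
      (polar_integrand (fun x => g x * v x)) (measurable_polar_integrand mgv)).
    by move=> z; exact: polar_integrand_ge0.
  apply: ge0_ae_eq_integral => //.
  - by apply: emeasurable_funM.
  - move=> y _; apply: integral_ge0 => t _.
    exact: (polar_integrand_ge0 (y, t) gv0).
  - by move=> y _; rewrite mule_ge0// lee_fin.
  apply: filterS HL => y Hy _.
  have [sy|sy] := pselect (shell y); last first.
    rewrite !indicE memNset// !mul0r mul0e.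
    by apply: integral0_eq => t _; rewrite !mul0r.
  rewrite EFinM -muleA -Hy// -ge0_integralZl_EFin//; last 3 first.
  - move=> t _; rewrite lee_fin; have [t0|t0] := ltP 0 t.
      by rewrite !mulr_ge0// ?pos_ind_ge0 ?exprn_ge0 ?ltW.
    by rewrite pos_ind_le0// !mul0r.
  - apply/measurable_EFinP; apply: measurable_funM.
      by apply: measurable_funM; [exact: measurable_pos_ind|exact: measurable_funX].
    by apply: (measurableT_comp mg); exact: measurable_scale_ray.
  - by rewrite mulr_ge0.
  apply: eq_integral => t _; rewrite -EFinM; congr (_%:E).
  have [t0|t0] := ltP 0 t; last by rewrite pos_ind_le0// !(mul0r,mulr0).
  by rewrite hv//; move: (\1__ _) (pos_ind t) (g _) (v _) => a b c d; ring.
have [c1 c2] := andP polar_const_bounds.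
have cfin : polar_const \is a fin_num.
  by rewrite fin_real// (lt_le_trans _ c1)//= ?ltNyr// (le_lt_trans c2)// ltry.
have K1 := key w mw w0 hw.
have K2 : (polar_const * \int[mu N.+1]_x (g x)%:E = @shell_int N.+1 (cst 1%R) * L)%E.
  rewrite -(key (cst 1))//=; congr (_ * _)%E.
  by apply: eq_integral => x _; rewrite mulr1.
have cne : polar_const != 0%E by rewrite gt_eqF// (lt_le_trans _ c1).
have inj a b : (polar_const * a = polar_const * b -> a = b)%E.
  have c0 : fine polar_const != 0 by rewrite fine_eq0.
  move=> /(congr1 (fun z => (fine polar_const)^-1%:E * z)%E).
  by rewrite -(fineK cfin) !muleA -!EFinM mulVf// !mul1e.
apply: inj; rewrite !muleA K1 K2 -!muleA; rewrite [RHS]muleCA.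
by rewrite muleCA [(shell_int w * _)%E]muleC.
Qed.

Lemma shell_int_bounds N (w : 'rV[R]_N -> R) : measurable_fun setT w ->
  (forall x, 0 <= w x <= 1) -> (0 <= shell_int w <= @shell_int N (cst 1%R))%E.
Proof.
move=> mw w01.
have s0 y : 0 <= \1_(@shell N) y :> R by rewrite indicE.
have e0 y : 0 <= (enorm y ^+ N)^-1 :> R by rewrite invr_ge0 exprn_ge0// enorm_ge0.
have msh := @measurable_indic_shell N.
have mi := @measurable_enormV N N.
apply/andP; split.
  apply: integral_ge0 => y _; rewrite lee_fin !mulr_ge0//.
  by case/andP: (w01 y).
apply: ge0_le_integral => //.
- by move=> y _; rewrite lee_fin !mulr_ge0//; case/andP: (w01 y).
- by apply/measurable_EFinP; apply: measurable_funM => //; exact: measurable_funM.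
- by apply/measurable_EFinP; apply: measurable_funM => //; exact: measurable_funM.
- move=> y _; rewrite lee_fin ler_wpM2r// ler_wpM2l//.
  by case/andP: (w01 y).
Qed.

Lemma shell_box N : exists c d : 'rV[R]_N.+1,
  (forall i, c ord0 i < d ord0 i) /\ cbox c d `<=` @shell N.+1.
Proof.
pose q := Num.sqrt N.+1%:R : R.
have q0 : 0 < q by rewrite sqrtr_gt0.
(* coordinates near [r / q] give a norm near [r]; the endpoints 11/10 and 19/10
   lie strictly inside the range of the shell *)
exists (const_mx (11 / 10 / q)), (const_mx (19 / 10 / q)); split.
  by move=> i; rewrite !mxE ltr_pM2r ?invr_gt0//; lra.
have E (r : R) : 0 <= r -> Num.sqrt (\sum_(i < N.+1) (r / q) ^+ 2) = r.
  move=> r0; rewrite sumr_const card_ord -mulr_natr expr_div_n sqr_sqrtr//.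
  by rewrite mulfVK ?pnatr_eq0// sqrtr_sqr ger0_norm.
have a0 : (0 : R) <= 11 / 10 by lra.
have b0 : (0 : R) <= 19 / 10 by lra.
move=> x H; have x0 i : 0 <= x ord0 i.
  have /andP[h _] := H i; apply: le_trans h; rewrite mxE.
  by rewrite mulr_ge0// invr_ge0 ltW.
apply/andP; split.
  apply: (@le_trans _ _ (11 / 10)); first lra.
  rewrite -(E _ a0) ler_wsqrtr// ler_sum// => i _.
  have := H i; rewrite !mxE => /andP[h _].
  by rewrite lerXn2r// ?nnegrE// mulr_ge0// invr_ge0 ltW.
apply: (@le_lt_trans _ _ (19 / 10)); last lra.
rewrite -(E _ b0) ler_wsqrtr// ler_sum// => i _.
have := H i; rewrite !mxE => /andP[_ h].
by rewrite lerXn2r// ?nnegrE// mulr_ge0// invr_ge0 ltW.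
Qed.

Lemma shell_sub_cbox N : @shell N `<=` cbox (const_mx (-2)) (const_mx 2).
Proof.
move=> x /andP[_ x2] i; rewrite !mxE -ler_norml.
by apply: le_trans (coor_le_enorm x i) (ltW x2).
Qed.

Lemma shell_gt0 N : (0 < N)%N -> (0 < mu N (@shell N))%E.
Proof.
case: N => // N _; have [c [d [cd cdS]]] := shell_box N.
apply: (@lt_le_trans _ _ (mu N.+1 (cbox c d))).
  rewrite lebesgue_rV_cbox => [|i]; last exact: ltW.
  by rewrite lte_fin prodr_gt0// => i _; rewrite subr_gt0.
by apply: le_measure; rewrite ?inE//; [exact: measurable_cbox|exact: measurable_shell].
Qed.

Lemma shell_int1_fin N : (0 < N)%N -> (0 < @shell_int N (cst 1%R) < +oo)%E.
Proof.
move=> N0.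
have msh := @measurable_indic_shell N.
have mi := @measurable_enormV N N.
have e0 y : 0 <= (enorm y ^+ N)^-1 :> R by rewrite invr_ge0 exprn_ge0// enorm_ge0.
have mS := @measurable_shell N.
have iS : (\int[mu N]_y (\1_(@shell N) y)%:E = mu N (@shell N))%E.
  by rewrite integral_indic// setIT.
have m1 : measurable_fun setT (fun y => (\1_(@shell N) y * 1 * (enorm y ^+ N)^-1)%:E).
  by apply/measurable_EFinP; apply: measurable_funM => //; exact: measurable_funM.
apply/andP; split.
  apply: (@lt_le_trans _ _ ((2 ^+ N)^-1%:E * mu N (@shell N))%E).
    by rewrite mule_gt0 ?shell_gt0// lte_fin invr_gt0 exprn_gt0.
  rewrite -iS -ge0_integralZl_EFin//; first last.
  - by apply/measurable_EFinP.
  apply: ge0_le_integral => //.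
  - by apply/measurable_EFinP; apply: measurable_funM.
  - move=> y _; rewrite -EFinM lee_fin mulr1 indicE.
    have [|_] := boolP (y \in _); last by rewrite mulr0 mul0r.
    rewrite inE => /andP[y1 y2]; rewrite mulr1 mul1r lef_pV2 ?posrE ?exprn_gt0//; last first.
      exact: lt_le_trans ltr01 y1.
    by rewrite lerXn2r ?nnegrE ?enorm_ge0// ltW.
apply: (@le_lt_trans _ _ (mu N (@shell N))); last first.
  apply: le_lt_trans (cbox_lty (const_mx (-2) : 'rV[R]_N) (const_mx 2)).
  by apply: le_measure; rewrite ?inE//; [exact: measurable_cbox|exact: shell_sub_cbox].
rewrite -iS; apply: ge0_le_integral => //.
- by move=> y _; rewrite lee_fin !mulr_ge0// indicE.
- by apply/measurable_EFinP.
- move=> y _; rewrite lee_fin mulr1 indicE.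
  have [|_] := boolP (y \in _); last by rewrite mul0r.
  rewrite inE => /andP[y1 y2]; rewrite mul1r invf_le1 ?exprn_ege1//.
  by rewrite exprn_gt0// (lt_le_trans ltr01 y1).
Qed.

(** The weight in [shell_int] makes this the mean over the unit sphere when [w] is
    homogeneous of degree 0. *)
Definition dir_average N (w : 'rV[R]_N -> R) : R :=
  fine (shell_int w) / fine (@shell_int N (cst 1%R)).

(** In polar coordinates the radial moment of [g] is the same on almost every
    ray, so it factors out of the integral; the comparison with [w = 1]
    eliminates it. *)
Lemma radial_average N (g w : 'rV[R]_N -> R) (f : R -> R) : (0 < N)%N ->
  measurable_fun setT g -> (forall x, 0 <= g x) ->
  {ae mu N, forall x, g x = f (enorm x)} ->
  measurable_fun setT w -> (forall x, 0 <= w x <= 1) -> homogeneous0 w ->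
  (\int[mu N]_x (g x * w x)%:E = (dir_average w)%:E * \int[mu N]_x (g x)%:E)%E.
Proof.
case: N g w => // N g w N0 mg g0 gf mw w01 hw.
have w0 x : 0 <= w x by case/andP: (w01 x).
have := radial_average_aux mg g0 gf mw w0 hw.
have /andP[S0 Soo] := shell_int1_fin N0.
have /andP[W0 W1] := shell_int_bounds mw w01.
have Sfin : @shell_int N.+1 (cst 1%R) \is a fin_num by rewrite ge0_fin_numE// ltW.
have Wfin : shell_int w \is a fin_num.
  by rewrite ge0_fin_numE//; exact: le_lt_trans Soo.
have s0 : fine (@shell_int N.+1 (cst 1%R)) != 0 by rewrite fine_eq0// gt_eqF.
rewrite -(fineK Sfin) -(fineK Wfin).
move=> /(congr1 (fun z => z * (fine (@shell_int N.+1 (cst 1%R)))^-1%:E)%E).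
rewrite -!muleA -!EFinM divff// mule1 => ->.
by rewrite muleC.
Qed.

End polar.

(** * Second and fourth moments of the direction *)

Section moments.
Context {R : realType} {N : nat}.
Local Notation mu := (@lebesgue_rV R N).
Implicit Types (P : pred 'I_N) (x : 'rV[R]_N).

Definition sqsum P x : R := \sum_(i | P i) x ord0 i ^+ 2.

Lemma sqsum_ge0 P x : 0 <= sqsum P x.
Proof. by apply: sumr_ge0 => i _; exact: sqr_ge0. Qed.

Lemma measurable_sqsum P : measurable_fun setT (sqsum P).
Proof.
rewrite /sqsum; under eq_fun do rewrite big_mkcond /=.
apply: measurable_sum => i; case: (P i) => //.
by apply: measurable_funX; exact: measurable_coor.
Qed.

Lemma sqsumC P x : sqsum P x + sqsum (predC P) x = enorm x ^+ 2.
Proof. by rewrite sqr_enorm [RHS](bigID P). Qed.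

Lemma sqsum_le P x : sqsum P x <= enorm x ^+ 2.
Proof. by rewrite -(sqsumC P) lerDl sqsum_ge0. Qed.

Lemma sqsumZ P (t : R) x : sqsum P (t *: x) = t ^+ 2 * sqsum P x.
Proof. by rewrite /sqsum mulr_sumr; apply: eq_bigr => i _; rewrite mxE exprMn. Qed.

Definition disk : set 'rV[R]_N := [set x | enorm x < 2].

(** The positive part of [4 - |x| ^ 2]: a radial function whose derivative in
    [|x| ^ 2] is minus the indicator of the disk, and convex in [|x| ^ 2]. *)
Definition cone x : R := \1_disk x * (4 - enorm x ^+ 2).

Lemma diskE x : disk x <-> enorm x ^+ 2 < 4.
Proof.
rewrite /disk /=; have -> : (4 : R) = 2 ^+ 2 by rewrite expr2; lra.
by rewrite ltr_sqr ?nnegrE ?enorm_ge0.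
Qed.

Lemma measurable_disk : measurable disk.
Proof.
have -> : disk = setT `&` @enorm R N @^-1` `]-oo, 2[%classic.
  by rewrite setTI; apply/seteqP; split => x; rewrite /disk/= in_itv.
by apply: measurable_enorm => //; exact: measurable_itv.
Qed.

Lemma measurable_cone : measurable_fun setT cone.
Proof.
apply: measurable_funM; first by apply: measurable_indic; exact: measurable_disk.
apply: measurable_funB => //; apply: measurable_funX; exact: measurable_enorm.
Qed.

(** The tangent line of a convex function lies below its graph. *)
Lemma cone_convex x y : cone y >= cone x - \1_disk x * (enorm y ^+ 2 - enorm x ^+ 2).
Proof.
rewrite /cone !indicE.
have [xd|xd] := boolP (x \in disk); have [yd|yd] := boolP (y \in disk); rewrite ?mul1r ?mul0r; try lra.
  move: yd; rewrite notin_setE => /diskE/negP; rewrite -leNgt; lra.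
by move: yd; rewrite inE => /diskE; lra.
Qed.

Lemma integrable_disk (f : 'rV[R]_N -> R) (M : R) : measurable_fun setT f ->
  (forall x, `|f x| <= M * \1_disk x) -> mu.-integrable setT (EFin \o f).
Proof.
move=> mf fM; have mD := measurable_disk.
apply: (@le_integrable _ _ _ mu setT measurableT _ (EFin \o (fun x => M * \1_disk x))) => //.
- exact/measurable_EFinP.
- move=> x _ /=; rewrite lee_fin; apply: le_trans (fM x) _; exact: ler_norm.
- apply: (integrableZl (f := EFin \o \1_disk) measurableT M).
  apply/integrableP; split; first exact/measurable_EFinP.
  under eq_integral => x _ do rewrite /= ger0_norm ?indicE ?ler0n// -indicE.
  rewrite integral_indic// setIT.
  apply: le_lt_trans (cbox_lty (const_mx (-2) : 'rV[R]_N) (const_mx 2)).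
  apply: le_measure; rewrite ?inE//; first exact: measurable_cbox.
  move=> x xd i; rewrite !mxE -ler_norml.
  by apply: le_trans (coor_le_enorm x i) (ltW xd).
Qed.

Definition mom P j k (h : 'rV[R]_N -> R) : R :=
  (\int[mu]_x (sqsum P x ^+ j * sqsum (predC P) x ^+ k * h x))%R.

Lemma measurable_mom P j k (h : 'rV[R]_N -> R) : measurable_fun setT h ->
  measurable_fun setT (fun x => sqsum P x ^+ j * sqsum (predC P) x ^+ k * h x).
Proof.
move=> mh; apply: measurable_funM => //.
by apply: measurable_funM; apply: measurable_funX; exact: measurable_sqsum.
Qed.

Lemma integrable_mom P j k (h : 'rV[R]_N -> R) : measurable_fun setT h ->
  (forall x, 0 <= h x <= 4 * \1_disk x) ->
  mu.-integrable setT (EFin \o (fun x => sqsum P x ^+ j * sqsum (predC P) x ^+ k * h x)).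
Proof.
move=> mh h4; apply: (@integrable_disk _ (4 ^+ j * 4 ^+ k * 4)).
  exact: measurable_mom.
move=> x; have /andP[h0 h1] := h4 x.
rewrite ger0_norm ?mulr_ge0// ?exprn_ge0 ?sqsum_ge0//.
move: h1; rewrite indicE; have [|_ h1] := boolP (x \in disk); last first.
  have -> : h x = 0 by apply/le_anti; rewrite h0 andbT; move: h1; rewrite mulr0.
  by rewrite !mulr0.
rewrite inE => xd; rewrite !mulr1 => h1.
have S4 Q : sqsum Q x <= 4 by apply: le_trans (sqsum_le Q x) _; apply/ltW/diskE.
rewrite ler_pM ?mulr_ge0 ?exprn_ge0 ?sqsum_ge0//.
by rewrite ler_pM ?exprn_ge0 ?sqsum_ge0// lerXn2r// nnegrE ?sqsum_ge0.
Qed.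

Lemma cone_bounds x : 0 <= cone x <= 4 * \1_disk x.
Proof.
rewrite /cone indicE; have [|] := boolP (x \in disk); last by rewrite mul0r mulr0 lexx.
by rewrite inE => /diskE; have := sqr_ge0 (enorm x) => *; rewrite mul1r mulr1; apply/andP; split; lra.
Qed.

Lemma disk_bounds x : 0 <= (\1_disk x : R) <= 4 * \1_disk x.
Proof. by rewrite indicE; case: (_ \in _); rewrite ?mulr1 ?mulr0 ?lexx// ler01 ler1n. Qed.

(** Dilating the block of coordinates in [P] multiplies the moment by a power
    of the ratio, while by convexity it changes it by at least its first-order
    variation; so the two derivatives at ratio 1 agree. *)
Lemma moment_recursion P j k :
  (#|P|%:R + 2 * j%:R) * mom P j k cone = 2 * mom P j.+1 k (\1_disk : _ -> R).
Proof.
set A := mom P j k cone; set B := mom P j.+1 k _; set q := (#|P| + 2 * j)%N.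
have mdisk : measurable_fun setT (\1_disk : 'rV[R]_N -> R).
  by apply: measurable_indic; exact: measurable_disk.
have mcone := measurable_cone.
have key (v : R) : 0 < v -> 0 <= A * v ^+ q.+2 - (A + B) * v ^+ 2 + B.
  move=> v0; pose l := v^-1; have l0 : 0 < l by rewrite invr_gt0.
  pose d (i : 'I_N) := if P i then l else 1.
  have d0 i : 0 < d i by rewrite /d; case: (P i).
  pose f x := sqsum P x ^+ j * sqsum (predC P) x ^+ k * cone x.
  have f0 x : 0 <= f x.
    have /andP[c0 _] := cone_bounds x.
    apply: mulr_ge0 => //.
    by apply: mulr_ge0; apply: exprn_ge0; exact: sqsum_ge0.
  have mf : measurable_fun setT f by exact: measurable_mom.
  have If := integrable_mom P j k mcone cone_bounds.
  have sP x : sqsum P (dilate d x) = l ^+ 2 * sqsum P x.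
    rewrite /sqsum mulr_sumr; apply: eq_bigr => i Pi.
    by rewrite mxE /d Pi exprMn.
  have sC x : sqsum (predC P) (dilate d x) = sqsum (predC P) x.
    rewrite /sqsum; apply: eq_bigr => i /negbTE Pi.
    by rewrite mxE /d Pi mul1r.
  have fd x : f (dilate d x) >= l ^+ (2 * j) * (f x -
      (l ^+ 2 - 1) * (sqsum P x ^+ j.+1 * sqsum (predC P) x ^+ k * \1_disk x)).
    rewrite /f sP sC exprMn -exprM -!mulrA ler_wpM2l ?exprn_ge0 ?(ltW l0)//.
    have -> : sqsum P x ^+ j * (sqsum (predC P) x ^+ k * cone x) -
       (l ^+ 2 - 1) * (sqsum P x ^+ j.+1 * (sqsum (predC P) x ^+ k * \1_disk x)) =
       sqsum P x ^+ j * (sqsum (predC P) x ^+ k * (cone x - \1_disk x *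
        ((l ^+ 2 - 1) * sqsum P x))).
      rewrite (exprS (sqsum P x) j); move: (cone x) (\1_disk x) (sqsum P x ^+ j) (sqsum P x)
        (sqsum (predC P) x ^+ k) => a b c e h; ring.
    rewrite ler_wpM2l ?exprn_ge0 ?sqsum_ge0// ler_wpM2l ?exprn_ge0 ?sqsum_ge0//.
    have := cone_convex x (dilate d x).
    by rewrite -!(sqsumC P) sP sC; congr (_ - _ * _ <= _); ring.
  have := ge0_integral_dilate d0 (f := EFin \o f) (proj2 (measurable_EFinP _ _) mf).
  have f0' x : (0 <= (EFin \o f) x)%E by rewrite lee_fin.
  move=> /(_ f0') E.
  have dprod : \prod_i d i = l ^+ #|P|.
    by rewrite /d -big_mkcond/= prodr_const.
  have Afin : (\int[mu]_x (f x)%:E = A%:E)%E.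
    by rewrite /A /mom /Rintegral fineK//; exact: integrable_fin_num.
  have mfd : measurable_fun setT (f \o dilate d).
    by apply: measurableT_comp => //; exact: measurable_dilate.
  have Ifd : mu.-integrable setT (EFin \o (f \o dilate d)).
    apply/integrableP; split; first exact/measurable_EFinP.
    under eq_integral do rewrite /= ger0_norm//.
    by rewrite E Afin -EFinM ltry.
  have IB := integrable_mom P j.+1 k mdisk disk_bounds.
  have I1 : mu.-integrable setT (EFin \o (fun x => (l ^+ 2 - 1) *
      (sqsum P x ^+ j.+1 * sqsum (predC P) x ^+ k * \1_disk x))).
    exact: (integrableZl measurableT (l ^+ 2 - 1) IB).
  have I2 : mu.-integrable setT (EFin \o (fun x => f x - (l ^+ 2 - 1) *
      (sqsum P x ^+ j.+1 * sqsum (predC P) x ^+ k * \1_disk x))).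
    exact: (integrableB measurableT If I1).
  have : l ^+ (2 * j) * (A - (l ^+ 2 - 1) * B) <= (l ^+ #|P|)^-1 * A.
    have -> : (l ^+ #|P|)^-1 * A = (\int[mu]_x (f (dilate d x)))%R.
      by rewrite /Rintegral E dprod Afin.
    have -> : A - (l ^+ 2 - 1) * B = (\int[mu]_x (f x - (l ^+ 2 - 1) *
      (sqsum P x ^+ j.+1 * sqsum (predC P) x ^+ k * \1_disk x)))%R.
      by rewrite RintegralB// RintegralZl.
    rewrite -RintegralZl//; apply: le_Rintegral => //.
    exact: (integrableZl measurableT (l ^+ (2 * j)) I2).
  move=> H.
  have H2 : v ^+ 2 * v ^+ (2 * j) * (l ^+ (2 * j) * (A - (l ^+ 2 - 1) * B)) <=
      v ^+ 2 * v ^+ (2 * j) * ((l ^+ #|P|)^-1 * A).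
    by rewrite ler_wpM2l// mulr_ge0 ?exprn_ge0// ltW.
  move: H2; rewrite /l !exprVn invrK.
  have -> : v ^+ 2 * v ^+ (2 * j) * (v ^- (2 * j) * (A - (v ^- 2 - 1) * B)) =
     (A + B) * v ^+ 2 - B.
    have : v ^+ (2 * j) != 0 by rewrite expf_neq0// gt_eqF.
    by move: (v ^+ (2 * j)) => w w0; field; rewrite w0 gt_eqF.
  have -> : v ^+ 2 * v ^+ (2 * j) * (v ^+ #|P| * A) = A * v ^+ q.+2.
    rewrite /q -[in RHS]addn2 !exprD.
    move: (v ^+ #|P|) (v ^+ (2 * j)) => w w'; ring.
  by move=> *; lra.
pose p : {poly R} := A *: 'X^(q.+2) - (A + B) *: 'X^2 + B%:P.
have pE v : p.[v] = A * v ^+ q.+2 - (A + B) * v ^+ 2 + B by rewrite !hornerE.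
have : is_derive (1 : R) 1 (horner p) 0.
  apply: (@derive1_at_min _ (horner p) 0 2) => //.
  - by rewrite in_itv/= ltr01 ltr1n.
  - move=> t; rewrite in_itv/= => /andP[t0 _]; rewrite !pE !expr1n.
    by have := key t t0; lra.
move=> [_]; rewrite -derive1E -derivE /p derivD derivB !derivZ !derivXn derivC.
rewrite addr0 hornerD hornerN !hornerZ !hornerMn !hornerXn !expr1n.
move=> e; have : (q.+2%:R : R) = #|P|%:R + 2 * j%:R + 2.
  by rewrite /q -addn2 natrD natrD natrM.
by move=> qE; move: e; rewrite qE => e; nra.
Qed.

Definition dir_mon P j k x : R :=
  (sqsum P x / enorm x ^+ 2) ^+ j * (sqsum (predC P) x / enorm x ^+ 2) ^+ k.

Lemma measurable_dir_mon P j k : measurable_fun setT (dir_mon P j k).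
Proof.
have m1 Q : measurable_fun setT (fun x => sqsum Q x / enorm x ^+ 2).
  apply: measurable_funM; first exact: measurable_sqsum.
  apply: (measurableT_comp measurable_inv); apply: measurable_funX.
  exact: measurable_enorm.
by apply: measurable_funM; apply: measurable_funX.
Qed.

Lemma dir_mon01 P j k x : 0 <= dir_mon P j k x <= 1.
Proof.
have h Q : 0 <= sqsum Q x / enorm x ^+ 2 <= 1.
  rewrite mulr_ge0 ?invr_ge0 ?sqsum_ge0 ?sqr_ge0//=.
  have [->|x0] := eqVneq (enorm x) 0; first by rewrite expr0n/= invr0 mulr0.
  by rewrite ler_pdivrMr ?mul1r ?sqsum_le// exprn_gt0// lt_neqAle eq_sym x0 enorm_ge0.
have /andP[a0 a1] := h P; have /andP[b0 b1] := h (predC P).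
by rewrite /dir_mon mulr_ge0 ?exprn_ge0//= mulr_ile1 ?exprn_ge0// exprn_ile1.
Qed.

Lemma dir_mon_homogeneous P j k : homogeneous0 (dir_mon P j k).
Proof.
move=> t x t0; rewrite /dir_mon !sqsumZ enormZ ?(ltW t0)//.
have E (a b : R) : t ^+ 2 * a / (t * b) ^+ 2 = a / b ^+ 2.
  by rewrite exprMn -mulf_div divff ?mul1r// expf_neq0// gt_eqF.
by rewrite !E.
Qed.

Lemma sqsum_dir P x : sqsum P x = sqsum P x / enorm x ^+ 2 * enorm x ^+ 2.
Proof.
have [x0|x0] := eqVneq (enorm x) 0; last by rewrite mulfVK// expf_neq0.
rewrite x0 expr0n/= mulr0; apply/le_anti; rewrite sqsum_ge0 andbT.
by apply: le_trans (sqsum_le P x) _; rewrite x0 expr0n.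
Qed.

Lemma mom_average P j k (h : 'rV[R]_N -> R) (f : R -> R) : (0 < N)%N ->
  measurable_fun setT h -> (forall x, 0 <= h x <= 4 * \1_disk x) ->
  (forall x, h x = f (enorm x)) ->
  mom P j k h = dir_average (dir_mon P j k) * mom predT (j + k) 0 h.
Proof.
move=> N0 mh h4 hf.
have PT x : sqsum predT x = enorm x ^+ 2 by rewrite sqr_enorm.
pose g x := (enorm x ^+ 2) ^+ (j + k) * h x.
have mg : measurable_fun setT g.
  apply: measurable_funM => //; apply: measurable_funX; apply: measurable_funX.
  exact: measurable_enorm.
have g0 x : 0 <= g x.
  by have /andP[h0 _] := h4 x; rewrite mulr_ge0// exprn_ge0// sqr_ge0.
have Ig : mu.-integrable setT (EFin \o g).
  have := integrable_mom predT (j + k) 0 mh h4; congr (mu.-integrable setT (EFin \o _)).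
  by apply/funext => x; rewrite expr0 mulr1 PT.
have := radial_average (g := g) (w := dir_mon P j k)
  (f := fun r => (r ^+ 2) ^+ (j + k) * f r) N0 mg g0 _ (measurable_dir_mon P j k)
  (dir_mon01 P j k) (@dir_mon_homogeneous P j k).
move=> /(_ _)/(congr1 fine).
rewrite -(fineK (integrable_fin_num measurableT Ig)) -EFinM /= => E.
rewrite /mom /Rintegral.
under [in LHS]eq_integral => x _.
  have -> : sqsum P x ^+ j * sqsum (predC P) x ^+ k * h x = g x * dir_mon P j k x.
    have sE Q i : sqsum Q x ^+ i = (sqsum Q x / enorm x ^+ 2) ^+ i * (enorm x ^+ 2) ^+ i.
      by rewrite -exprMn -sqsum_dir.
    rewrite (sE P j) (sE (predC P) k) /g /dir_mon exprD.
    move: ((_ / _) ^+ j) ((_ / _) ^+ k) ((_ ^+ 2) ^+ j) ((_ ^+ 2) ^+ k) (h x) => a b c d e.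
    ring.
  over.
rewrite E; last by apply: aeW => x; rewrite /g hf.
by congr (_ * fine _); apply: eq_integral => x _; rewrite expr0 mulr1 PT.
Qed.

(** Both moments in [moment_recursion] are averages of direction monomials times
    moments of the norm; the latter satisfy the same recursion with all the
    coordinates in one block, and cancel. *)
Lemma dir_average_recursion P j k : (0 < N)%N ->
  (N%:R + 2 * (j + k)%:R) * dir_average (dir_mon P j.+1 k) =
  (#|P|%:R + 2 * j%:R) * dir_average (dir_mon P j k).
Proof.
move=> N0; have mdisk : measurable_fun setT (\1_disk : 'rV[R]_N -> R).
  by apply: measurable_indic; exact: measurable_disk.
have dE x : (\1_disk x : R) = \1_(`]-oo, 2[%classic : set R) (enorm x).
  by rewrite !indicE; congr (_%:R); congr nat_of_bool; apply/idP/idP; rewrite !inE /disk/= in_itv.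
have E1 := moment_recursion P j k; have E2 := moment_recursion predT (j + k) 0.
rewrite (@mom_average P j k _ (fun r => \1_(`]-oo, 2[%classic : set R) r * (4 - r ^+ 2)) N0
  measurable_cone cone_bounds) in E1; last by move=> x; rewrite /cone dE.
rewrite (mom_average P j.+1 k N0 mdisk disk_bounds dE) addSn in E1.
rewrite cardT size_enum_ord in E2.
have : 0 < mom predT (j + k).+1 0 (\1_disk : 'rV[R]_N -> R).
  have IB := integrable_mom predT (j + k).+1 0 mdisk disk_bounds.
  rewrite -lte_fin /mom /Rintegral fineK; last exact: (integrable_fin_num measurableT IB).
  apply: lt_le_trans (shell_gt0 (R := R) N0) _.
  have mS := @measurable_shell R N.
  have <- : (\int[mu]_y (\1_(@shell R N) y)%:E = mu (@shell R N))%E.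
    by rewrite integral_indic// setIT.
  apply: ge0_le_integral => //.
  - by apply/measurable_EFinP; exact: measurable_indic.
  - by apply/measurable_EFinP; exact: measurable_mom.
  - move=> x _ /=; rewrite lee_fin !indicE expr0 mulr1.
    have [|_] := boolP (x \in shell (N:=N)); last first.
      by rewrite mulr_ge0// exprn_ge0// sqsum_ge0.
    rewrite inE => /andP[x1 x2]; rewrite mem_set// mulr1 exprn_ege1//.
    by rewrite /sqsum -sqr_enorm exprn_ege1.
move: E1 E2; move: (mom _ _ _ _) (mom _ _ _ _) (dir_average _) (dir_average _).
move=> c d a b E1 E2 d0; have d1 : d != 0.
  by apply/eqP => h; move: E2 d0; rewrite h mulr0; lra.
by apply: (mulIf d1); rewrite -mulrA [_ * d]mulrC mulrA -mulrA mulrC -!mulrA; nra.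
Qed.

Lemma dir_monC P j k : dir_mon (predC P) k j = dir_mon P j k.
Proof.
apply/funext => x; rewrite /dir_mon mulrC; congr (_ * _).
by congr ((_ / _) ^+ _); apply: eq_bigl => i; rewrite /= negbK.
Qed.

Lemma dir_average1 P : (0 < N)%N -> dir_average (dir_mon P 0 0) = 1.
Proof.
move=> N0; have -> : dir_mon P 0 0 = cst 1.
  by apply/funext => x; rewrite /dir_mon !expr0 mulr1.
have /andP[S0 Soo] := shell_int1_fin (R := R) N0.
by rewrite /dir_average divff// fine_eq0 ?gt_eqF// ge0_fin_numE// ltW.
Qed.

End moments.

(** The values of E[x(1-x)] and E[x^2(1-x)^2] for the Beta(n/2, n/2) law. *)
Lemma dir_average_balanced (R : realType) n (P : pred 'I_(n + n)) : (0 < n)%N ->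
  #|P| = n ->
  dir_average (dir_mon (R := R) P 1 1) = n%:R / (4 * (n%:R + 1)) /\
  dir_average (dir_mon (R := R) P 2 2) =
    n%:R * (n%:R + 2) / (16 * (n%:R + 1) * (n%:R + 3)).
Proof.
move=> n0 Pn; have N0 : (0 < n + n)%N by rewrite addn_gt0 n0.
have Cn : #|predC P| = n.
  by apply/eqP; rewrite -(eqn_add2l #|P|) cardC card_ord Pn.
have n0' : 0 < n%:R :> R by rewrite ltr0n.
have E1 := dir_average_recursion (R := R) P 0 0 N0.
have E2 := dir_average_recursion (R := R) (predC P) 0 1 N0.
have E3 := dir_average_recursion (R := R) P 1 1 N0.
have E4 := dir_average_recursion (R := R) (predC P) 1 2 N0.
rewrite ?dir_monC ?dir_average1 ?Pn ?Cn ?natrD// in E1 E2 E3 E4.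
move: E1 E2 E3 E4.
move: (dir_average _) (dir_average _) (dir_average _) (dir_average _) => a b c d.
move: (n%:R : R) n0' => m m0 e1 e2 e3 e4.
have ed : d = 2^-1 by apply: (@mulfI _ m); [rewrite gt_eqF|lra].
have ec : c = m / (4 * (m + 1)).
  have -> : m / (4 * (m + 1)) = m / (m + 1) * 4^-1 by rewrite invfM; ring.
  apply: (@mulfI _ (m + 1)); first by rewrite gt_eqF// addr_gt0.
  rewrite mulrA [(m + 1) * (m / _)]mulrC mulfVK; last by rewrite gt_eqF// addr_gt0.
  by move: e2; rewrite ed => e2; lra.
have eb : b = c / 2.
  by apply: (@mulfI _ (m + 2)); [rewrite gt_eqF// addr_gt0|lra].
have ea : a = (m + 2) * b / (2 * (m + 3)).
  have h : 2 * (m + 3) != 0 by rewrite gt_eqF// mulr_gt0// addr_gt0.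
  by apply: (mulIf h); rewrite mulfVK//; lra.
split => //; rewrite ea eb ec; field; rewrite !gt_eqF ?addr_gt0//.
Qed.

(** * Smooth functions and bumps *)

Section smooth.
Context {R : realType} {N : nat}.
Local Notation T := ('rV[R]_N).
Implicit Types (f g : T -> R).

Definition smooth f := forall k, Ck k f.

Lemma CkS k f : Ck k.+1 f -> Ck k f.
Proof.
elim: k f => [|k IH] f; first by case.
move=> [cf df]; split => // i; have [d1 d2] := df i; split => //.
exact: IH.
Qed.

Lemma Ck_cst k (c : R) : Ck k (cst c : T -> R).
Proof.
elim: k c => [|k IH] c /=; first by move=> x; exact: cst_continuous.
split; first by move=> x; exact: cst_continuous.
move=> i; split; first by move=> x; exact: derivable_cst.
have -> : partial i (cst c : T -> R) = cst 0.
  by apply/funext => x; rewrite /partial derive_cst.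
exact: IH.
Qed.

Lemma CkD k f g : Ck k f -> Ck k g -> Ck k (f \+ g).
Proof.
elim: k f g => [|k IH] f g /=.
  by move=> cf cg x; apply: continuousD; [exact: cf|exact: cg].
move=> [cf df] [cg dg]; split.
  by move=> x; apply: continuousD; [exact: cf|exact: cg].
move=> i; have [df1 df2] := df i; have [dg1 dg2] := dg i; split.
  by move=> x; apply: derivableD.
have -> : partial i (f \+ g) = partial i f \+ partial i g.
  by apply/funext => x; rewrite /partial deriveD.
exact: IH.
Qed.

Lemma partialM i f g x : derivable f x (delta_mx ord0 i) ->
  derivable g x (delta_mx ord0 i) ->
  partial i (f \* g) x = f x * partial i g x + g x * partial i f x.
Proof. by move=> df dg; exact: (deriveM df dg). Qed.

Lemma CkM k f g : Ck k f -> Ck k g -> Ck k (f \* g).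
Proof.
elim: k f g => [|k IH] f g /=.
  by move=> cf cg x; apply: continuousM; [exact: cf|exact: cg].
move=> Cf' Cg'; have Cf := CkS Cf'; have Cg := CkS Cg'.
move: Cf' Cg' => [cf df] [cg dg]; split.
  by move=> x; apply: continuousM; [exact: cf|exact: cg].
move=> i; have [df1 df2] := df i; have [dg1 dg2] := dg i; split.
  by move=> x; apply: derivableM.
have -> : partial i (f \* g) = (f \* partial i g) \+ (g \* partial i f).
  by apply/funext => x; rewrite partialM.
by apply: CkD; exact: IH.
Qed.

Lemma CkV k f : (forall x, f x != 0) -> Ck k f -> Ck k (fun x => (f x)^-1).
Proof.
move=> f0; elim: k => [|k IH].
  by move=> /= cf x; apply: continuousV => //; exact: cf.
move=> Cf'; have Cf := IH (CkS Cf'); move: Cf' => [cf df]; split.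
  by move=> x; apply: continuousV => //; exact: cf.
move=> i; have [df1 df2] := df i; split.
  by move=> x; apply: derivableV.
have -> : partial i (fun x => (f x)^-1) =
    cst (-1) \* (partial i f \* ((fun x => (f x)^-1) \* (fun x => (f x)^-1))).
  apply/funext => x; rewrite /partial deriveV//=.
  by rewrite /GRing.scale/= expr2 invfM; ring.
by apply: CkM; [exact: Ck_cst|apply: CkM => //; exact: CkM].
Qed.

Lemma is_derive_coor (x v : T) (i : 'I_N) :
  is_derive x v (fun y : T => y ord0 i) (v ord0 i).
Proof.
have dx : derivable (@id T) x v by exact: derivable_id.
split; first by move/derivable_mxP: dx; apply.
have := derive_id x v; rewrite derive_mx// => /(congr1 (fun M : T => M ord0 i)).
by rewrite mxE.
Qed.

Lemma partial_coor i l (x : T) : partial l (fun y : T => y ord0 i) x = (l == i)%:R.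
Proof.
have [_ e] := is_derive_coor x (delta_mx ord0 l) i.
by rewrite /partial e mxE eqxx/= eq_sym.
Qed.

Lemma Ck_coor k i : Ck k (fun y : T => y ord0 i).
Proof.
case: k => [|k]; first by move=> x; exact: coord_continuous.
split; first by move=> x; exact: coord_continuous.
move=> l; split; first by move=> x; have [] := is_derive_coor x (delta_mx ord0 l) i.
have -> : partial l (fun y : T => y ord0 i) = cst (l == i)%:R.
  by apply/funext => x; rewrite partial_coor.
exact: Ck_cst.
Qed.

Lemma Ck_sum k (I : Type) (r : seq I) (P : pred I) (F : I -> T -> R) :
  (forall i, P i -> Ck k (F i)) -> Ck k (fun x => \sum_(i <- r | P i) F i x).
Proof.
move=> CF; elim: r => [|i r IH].
  by under eq_fun do rewrite big_nil; exact: Ck_cst.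
under eq_fun do rewrite big_cons.
by case: (boolP (P i)) => // Pi; exact: (CkD (CF i Pi) IH).
Qed.

Lemma Ck_prod k (I : Type) (r : seq I) (P : pred I) (F : I -> T -> R) :
  (forall i, P i -> Ck k (F i)) -> Ck k (fun x => \prod_(i <- r | P i) F i x).
Proof.
move=> CF; elim: r => [|i r IH].
  by under eq_fun do rewrite big_nil; exact: Ck_cst.
under eq_fun do rewrite big_cons.
by case: (boolP (P i)) => // Pi; exact: (CkM (CF i Pi) IH).
Qed.

End smooth.

Section flat.
Context {R : realType}.

(** Functions flat at the origin; the family is closed under differentiation up
    to linear combinations. *)
Definition flat (j : nat) (t : R) : R :=
  if 0 < t then t ^- j * expR (- t^-1) else 0.

Lemma flat_ge0 j t : 0 <= flat j t.
Proof.
by rewrite /flat; case: ifPn => // t0; rewrite mulr_ge0 ?expR_ge0 ?invr_ge0 ?exprn_ge0 ?ltW.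
Qed.

Lemma flat_le j t : flat j t <= j.+2`!%:R * t ^+ 2.
Proof.
rewrite /flat; case: ifPn => t0; last by rewrite mulr_ge0 ?sqr_ge0.
have ti : 0 <= t^-1 by rewrite invr_ge0 ltW.
have := expR_ge1Dxn j.+1 ti; rewrite expRN => h.
have tj : 0 < t ^+ j by rewrite exprn_gt0.
have q0 : 0 < t^-1 ^+ j.+2 / j.+2`!%:R :> R.
  by rewrite divr_gt0 ?exprn_gt0 ?invr_gt0// ltr0n fact_gt0.
apply: (@le_trans _ _ (t ^- j * (t^-1 ^+ j.+2 / j.+2`!%:R)^-1)).
  rewrite ler_wpM2l ?invr_ge0 ?(ltW tj)// lef_pV2 ?posrE ?expR_gt0//.
  by apply: le_trans h; rewrite lerDr.
have E : t ^+ j.+2 = t ^+ j * t ^+ 2 by rewrite -exprD addn2.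
by rewrite invfM invrK exprVn invrK E -mulrA mulKf ?gt_eqF// mulrC.
Qed.

(** At 0 the difference quotient tends to 0 by [flat_le]. *)
Lemma is_derive_flat j t :
  is_derive t (1 : R) (flat j) (flat j.+2 t - j%:R * flat j.+1 t).
Proof.
have [t0|t0|t0] := ltgtP t 0.
- have -> : flat j.+2 t - j%:R * flat j.+1 t = 0 by rewrite /flat (lt_gtF t0) mulr0 subrr.
  have D0 : is_derive t (1 : R) (cst 0 : R -> R) 0 by exact: is_derive_cst.
  apply: near_eq_is_derive D0.
  near=> s; rewrite /flat ifF//; apply/negbTE; rewrite -leNgt ltW//.
  by near: s; exact: lt_nbhsl.
- pose F : R -> R := (fun s => s^-1) ^+ j * (expR \o (- (fun s => s^-1))).
  have tn0 : t != 0 by rewrite gt_eqF.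
  have D1 : is_derive t (1 : R) (fun s : R => s^-1) (- t ^- 2 *: 1).
    exact: (is_deriveV (f := id)).
  have D2 := is_deriveX j D1.
  have D3 : is_derive t (1 : R) (expR \o (- (fun s => s^-1))) (expR (- t^-1) * (t ^- 2)).
    have := is_derive1_comp (f := expR) (is_derive_expR _) (is_deriveN D1).
    by move/is_derive_eq; apply; rewrite /GRing.scale/= mulr1 opprK.
  have D4 := is_deriveM D2 D3.
  suff DF : is_derive t (1 : R) F (flat j.+2 t - j%:R * flat j.+1 t).
    apply: near_eq_is_derive DF.
    near=> s; rewrite /flat ifT; first by rewrite /F !fctE /= exprVn.
    by near: s; exact: lt_nbhsr.
  apply: is_derive_eq D4 _.
  rewrite /flat t0 /=.
  rewrite !fctE /GRing.scale/= mulr1; move: (expR _) => E.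
  case: j {D2 F} => [|j]; first by rewrite !mul0r mulr0 expr0; field.
  have e1 : t ^+ j.+1 = t ^+ j * t by rewrite exprSr.
  have e2 : t ^+ j.+2 = t ^+ j * t ^+ 2 by rewrite -exprD addn2.
  have e3 : t ^+ j.+3 = t ^+ j * t ^+ 3 by rewrite -exprD addn3.
  have tj : t ^+ j != 0 by rewrite expf_neq0.
  rewrite /= !exprVn e1 e2 e3; move: (t ^+ j) (j.+1%:R) tj => w v w0.
  by field; rewrite w0 tn0.
- rewrite t0 /flat ltxx mulr0 subrr.
  have H : (fun h : R => h^-1 *: ((flat j \o shift 0) (h *: 1) - flat j 0)) @ 0^' --> (0 : R).
    apply/cvgr0Pnorm_lt => e e0; near=> h.
    have h0 : h != 0 by near: h; exact: nbhs_dnbhs_neq.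
    have K0 : 0 < j.+2`!%:R :> R by rewrite ltr0n fact_gt0.
    have he : `|h| < e / j.+2`!%:R by near: h; apply: dnbhs0_lt; exact: divr_gt0.
    rewrite /= addr0 [flat j 0]/flat ltxx subr0 /GRing.scale/= mulr1 normrM normfV.
    rewrite ger0_norm ?flat_ge0//.
    apply: (@le_lt_trans _ _ (`|h|^-1 * (j.+2`!%:R * `|h| ^+ 2))).
      by rewrite ler_wpM2l ?invr_ge0// real_normK ?num_real// flat_le.
    rewrite expr2 mulrCA mulKf ?normr_eq0//.
    by rewrite -ltr_pdivlMl// mulrC.
  split; first by apply/cvg_ex; exists 0; exact: H.
  exact: cvg_lim H.
Unshelve. all: by end_near. Qed.

End flat.

Section bump.
Context {R : realType} {N : nat}.
Local Notation T := ('rV[R]_N).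
Local Notation mu := (@lebesgue_rV R N).

Lemma derive_affine_coor (g : R -> R) (a b : R) (i l : 'I_N) (x : T) (dg : R) :
  is_derive (a * x ord0 i + b) (1 : R) g dg ->
  is_derive x (delta_mx ord0 l) (fun y : T => g (a * y ord0 i + b))
    ((l == i)%:R * a * dg).
Proof.
move=> [d1 d2]; have df : differentiable g (a * x ord0 i + b).
  exact/derivable1_diffP.
pose w : R := a * (l == i)%:R.
have E : (fun h : R => h^-1 *: (((fun y : T => g (a * y ord0 i + b)) \o shift x)
      (h *: delta_mx ord0 l) - g (a * x ord0 i + b))) =
    (fun h : R => h^-1 *: ((g \o shift (a * x ord0 i + b)) (h *: w)
      - g (a * x ord0 i + b))).
  apply/funext => h /=; congr (_ *: (g _ - _)).
  rewrite !mxE eqxx /= /w /GRing.scale/= [i == l]eq_sym; ring.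
have dw : derivable g (a * x ord0 i + b) w by exact: diff_derivable.
split; first by rewrite /derivable E.
rewrite /derive E -[LHS]/('D_w g (a * x ord0 i + b)) deriveE//.
have -> : w = w *: (1 : R) by rewrite /GRing.scale/= mulr1.
rewrite linearZ/= -deriveE// d2 /w /GRing.scale/=; ring.
Qed.

Lemma continuous_affine_coor (g : R -> R) (a b : R) (i : 'I_N) :
  continuous g -> continuous (fun y : T => g (a * y ord0 i + b)).
Proof.
move=> cg x; apply: (@continuous_comp _ _ _ (fun y : T => a * y ord0 i + b) g);
  last exact: cg.
apply: continuousD; last exact: cst_continuous.
by apply: continuousM; [exact: cst_continuous|exact: coord_continuous].
Qed.

Lemma Ck_flat k j (a b : R) (i : 'I_N) :
  Ck k (fun y : T => flat j (a * y ord0 i + b)).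
Proof.
have cf m : continuous (@flat R m).
  move=> t; apply: differentiable_continuous; apply/derivable1_diffP.
  by have [] := is_derive_flat m t.
elim: k j => [|k IH] j /=; first by apply: continuous_affine_coor.
split; first by apply: continuous_affine_coor.
move=> l; split.
  move=> x; have [] := @derive_affine_coor _ a b i l x _ (is_derive_flat j _).
  by [].
have -> : partial l (fun y : T => flat j (a * y ord0 i + b)) =
    cst ((l == i)%:R * a) \* ((fun y : T => flat j.+2 (a * y ord0 i + b)) \+
      (cst (- j%:R) \* (fun y : T => flat j.+1 (a * y ord0 i + b)))).
  apply/funext => x; rewrite /partial.
  have [_ ->] := @derive_affine_coor _ a b i l x _ (is_derive_flat j _).
  by rewrite /= mulNr.
by apply: CkM; [exact: Ck_cst|apply: CkD => //; apply: CkM => //; exact: Ck_cst].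
Qed.

(** Smooth functions supported in a box that increase to its indicator. *)
Definition box_bump (c d : T) (m : nat) (x : T) : R :=
  \prod_(i < N) (flat 0 (m.+1%:R * x ord0 i + - (m.+1%:R * c ord0 i)) *
                 flat 0 (- m.+1%:R * x ord0 i + m.+1%:R * d ord0 i)).

Lemma flat0_le1 (t : R) : flat 0 t <= 1.
Proof.
rewrite /flat; case: ifPn => // t0; rewrite expr0 invr1 mul1r expR_le1.
by rewrite oppr_le0 invr_ge0 ltW.
Qed.

Lemma bump01 c d m x : 0 <= box_bump c d m x <= 1.
Proof.
apply/andP; split; first by apply: prodr_ge0 => i _; rewrite mulr_ge0 ?flat_ge0.
apply: prodr_ile1 => i _; rewrite mulr_ge0 ?flat_ge0//=.
by rewrite mulr_ile1 ?flat_ge0 ?flat0_le1.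
Qed.

Lemma bump_out c d m x : ~ obox c d x -> box_bump c d m x = 0.
Proof.
move=> /existsNP[i /negP nx]; apply/eqP; rewrite prodf_seq_eq0; apply/hasP.
exists i; first by rewrite mem_index_enum.
rewrite /= mulf_eq0 /flat -mulrBr [- _ * _ + _]addrC mulNr -mulrBr !pmulr_rgt0//.
rewrite !subr_gt0; move: nx; rewrite negb_and => /orP[]/negbTE ->; first by rewrite eqxx.
by rewrite eqxx orbT.
Qed.

Lemma bump_cvg c d x : box_bump c d m x @[m --> \oo] --> (\1_(obox c d) x : R).
Proof.
have [xcd|xcd] := pselect (obox c d x); last first.
  rewrite indicE memNset//=; under eq_fun do rewrite bump_out//.
  exact: cvg_cst.
rewrite indicE mem_set//=.
have flat_cvg (t : R) : 0 < t -> flat 0 (m.+1%:R * t) @[m --> \oo] --> (1 : R).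
  move=> t0; have -> : (fun m => flat 0 (m.+1%:R * t)) =
      (fun m => expR (- (t^-1 * m.+1%:R^-1))).
    by apply/funext => m; rewrite /flat mulr_gt0// expr0 invr1 mul1r invfM mulrC.
  rewrite -[X in _ --> X]expR0; apply: continuous_cvg; first exact: continuous_expR.
  rewrite -[X in _ --> X]oppr0; apply: cvgN; rewrite -[X in _ --> X](mulr0 t^-1).
  by apply: cvgM; [exact: cvg_cst|exact: cvg_harmonic].
have E m : box_bump c d m x = \prod_(i < N) (flat 0 (m.+1%:R * (x ord0 i - c ord0 i)) *
                 flat 0 (m.+1%:R * (d ord0 i - x ord0 i))).
  apply: eq_bigr => i _; rewrite mulrBr mulrBr mulNr.
  by rewrite [- _ + _]addrC.
under eq_fun do rewrite E.
elim: (index_enum _) => [|i r IH].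
  by under eq_fun do rewrite big_nil; exact: cvg_cst.
under eq_fun do rewrite big_cons.
have /andP[a b] := xcd i.
have H : flat 0 (m.+1%:R * (x ord0 i - c ord0 i)) *
    flat 0 (m.+1%:R * (d ord0 i - x ord0 i)) @[m --> \oo] --> (1 * 1 : R).
  by apply: cvgM; apply: flat_cvg; rewrite subr_gt0.
by have H2 := cvgM H IH; rewrite !mulr1 in H2; exact: H2.
Qed.

Lemma closed_cbox (c d : T) : closed (cbox c d).
Proof.
have -> : cbox c d = \bigcap_(i in [set: 'I_N])
    ((fun x : T => x ord0 i) @^-1` `[c ord0 i, d ord0 i]%classic).
  by apply/seteqP; split => [x H i _|x H i]; [rewrite /= in_itv; exact: H|
    have := H i I; rewrite /= in_itv].
apply: closed_bigI => i _; apply: preimage_closed; last exact: interval_closed.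
by move=> x _; exact: coord_continuous.
Qed.

Lemma bounded_cbox (c d : T) : bounded_set (cbox c d).
Proof.
pose M : R := \sum_(i < N) (`|c ord0 i| + `|d ord0 i|).
have M0 : 0 <= M by apply: sumr_ge0 => i _; rewrite addr_ge0.
exists M; split; first exact: num_real.
move=> M' MM' x H; rewrite /= [leLHS]/Num.norm /= mx_normrE.
apply/bigmax_leP; split; first by rewrite ltW// (le_lt_trans M0).
move=> [i j] _ /=; have -> : i = ord0 by apply/val_inj; case: i => -[].
apply: le_trans (ltW MM'); rewrite /M (bigD1 j)//=.
have /andP[a b] := H j.
apply: (@le_trans _ _ (`|c ord0 j| + `|d ord0 j|)); last first.
  by rewrite lerDl sumr_ge0// => k _; rewrite addr_ge0.
have := ler_norm (d ord0 j); have := ler_norm (- c ord0 j); rewrite normrN.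
have := normr_ge0 (d ord0 j); have := normr_ge0 (c ord0 j).
by move=> *; rewrite ler_norml; apply/andP; split; lra.
Qed.

Lemma test_fun_bump (Omega : set T) (c d : T) m : cbox c d `<=` Omega ->
  test_fun Omega (box_bump c d m).
Proof.
move=> cdO; have cl : closure [set x | box_bump c d m x != 0] `<=` cbox c d.
  rewrite closureE; apply: smallest_sub; first exact: closed_cbox.
  move=> x /= b0 i; have : obox c d x.
    by apply: contrapT => nx; move/eqP: b0; apply; exact: bump_out.
  by move/(_ i) => /andP[/ltW -> /ltW ->].
split.
- by move=> k; apply: Ck_prod => i _; apply: CkM; exact: Ck_flat.
- apply: (subclosed_compact _ _ cl); first exact: closed_closure.
  by apply: bounded_closed_compact; [exact: bounded_cbox|exact: closed_cbox].
- exact: subset_trans cl cdO.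
Qed.

End bump.

(** * Weak gradients *)

Section L2.
Context {R : realType} {N : nat}.
Local Notation T := ('rV[R]_N).
Local Notation mu := (@lebesgue_rV R N).
Variable Omega : set T.
Hypothesis mO : measurable Omega.
Implicit Types u v : T -> R.

Lemma L2_le u v : measurable_fun Omega u -> L2 Omega v ->
  (forall x, Omega x -> `|u x| <= `|v x|) -> L2 Omega u.
Proof.
move=> mu_ [mv iv] uv; split => //; apply: le_lt_trans iv.
apply: ge0_le_integral => //.
- by move=> x _; rewrite lee_fin sqr_ge0.
- by apply/measurable_EFinP; exact: measurable_funX.
- by apply/measurable_EFinP; exact: measurable_funX.
- move=> x Ox; rewrite lee_fin -[u x ^+ 2]real_normK ?num_real//.
  by rewrite -[v x ^+ 2]real_normK ?num_real// lerXn2r ?nnegrE// uv.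
Qed.

Lemma L2Z u (k : R) : L2 Omega u -> L2 Omega (fun x => k * u x).
Proof.
move=> [mu_ iu]; split; first exact: measurable_funM.
under eq_integral do rewrite exprMn EFinM.
rewrite ge0_integralZl_EFin ?sqr_ge0//; last 2 first.
- by move=> x _; rewrite lee_fin sqr_ge0.
- by apply/measurable_EFinP; exact: measurable_funX.
have : (0 <= \int[mu]_(x in Omega) (u x ^+ 2)%:E)%E.
  by apply: integral_ge0 => x _; rewrite lee_fin sqr_ge0.
by case: (integral _ _ _) iu => // r _ _; rewrite -EFinM ltry.
Qed.

Lemma integrable_sqr u : L2 Omega u -> mu.-integrable Omega (EFin \o (fun x => u x ^+ 2)).
Proof.
move=> [mu_ iu]; apply/integrableP; split.
  by apply/measurable_EFinP; exact: measurable_funX.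
by under eq_integral do rewrite /= ger0_norm ?sqr_ge0//.
Qed.

Lemma L2D u v : L2 Omega u -> L2 Omega v -> L2 Omega (fun x => u x + v x).
Proof.
move=> Lu Lv; have [mu_ iu] := Lu; have [mv iv] := Lv.
split; first exact: measurable_funD.
have I1 := integrableZl mO 2 (integrable_sqr Lu).
have I2 := integrableZl mO 2 (integrable_sqr Lv).
have I3 := integrableD mO I1 I2.
apply: le_lt_trans (integrable_lty mO I3).
apply: ge0_le_integral => //.
- by move=> x _; rewrite lee_fin sqr_ge0.
- by apply/measurable_EFinP; apply: measurable_funX; exact: measurable_funD.
- exact: measurable_int I3.
- move=> x _; rewrite /= -!EFinM -EFinD lee_fin.
  by have := sqr_ge0 (u x - v x); rewrite !expr2; lra.
Qed.

Lemma L2M u v : L2 Omega u -> L2 Omega v ->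
  mu.-integrable Omega (EFin \o (fun x => u x * v x)).
Proof.
move=> Lu Lv; have [mu_ iu] := Lu; have [mv iv] := Lv.
have I3 := integrableD mO (integrable_sqr Lu) (integrable_sqr Lv).
apply: le_integrable I3 => //.
  by apply/measurable_EFinP; exact: measurable_funM.
move=> x _; rewrite /= lee_fin [leRHS]ger0_norm ?addr_ge0 ?sqr_ge0//.
have := sqr_ge0 (u x - v x); have := sqr_ge0 (u x + v x).
by rewrite !expr2 ler_norml => *; apply/andP; split; nra.
Qed.

Lemma L2_bounded u (f : T -> R) (M : R) : measurable_fun Omega f ->
  (forall x, Omega x -> `|f x| <= M) -> L2 Omega u -> L2 Omega (fun x => f x * u x).
Proof.
move=> mf fM Lu; apply: (L2_le _ (L2Z M Lu)).
  by apply: measurable_funM => //; case: Lu.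
by move=> x Ox; rewrite !normrM ler_wpM2r// (le_trans (fM x Ox))// ler_norm.
Qed.

End L2.

Section test_functions.
Context {R : realType} {N : nat}.
Local Notation T := ('rV[R]_N).
Local Notation mu := (@lebesgue_rV R N).
Implicit Types (Omega : set T) (f phi : T -> R).

Lemma continuous_measurable_rVT f : continuous f -> measurable_fun setT f.
Proof. by move=> cf; apply: continuous_measurable_rV; [exact: openT|move=> x _; exact: cf]. Qed.

Lemma smooth_measurable f D : smooth f -> measurable_fun D f.
Proof.
move=> sf; apply: (@measurable_funS _ _ _ _ setT) => //.
by apply: continuous_measurable_rVT; exact: (sf 0%N).
Qed.

Lemma smooth_partial i f : smooth f -> smooth (partial i f).
Proof. by move=> sf k; have [_ /(_ i)[]] := sf k.+1. Qed.

Lemma smooth_derivable i f x : smooth f -> derivable f x (delta_mx ord0 i).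
Proof. by move=> sf; have [_ /(_ i)[]] := sf 1%N. Qed.

Lemma test_fun_partial Omega i phi : test_fun Omega phi -> test_fun Omega (partial i phi).
Proof.
move=> [sp cp pO].
have S : closure [set x | partial i phi x != 0] `<=` closure [set x | phi x != 0].
  rewrite closureE; apply: smallest_sub; first exact: closed_closure.
  move=> x /= px; apply: contrapT => nx; move/eqP: px; apply.
  have near0 : \forall y \near x, phi y = cst 0 y.
    have : open (~` closure [set x | phi x != 0]).
      by apply: closed_openC; exact: closed_closure.
    rewrite openE => /(_ x nx); apply: filterS => y ny.
    by apply: contrapT => /eqP py; apply: ny; exact: subset_closure.
  by rewrite /partial (near_eq_derive _ near0) derive_cst.
split; first exact: smooth_partial.
- by apply: (subclosed_compact _ cp S); exact: closed_closure.
- exact: subset_trans S pO.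
Qed.

Lemma test_funM Omega f phi : smooth f -> test_fun Omega phi ->
  test_fun Omega (fun x => f x * phi x).
Proof.
move=> sf [sp cp pO].
have S : closure [set x | f x * phi x != 0] `<=` closure [set x | phi x != 0].
  apply: closure_subset => x /=; apply: contra => /eqP ->.
  by rewrite mulr0.
split; first by move=> k; exact: (CkM (sf k) (sp k)).
- by apply: (subclosed_compact _ cp S); exact: closed_closure.
- exact: subset_trans S pO.
Qed.

Lemma test_fun_bound Omega phi : test_fun Omega phi ->
  exists (M r : R), forall x, `|phi x| <= M * \1_(cbox (const_mx (- r) : T) (const_mx r)) x.
Proof.
move=> [sp cp pO]; pose K := closure [set x | phi x != 0].
have [r [_ Hr]] := compact_bounded cp.
have cimg : compact (phi @` K).
  apply: continuous_compact => //; apply: continuous_subspaceT.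
  exact: (sp 0%N).
have [M [_ HM]] := compact_bounded cimg.
exists (`|M| + 1), (`|r| + 1) => x; have [xK|xK] := pselect (K x); last first.
  have -> : phi x = 0 by apply: contrapT => /eqP px; apply: xK; exact: subset_closure.
  by rewrite normr0 mulr_ge0// addr_ge0.
rewrite indicE mem_set ?mulr1; last first.
  move=> i; rewrite !mxE -ler_norml; apply: le_trans (coor_le_norm x i) _.
  by apply: Hr => //; rewrite (le_lt_trans (ler_norm r))// ltrDl.
apply: HM; last by exists x.
by rewrite (le_lt_trans (ler_norm M))// ltrDl.
Qed.

Lemma test_fun_L2 Omega phi : measurable Omega -> test_fun Omega phi -> L2 Omega phi.
Proof.
move=> mO tp; have [M [r H]] := test_fun_bound tp.
have mphi : measurable_fun Omega phi by case: tp => sp _ _; exact: smooth_measurable.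
split => //; set B := cbox _ _ in H.
have mB : measurable B by exact: measurable_cbox.
apply: (@le_lt_trans _ _ (\int[mu]_(x in Omega) ((M ^+ 2)%:E * (\1_B x)%:E))%E).
  apply: ge0_le_integral => //.
  - by move=> x _; rewrite lee_fin sqr_ge0.
  - by apply/measurable_EFinP; exact: measurable_funX.
  - apply/measurable_EFinP; apply: measurable_funM => //; exact: measurable_indic.
  - move=> x _; rewrite -EFinM lee_fin; have := H x; rewrite indicE.
    have [_|_] := boolP (x \in B).
      rewrite !mulr1 -[phi x ^+ 2]real_normK ?num_real// => h.
      by rewrite lerXn2r ?nnegrE// (le_trans _ h).
    by rewrite !mulr0 normr_le0 => /eqP ->; rewrite expr0n.
rewrite ge0_integralZl_EFin ?sqr_ge0//; last first.
  by apply/measurable_EFinP; exact: measurable_indic.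
rewrite integral_indic//.
apply: lte_mul_pinfty; rewrite ?lee_fin ?sqr_ge0//.
apply: le_lt_trans (cbox_lty (const_mx (- r)) (const_mx r)).
by apply: le_measure; rewrite ?inE//; exact: measurableI.
Qed.

(** The bumps of a box converge to its indicator, so the integral over every box
    in [Omega] vanishes, and countably many boxes cover [Omega]. *)
Lemma ae_eq0_of_test Omega g : open Omega -> L2 Omega g ->
  (forall phi, test_fun Omega phi -> (\int[mu]_(x in Omega) (g x * phi x) = 0)%R) ->
  ae_in Omega (fun x => g x = 0).
Proof.
move=> oO Lg g0; have mO := open_measurable_rV oO.
have box c d : cbox c d `<=` Omega -> mu.-integrable (obox c d) (EFin \o g) /\
    (\int[mu]_(x in obox c d) (g x)%:E = 0)%E.
  move=> cdO; have oc : obox c d `<=` cbox c d.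
    by move=> x H i; have /andP[/ltW -> /ltW ->] := H i.
  have mcd := measurable_obox c d.
  have ocO : obox c d `<=` Omega by exact: subset_trans oc cdO.
  have Lg1 : L2 (obox c d) g.
    split; first by apply: measurable_funS Lg.1.
    apply: le_lt_trans Lg.2; apply: ge0_subset_integral => //.
      by apply/measurable_EFinP; apply: measurable_funX; case: Lg.
    by move=> x _; rewrite lee_fin sqr_ge0.
  have L1 : L2 (obox c d) (cst 1).
    split; first exact: measurable_cst.
    under eq_integral do rewrite expr1n.
    rewrite integral_cst// mul1e; apply: le_lt_trans (cbox_lty c d).
    by apply: le_measure; rewrite ?inE//; exact: measurable_cbox.
  have Ig : mu.-integrable (obox c d) (EFin \o g).
    have := L2M mcd Lg1 L1; apply: eq_integrable => // x _ /=.
    by rewrite mulr1.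
  split => //.
  have sb m : smooth (box_bump c d m) by case: (test_fun_bump m cdO).
  have Z m : (\int[mu]_(x in obox c d) (g x * box_bump c d m x)%:E = 0)%E.
    have := g0 _ (test_fun_bump m cdO).
    have I := L2M mO Lg (test_fun_L2 mO (test_fun_bump m cdO)).
    transitivity (\int[mu]_(x in Omega) (g x * box_bump c d m x)%:E)%E; last first.
      rewrite -(fineK (integrable_fin_num mO I)); congr (_%:E).
      exact: g0 (test_fun_bump m cdO).
    rewrite [RHS]integral_mkcond [LHS]integral_mkcond.
    apply: eq_integral => x _; rewrite !patchE.
    have [xcd|xcd] := boolP (x \in obox c d).
      by rewrite mem_set//; apply: ocO; rewrite inE in xcd.
    case: ifPn => // _; rewrite bump_out ?mulr0//.
    by move: xcd; rewrite notin_setE.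
  have mgb m : measurable_fun (obox c d) (fun x => g x * box_bump c d m x).
    by apply: measurable_funM; [case: Lg1|exact: smooth_measurable].
  have := @dominated_convergence _ _ _ mu (obox c d) mcd
    (fun m => EFin \o (fun x => g x * box_bump c d m x)) (EFin \o g) (abse \o (EFin \o g)).
  move=> /(_ _ (measurable_int _ Ig) _ (integrable_abse Ig) _)[].
  - by move=> m; exact/measurable_EFinP.
  - apply: aeW => x xcd; apply/fine_cvgP; split; first exact: nearW.
    rewrite -[X in _ --> X]mulr1; apply: cvgM; first exact: cvg_cst.
    by have := @bump_cvg _ _ c d x; rewrite indicE mem_set.
  - apply: aeW => x m xcd; rewrite /= lee_fin normrM.
    have /andP[b0 b1] := bump01 c d m x.
    by rewrite [ `|box_bump _ _ _ _| ]ger0_norm// ler_piMr.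
  - move=> _ _; rewrite (_ : [sequence _]_n = cst 0%E); last by apply/funext => m; exact: Z.
    by move=> /(cvg_lim (@ereal_hausdorff R)) <-; rewrite lim_cst.
pose Q (qk : 'rV[rat]_N * nat) :=
  (\row_i (ratr (qk.1 ord0 i) - qk.2.+1%:R^-1) : T,
   \row_i (ratr (qk.1 ord0 i) + qk.2.+1%:R^-1) : T).
pose F qk := if `[< cbox (Q qk).1 (Q qk).2 `<=` Omega >]
  then obox (Q qk).1 (Q qk).2 else set0.
have cover : Omega `<=` \bigcup_qk F qk.
  move=> x Ox.
  have /nbhs_ballP[e /= e0 xeO] : nbhs x Omega by move: oO; rewrite openE; apply.
  have [k ke] : exists k : nat, k.+1%:R^-1 < e / 2.
    have [k _ /(_ k (leqnn k)) ke] := near_infty_natSinv_lt (PosNum (divr_gt0 e0 (@ltr0Sn R 1))).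
    by exists k.
  have hk : 0 < k.+1%:R^-1 :> R by rewrite invr_gt0.
  have /choice[q hq] (i : 'I_N) : exists q : rat, x ord0 i - k.+1%:R^-1 < ratr q < x ord0 i + k.+1%:R^-1.
    have xk : x ord0 i - k.+1%:R^-1 < x ord0 i + k.+1%:R^-1 by rewrite ltrD2l gtrN.
    by have [q] := rat_in_itvoo xk; rewrite in_itv/=; exists q.
  exists (\row_i q i, k) => //; rewrite /F asboolT.
    move=> i; rewrite /Q/= !mxE; have /andP[q1 q2] := hq i.
    by rewrite ltrBlDr q2/= -ltrBlDr.
  move=> y By; apply: xeO; split => // i j.
  have -> : i = ord0 by apply/val_inj; case: i => -[].
  have := hq j; have := By j; rewrite /ball/= !mxE/= ltr_distl => /andP[a b] /andP[a' b'].
  move: (k.+1%:R^-1) (ratr _) ke a' b' a b => h r ke a' b' a b.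
  by apply/andP; split; lra.
have : mu.-negligible (\bigcup_qk (F qk `&` [set x | g x != 0])).
  have [U UE] : exists U : nat -> 'rV[rat]_N * nat, forall qk, exists i, U i = qk.
    exists (fun i => odflt (0, 0%N) (unpickle i)) => qk.
    by exists (pickle qk); rewrite pickleK.
  have -> : \bigcup_qk (F qk `&` [set x | g x != 0]) =
      \bigcup_i (F (U i) `&` [set x | g x != 0]).
    apply/seteqP; split => x [qk _ Fx]; last by exists (U qk).
    by have [i Ui] := UE qk; exists i => //; rewrite Ui.
  apply: negligible_bigcup => i; rewrite /F; case: asboolP => cO; last first.
    by rewrite set0I; exact: negligible_set0.
  have [Ig I0] := box _ _ cO.
  have : {ae mu, forall x, obox (Q (U i)).1 (Q (U i)).2 x -> g x = 0}.
    apply: obox_integral_eq0 => // c' d' cc' dd'.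
    apply: (box c' d' _).2; apply: subset_trans cO => x H j.
    have /andP[a b] := H j; rewrite (le_trans (cc' j) a) /=.
    exact: le_trans b (dd' j).
  apply: negligibleS => x [ox gx] /=; move=> /(_ ox); exact/eqP.
apply: negligibleS => x /= /not_implyP[Ox /eqP gx].
by have [qk _ Fx] := cover x Ox; exists qk.
Qed.

Lemma wgrad_unique Omega u (g1 g2 : T -> T) : open Omega ->
  is_wgrad Omega u g1 -> is_wgrad Omega u g2 -> ae_in Omega (fun x => g1 x = g2 x).
Proof.
move=> oO h1 h2; have mO := open_measurable_rV oO.
have ae0 i : ae_in Omega (fun x => g1 x ord0 i + (- 1) * g2 x ord0 i = 0).
  have [L1 E1] := h1 i; have [L2' E2] := h2 i.
  apply: ae_eq0_of_test => //; first by apply: L2D => //; exact: L2Z.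
  move=> phi tp; have Lp := test_fun_L2 mO tp.
  under eq_Rintegral do rewrite mulrDl -mulrA.
  have I1 := L2M mO L1 Lp; have I2 := L2M mO L2' Lp.
  rewrite RintegralD//; last exact: (integrableZl mO (-1) I2).
  rewrite RintegralZl// mulN1r; apply/eqP; rewrite subr_eq0; apply/eqP.
  by apply: oppr_inj; rewrite -E1// -E2.
have : {ae mu, forall x, forall k (kN : (k < N)%N), Omega x ->
    g1 x ord0 (Ordinal kN) + (- 1) * g2 x ord0 (Ordinal kN) = 0}.
  apply/ae_foralln => k; have [kN|kN] := pselect (is_true (k < N)%N); last first.
    by apply: aeW => x kN'.
  have := ae0 (Ordinal kN); rewrite /ae_in; apply: filterS => x H kN' Ox.
  by rewrite (bool_irrelevance kN' kN); exact: H.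
apply: filterS => x H Ox; apply/rowP => -[k kN].
by have := H k kN Ox; rewrite mulN1r => /eqP; rewrite subr_eq0 => /eqP.
Qed.

Lemma ae_inS Omega (P Q : T -> Prop) : ae_in Omega P ->
  (forall x, Omega x -> P x -> Q x) -> ae_in Omega Q.
Proof. by rewrite /ae_in => + PQ; apply: filterS => x H Ox; exact: PQ (H Ox). Qed.

Lemma ae_inI Omega (P Q : T -> Prop) : ae_in Omega P -> ae_in Omega Q ->
  ae_in Omega (fun x => P x /\ Q x).
Proof.
by move=> aP aQ; apply: (ae_imp2 (m := mu) _ aP aQ) => x H1 H2 Ox; split; [exact: H1|exact: H2].
Qed.

Definition grad f (x : T) : T := \row_i partial i f x.

(** The product of a test function and [f] is again a test function. *)
Lemma is_wgradM Omega u (g : T -> T) f (M : R) : open Omega -> L2 Omega u ->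
  is_wgrad Omega u g -> smooth f -> (forall x, Omega x -> `|f x| <= M) ->
  (forall i x, Omega x -> `|partial i f x| <= M) ->
  is_wgrad Omega (fun x => f x * u x) (fun x => f x *: g x + u x *: grad f x).
Proof.
move=> oO Lu gu sf fM dfM i; have mO := open_measurable_rV oO.
have [Lg Eg] := gu i.
have Lfg : L2 Omega (fun x => f x * g x ord0 i).
  by apply: L2_bounded => //; [exact: smooth_measurable|exact: fM].
have Lud : L2 Omega (fun x => partial i f x * u x).
  apply: (L2_bounded mO _ (dfM i)) => //.
  by apply: smooth_measurable; exact: smooth_partial.
have gE : (fun x => (f x *: g x + u x *: grad f x) ord0 i) =
    (fun x => f x * g x ord0 i + partial i f x * u x).
  by apply/funext => x; rewrite !mxE [u x * _]mulrC.
rewrite gE; split; first exact: L2D.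
move=> phi tp; have Lp := test_fun_L2 mO tp.
have tfp := test_funM sf tp.
have I1 := L2M mO Lu (test_fun_L2 mO (test_fun_partial i tfp)).
have I2 := L2M mO Lud Lp.
have I3 := L2M mO Lg (test_fun_L2 mO tfp).
have E1 : (fun x => f x * u x * partial i phi x) = (fun x =>
    u x * partial i (fun y => f y * phi y) x - partial i f x * u x * phi x).
  apply/funext => x; rewrite partialM; first last.
  - by apply: smooth_derivable; case: tp.
  - exact: smooth_derivable.
  - ring.
rewrite E1 RintegralB// Eg//.
rewrite -opprD; congr (- _); rewrite -RintegralD//; apply: eq_Rintegral => x _.
by rewrite !mxE; ring.
Qed.

Lemma is_wgrad_wgrad Omega u (g : T -> T) : is_wgrad Omega u g ->
  is_wgrad Omega u (wgrad Omega u).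
Proof. by move=> h; rewrite /wgrad; exact: (@xgetI _ _ [set g | is_wgrad Omega u g] g h). Qed.

Lemma wgradE Omega u (g : T -> T) : open Omega -> is_wgrad Omega u g ->
  ae_in Omega (fun x => wgrad Omega u x = g x).
Proof. by move=> oO h; apply: wgrad_unique => //; exact: is_wgrad_wgrad h. Qed.

Lemma wgradM Omega u (g : T -> T) f (M : R) : open Omega -> L2 Omega u ->
  is_wgrad Omega u g -> smooth f -> (forall x, Omega x -> `|f x| <= M) ->
  (forall i x, Omega x -> `|partial i f x| <= M) ->
  ae_in Omega (fun x => wgrad Omega (fun x => f x * u x) x =
    f x *: wgrad Omega u x + u x *: grad f x).
Proof.
move=> oO Lu gu sf fM dfM; apply: wgradE => //.
by apply: is_wgradM fM dfM => //; exact: is_wgrad_wgrad gu.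
Qed.

Definition Hsq Omega u : \bar R :=
  (\int[mu]_(x in Omega) (enorm (wgrad Omega u x) ^+ 2 + u x ^+ 2)%:E)%E.

Lemma Hsq_ge0 Omega u : (0 <= Hsq Omega u)%E.
Proof. by apply: integral_ge0 => x _; rewrite lee_fin addr_ge0 ?sqr_ge0. Qed.

Lemma measurable_wgrad Omega u (g : T -> T) : is_wgrad Omega u g ->
  measurable_fun Omega (fun x => enorm (g x) ^+ 2).
Proof.
move=> h; under eq_fun do rewrite sqr_enorm.
by apply: measurable_sum => i; apply: measurable_funX; have [[]] := h i.
Qed.

Lemma enorm2D (x y : T) : enorm (x + y) ^+ 2 <= 2 * enorm x ^+ 2 + 2 * enorm y ^+ 2.
Proof.
rewrite !sqr_enorm !mulr_sumr -big_split/=; apply: ler_sum => i _.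
by rewrite mxE; have := sqr_ge0 (x ord0 i - y ord0 i); rewrite !expr2; lra.
Qed.

Lemma enorm2Z (k : R) (x : T) : enorm (k *: x) ^+ 2 = k ^+ 2 * enorm x ^+ 2.
Proof. by rewrite !sqr_enorm mulr_sumr; apply: eq_bigr => i _; rewrite mxE exprMn. Qed.

Lemma enorm2_grad_le f x (M : R) : (forall i, `|partial i f x| <= M) ->
  enorm (grad f x) ^+ 2 <= N%:R * M ^+ 2.
Proof.
move=> H; rewrite sqr_enorm; apply: (@le_trans _ _ (\sum_(i < N) M ^+ 2)).
  apply: ler_sum => i _; rewrite mxE -real_normK ?num_real//.
  by rewrite lerXn2r ?nnegrE// (le_trans _ (H i)).
by rewrite sumr_const card_ord mulr_natl.
Qed.

(** Without a weak gradient of [w] the left-hand side has a junk value too: the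
    reciprocal of [f] is a multiplier as well, so [f w] has a weak gradient only
    if [w] has one. *)
Lemma Hsq_mul_le Omega f (c M : R) : open Omega -> smooth f -> 0 < c ->
  (forall x, f x != 0) ->
  (forall x, Omega x -> c <= f x <= M) ->
  (forall i x, Omega x -> `|partial i f x| <= M) -> 0 <= M ->
  forall w, L2 Omega w ->
  (Hsq Omega (fun x => f x * w x)%R <= ((2 * N%:R + 3) * M ^+ 2)%:E * Hsq Omega w)%E.
Proof.
move=> oO sf c0 f0 fcM dfM M0 w Lw; have mO := open_measurable_rV oO.
have fM x : Omega x -> `|f x| <= M.
  by move=> /fcM/andP[a b]; rewrite ger0_norm// (le_trans (ltW c0) a).
have mw : measurable_fun Omega (fun x => w x ^+ 2).
  by apply: measurable_funX; case: Lw.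
have mfw : measurable_fun Omega (fun x => (f x * w x) ^+ 2).
  by apply: measurable_funX; apply: measurable_funM; [exact: smooth_measurable|case: Lw].
have fw2 x : Omega x -> (f x * w x) ^+ 2 <= M ^+ 2 * w x ^+ 2.
  move=> Ox; rewrite exprMn ler_wpM2r ?sqr_ge0// -[f x ^+ 2]real_normK ?num_real//.
  by rewrite lerXn2r ?nnegrE//; exact: fM.
have K0 : 0 <= (2 * N%:R + 3) * M ^+ 2 by rewrite mulr_ge0 ?sqr_ge0// addr_ge0// mulr_ge0.
have [[g gw]|nog] := pselect (exists g, is_wgrad Omega w g).
  have h1 := is_wgrad_wgrad gw.
  have h2 := is_wgrad_wgrad (is_wgradM oO Lw gw sf fM dfM).
  have m1 := measurable_wgrad h1; have m2 := measurable_wgrad h2.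
  rewrite /Hsq -ge0_integralZl_EFin//; first last.
  - by apply/measurable_EFinP; exact: (measurable_funD m1 mw).
  - by move=> x _; rewrite lee_fin addr_ge0 ?sqr_ge0.
  apply: ae_ge0_le_integral => //.
  - by move=> x _; rewrite lee_fin addr_ge0 ?sqr_ge0.
  - by apply/measurable_EFinP; exact: (measurable_funD m2 mfw).
  - by move=> x _; rewrite -EFinM lee_fin mulr_ge0// addr_ge0 ?sqr_ge0.
  - by apply/measurable_EFinP; apply: measurable_funM; [exact: measurable_cst|exact: (measurable_funD m1 mw)].
  - apply: (ae_inS (wgradM oO Lw gw sf fM dfM)) => x Ox ->; rewrite -EFinM lee_fin.
    have := enorm2D (f x *: wgrad Omega w x) (w x *: grad f x).
    rewrite !enorm2Z; have := fw2 x Ox.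
    have := enorm2_grad_le (fun i => dfM i x Ox).
    have : f x ^+ 2 <= M ^+ 2.
      by rewrite -[f x ^+ 2]real_normK ?num_real// lerXn2r ?nnegrE//; exact: fM.
    have := sqr_ge0 (w x); have := sqr_ge0 (enorm (wgrad Omega w x)).
    have := sqr_ge0 (enorm (grad f x)); have := sqr_ge0 M.
    have := ler0n R N.
    move: (enorm _ ^+ 2) (enorm (grad _ _) ^+ 2) (enorm (wgrad Omega w x) ^+ 2).
    move=> A B D; move: (w x ^+ 2) (f x ^+ 2) (M ^+ 2) (N%:R) => W F M2 n.
    move=> n0 M20 B0 D0 W0 FM BM fwM AL.
    have : F * D <= M2 * D by exact: ler_wpM2r.
    have : W * B <= W * (n * M2) by exact: ler_wpM2l.
    have : 0 <= n * M2 * D by rewrite !mulr_ge0.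
    have : 0 <= M2 * D by rewrite mulr_ge0.
    have : 0 <= M2 * W by rewrite mulr_ge0.
    by move=> *; lra.
have nog' : ~ exists g, is_wgrad Omega (fun x => f x * w x) g.
  move=> [g gfw]; apply: nog.
  have Lfw : L2 Omega (fun x => f x * w x).
    by apply: L2_bounded => //; [exact: smooth_measurable|exact: fM].
  have sV : smooth (fun x => (f x)^-1) by move=> k; exact: CkV.
  have fV x : Omega x -> `|(f x)^-1| <= c^-1.
    move=> /fcM/andP[a b]; have fx := lt_le_trans c0 a.
    by rewrite ger0_norm ?invr_ge0 ?(ltW fx)// lef_pV2.
  have dfV i x : Omega x -> `|partial i (fun x => (f x)^-1) x| <= c^-1 ^+ 2 * M.
    move=> Ox; rewrite /partial deriveV//; last exact: smooth_derivable.
    rewrite /GRing.scale/= normrM normrN normfV normrX -exprVn.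
    apply: ler_pM => //; last exact: dfM.
    by rewrite lerXn2r ?nnegrE ?invr_ge0 ?(ltW c0)// -normfV; exact: fV.
  pose M' := c^-1 + c^-1 ^+ 2 * M.
  have M'0 : 0 <= c^-1 ^+ 2 * M by rewrite mulr_ge0 ?sqr_ge0.
  have fV' x : Omega x -> `|(f x)^-1| <= M'.
    by move=> Ox; apply: le_trans (fV x Ox) _; rewrite lerDl.
  have dfV' i x : Omega x -> `|partial i (fun x => (f x)^-1) x| <= M'.
    by move=> Ox; apply: le_trans (dfV i x Ox) _; rewrite lerDr invr_ge0 ltW.
  have := is_wgradM oO Lfw gfw sV fV' dfV'.
  have -> : (fun x => (f x)^-1 * (f x * w x)) = w.
    by apply/funext => x; rewrite mulKf.
  by move=> h; eexists; exact: h.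
have xg0 v : (~ exists g, is_wgrad Omega v g) -> wgrad Omega v = (fun=> 0).
  move=> nv; rewrite /wgrad; case: xgetP => // g _ h.
  by exfalso; apply: nv; exists g.
rewrite /Hsq (xg0 _ nog) (xg0 _ nog') -ge0_integralZl_EFin//; first last.
- by apply/measurable_EFinP; exact: measurable_funD.
- by move=> x _; rewrite lee_fin addr_ge0 ?sqr_ge0.
have e0 : enorm (0 : T) ^+ 2 = 0 by have /eqP -> : enorm (0 : T) == 0; rewrite ?enorm_eq0// expr0n.
apply: ge0_le_integral => //.
- by move=> x _; rewrite lee_fin addr_ge0 ?sqr_ge0.
- by apply/measurable_EFinP; exact: measurable_funD.
- by apply/measurable_EFinP; apply: measurable_funM => //; exact: measurable_funD.
- move=> x Ox; rewrite -EFinM lee_fin e0 !add0r; apply: le_trans (fw2 x Ox) _.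
  rewrite ler_wpM2r ?sqr_ge0// ler_peMl ?sqr_ge0//.
  by have := ler0n R N; lra.
Qed.

Lemma H1normE Omega u : H1norm Omega u = (Hsq Omega u `^ 2^-1)%E.
Proof. by []. Qed.

Lemma H1norm_lt Omega u (e : R) : 0 < e -> (Hsq Omega u < (e ^+ 2)%:E)%E ->
  (H1norm Omega u < e%:E)%E.
Proof.
move=> e0; rewrite H1normE; have := Hsq_ge0 Omega u.
case: (Hsq Omega u) => // r; rewrite lee_fin => r0; rewrite !lte_fin => re /=.
by rewrite powR12_sqrt// -(ger0_norm (ltW e0)) -sqrtr_sqr ltr_sqrt ?exprn_gt0.
Qed.

Lemma lt_H1norm Omega u (e : R) : 0 < e -> (H1norm Omega u < e%:E)%E ->
  (Hsq Omega u < (e ^+ 2)%:E)%E.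
Proof.
move=> e0; rewrite H1normE; have := Hsq_ge0 Omega u.
case: (Hsq Omega u) => [r|_|]; rewrite ?lee_fin//; last by rewrite poweRyr ?invr_neq0.
move=> r0.
rewrite !lte_fin /= powR12_sqrt// -{1}(ger0_norm (ltW e0)) -sqrtr_sqr.
by rewrite ltr_sqrt ?exprn_gt0.
Qed.

Lemma H1_L2 Omega u : H10 Omega u -> L2 Omega u.
Proof. by move=> [[]]. Qed.

Lemma H10_wgrad Omega u : H10 Omega u -> is_wgrad Omega u (wgrad Omega u).
Proof. by move=> [[_ [g h]] _]; exact: is_wgrad_wgrad h. Qed.

(** Test functions close to [u] are multiplied by [f]. *)
Lemma H10M Omega f (c M : R) u : open Omega -> smooth f -> 0 < c ->
  (forall x, f x != 0) ->
  (forall x, Omega x -> c <= f x <= M) ->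
  (forall i x, Omega x -> `|partial i f x| <= M) -> 0 < M ->
  H10 Omega u -> H10 Omega (fun x => f x * u x).
Proof.
move=> oO sf c0 f0 fcM dfM M0 Hu; have mO := open_measurable_rV oO.
have Lu := H1_L2 Hu; have gu := H10_wgrad Hu.
have fM x : Omega x -> `|f x| <= M.
  by move=> /fcM/andP[a b]; rewrite ger0_norm// (le_trans (ltW c0) a).
split.
  split; first by apply: L2_bounded => //; [exact: smooth_measurable|exact: fM].
  by eexists; apply: is_wgradM fM dfM; [| |exact: gu|].
move=> e e0; have [_ Hap] := Hu.
pose K := (2 * N%:R + 3) * M ^+ 2.
have K0 : 0 < K by rewrite /K mulr_gt0 ?exprn_gt0//; have := ler0n R N; lra.
pose e' := e / Num.sqrt K.
have e'0 : 0 < e' by rewrite divr_gt0// sqrtr_gt0.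
have [phi tphi Hphi] := Hap _ e'0.
have Lw : L2 Omega (u \- phi)%R.
  have := L2D mO Lu (L2Z mO (-1) (test_fun_L2 mO tphi)).
  by congr (L2 Omega _); apply/funext => x; rewrite mulN1r.
exists (fun x => f x * phi x); first exact: test_funM.
have -> : ((fun x => f x * u x) \- (fun x => f x * phi x))%R =
    (fun x => f x * (u \- phi)%R x).
  by apply/funext => x; rewrite /= mulrBr.
apply: H1norm_lt => //.
apply: le_lt_trans (Hsq_mul_le oO sf c0 f0 fcM dfM (ltW M0) Lw) _.
have := lt_H1norm e'0 Hphi; rewrite -/K.
have := Hsq_ge0 Omega (u \- phi)%R.
case: (Hsq _ _) => // r _; rewrite -EFinM !lte_fin.
rewrite /e' expr_div_n sqr_sqrtr ?(ltW K0)// => h.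
by rewrite mulrC -ltr_pdivlMr.
Qed.

Definition multiplier (f : T -> R) (M : R) :=
  [/\ smooth f, forall x, 2^-1 <= f x <= M & forall i x, `|partial i f x| <= M].

Lemma multiplier_gt0 f M x : multiplier f M -> 0 < f x.
Proof. by move=> [_ + _] => /(_ x)/andP[h _]; rewrite (lt_le_trans _ h). Qed.

Lemma multiplier_bound f M : multiplier f M -> 0 < M /\ forall x, `|f x| <= M.
Proof.
move=> h; have h0 x := multiplier_gt0 x h; case: h => _ hM _; split.
  by have /andP[a1 a2] := hM 0; apply: lt_le_trans (le_trans a1 a2).
by move=> x; rewrite ger0_norm ?(ltW (h0 x))//; have /andP[] := hM x.
Qed.

Lemma wgrad_multiplier Omega f M u : open Omega -> multiplier f M -> H10 Omega u ->
  ae_in Omega (fun x => wgrad Omega (fun x => f x * u x) x =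
    f x *: wgrad Omega u x + u x *: grad f x).
Proof.
move=> oO h Hu; have [M0 fM] := multiplier_bound h; case: h => sf _ df.
by apply: (wgradM oO (H1_L2 Hu) (H10_wgrad Hu) sf (fun x _ => fM x) (fun i x _ => df i x)).
Qed.

Lemma H10_multiplier Omega f M u : open Omega -> multiplier f M ->
  H10 Omega u -> H10 Omega (fun x => f x * u x).
Proof.
move=> oO h Hu; have [M0 _] := multiplier_bound h.
have f0 x := multiplier_gt0 x h; case: h => sf hM df.
apply: (H10M (c := 2^-1) (M := M)) => //.
by move=> x; rewrite gt_eqF.
Qed.

Lemma multiplier_cst1 : multiplier (cst 1) 1.
Proof.
split => [k|x|i x]; first exact: Ck_cst.
  by rewrite /= lexx andbT invf_le1 ?ler1n.
by rewrite /partial derive_cst normr0.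
Qed.

End test_functions.

(** * The angular weight *)

Section weight.
Context {R : realType} {n : nat}.
Local Notation T := ('rV[R]_(n + n)).
Local Notation mu := (@lebesgue_rV R (n + n)).
Implicit Types x : T.

Definition first_block : pred 'I_(n + n) := fun i => (i < n)%N.

Definition sS x : R := sqsum first_block x.
Definition sT x : R := sqsum (predC first_block) x.

Lemma first_block_lshift (i : 'I_n) : first_block (lshift n i).
Proof. exact: (ltn_ord i). Qed.

Lemma first_block_rshift (i : 'I_n) : first_block (rshift n i) = false.
Proof. by apply/negbTE; rewrite /first_block -leqNgt /= leq_addr. Qed.

Lemma card_first_block : #|first_block| = n.
Proof.
rewrite -sum1_card big_mkcond /= big_split_ord /=.
under eq_bigr => i _ do rewrite -topredE /= first_block_lshift.
under [X in (_ + X)%N]eq_bigr => i _ do rewrite -topredE /= first_block_rshift.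
by rewrite sum1_card card_ord big1 ?addn0.
Qed.

Lemma sS_sum x : sS x = \sum_(i < n) x ord0 (lshift n i) ^+ 2.
Proof.
rewrite /sS /sqsum big_mkcond big_split_ord /=.
under eq_bigr => i _ do rewrite first_block_lshift.
under [X in _ + X]eq_bigr => i _ do rewrite first_block_rshift.
by rewrite [X in _ + X]big1// addr0.
Qed.

Lemma sT_sum x : sT x = \sum_(i < n) x ord0 (rshift n i) ^+ 2.
Proof.
rewrite /sT /sqsum big_mkcond big_split_ord /=.
under eq_bigr => i _ do rewrite first_block_lshift.
under [X in _ + X]eq_bigr => i _ do rewrite first_block_rshift.
by rewrite [X in X + _]big1// add0r.
Qed.

Lemma sSE x : sS x = s_of x ^+ 2.
Proof. by rewrite sS_sum /s_of sqr_enorm; apply: eq_bigr => i _; rewrite mxE. Qed.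

Lemma sTE x : sT x = t_of x ^+ 2.
Proof. by rewrite sT_sum /t_of sqr_enorm; apply: eq_bigr => i _; rewrite mxE. Qed.

Lemma sS_ge0 x : 0 <= sS x. Proof. exact: sqsum_ge0. Qed.
Lemma sT_ge0 x : 0 <= sT x. Proof. exact: sqsum_ge0. Qed.

Lemma sSTE x : sS x + sT x = enorm x ^+ 2.
Proof. exact: sqsumC. Qed.

Lemma is_derive_sqsum (P : pred 'I_(n + n)) x l :
  is_derive x (delta_mx ord0 l) (sqsum P) (2 * (P l)%:R * x ord0 l).
Proof.
have -> : sqsum P = \sum_(i < n + n) (cst (P i)%:R * (fun y : T => y ord0 i) ^+ 2).
  apply/funext => y; rewrite fct_sumE /sqsum big_mkcond /=; apply: eq_bigr => i _.
  by rewrite !fctE /=; case: (P i); rewrite ?mul1r ?mul0r.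
have H i := is_deriveM (is_derive_cst ((P i)%:R : R) x (delta_mx ord0 l))
  (is_deriveX 2 (is_derive_coor x (delta_mx ord0 l) i)).
apply: is_derive_eq (is_derive_sum H) _.
rewrite (bigD1 l)//= big1 => [|i il].
  by rewrite !fctE /GRing.scale/= mxE !eqxx/= expr1 mulr0 !addr0 mulr1 mulrCA mulrA.
by rewrite !fctE /GRing.scale/= mxE (negbTE il) andbF/= mulr0 mulr0 mulr0 addr0.
Qed.

Definition rho (e : R) x : R := sS x + sT x + e.

Lemma rho_gt0 e x : 0 < e -> 0 < rho e x.
Proof. by move=> e0; rewrite /rho ltr_wpDl// addr_ge0 ?sqsum_ge0. Qed.

(** The inverse of the average of [s ^ 2 t ^ 2 / r ^ 4]. *)
Definition Cn : R := 4 * (n%:R + 1) / n%:R.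

(** For [e = 0] the factor of [sg] is a spherical harmonic of degree 4; [e > 0]
    makes it smooth at the origin. *)
Definition weight (sg e : R) x : R :=
  1 + sg * (Cn * (sS x * sT x) / rho e x ^+ 2 - 1).

Lemma smooth_sqsum (P : pred 'I_(n + n)) : smooth (sqsum P : T -> R).
Proof. by move=> k; apply: Ck_sum => i _; apply: CkM; exact: Ck_coor. Qed.

Lemma smooth_rhoV e : 0 < e -> smooth (fun x => (rho e x)^-1).
Proof.
move=> e0 k; apply: CkV; first by move=> x; rewrite gt_eqF// rho_gt0.
apply: (CkD (f := fun x => sS x + sT x)); last exact: Ck_cst.
by apply: CkD; exact: smooth_sqsum.
Qed.

Lemma smooth_weight sg e : 0 < e -> smooth (weight sg e).
Proof.
move=> e0 k; apply: (CkD (f := cst 1)); first exact: Ck_cst.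
apply: (CkM (f := cst sg)); first exact: Ck_cst.
apply: (CkD (g := cst (- 1))); last exact: Ck_cst.
have -> : (fun x => Cn * (sS x * sT x) / rho e x ^+ 2) =
  (fun x => Cn * (sS x * sT x) * ((rho e x)^-1 * (rho e x)^-1)).
  by apply/funext => x; rewrite expr2 invfM.
apply: CkM; last by apply: CkM; exact: smooth_rhoV.
apply: (CkM (f := cst Cn)); first exact: Ck_cst.
by apply: CkM; exact: smooth_sqsum.
Qed.

Lemma partial_weight sg e x l : 0 < e ->
  partial l (weight sg e) x = 2 * sg * Cn * x ord0 l *
    (if first_block l then sT x * (rho e x - 2 * sS x)
     else sS x * (rho e x - 2 * sT x)) / rho e x ^+ 3.
Proof.
move=> e0; have r0 : rho e x != 0 by rewrite gt_eqF// rho_gt0.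
have dS := is_derive_sqsum first_block x l.
have dT := is_derive_sqsum (predC first_block) x l.
have dr : is_derive x (delta_mx ord0 l) (rho e) (2 * x ord0 l).
  have := is_deriveD (is_deriveD dS dT) (is_derive_cst e x (delta_mx ord0 l)).
  move/is_derive_eq; apply; rewrite addr0 /=.
  by case: (first_block l); rewrite /=; ring.
have dV : is_derive x (delta_mx ord0 l) (fun y => (rho e y)^-1)
    (- (rho e x) ^- 2 *: (2 * x ord0 l)).
  split; first exact: derivableV.
  by rewrite deriveV// derive_val.
have D1 := is_deriveM (is_derive_cst Cn x (delta_mx ord0 l)) (is_deriveM dS dT).
have D2 := is_deriveM D1 (is_deriveM dV dV).
have D3 := is_deriveM (is_derive_cst sg x (delta_mx ord0 l))
  (is_deriveD D2 (is_derive_cst (- 1 : R) x (delta_mx ord0 l))).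
have D4 := is_deriveD (is_derive_cst (1 : R) x (delta_mx ord0 l)) D3.
have wE : weight sg e = cst 1 + cst sg * (cst Cn * (sS * sT) *
    ((fun y => (rho e y)^-1) * (fun y => (rho e y)^-1)) + cst (- 1)).
  by apply/funext => y; rewrite /weight !fctE /= expr2 invfM.
rewrite /partial wE; case: D4 => _ ->.
rewrite !fctE /GRing.scale/= -/(sS x) -/(sT x).
move: (rho e x) r0 => r r0.
by case: (first_block l) => /=; field.
Qed.

Lemma enorm2_grad_weight sg e x : 0 < e ->
  enorm (grad (weight sg e) x) ^+ 2 = sg ^+ 2 * (4 * Cn ^+ 2 *
    (sS x * sT x ^+ 2 * (rho e x - 2 * sS x) ^+ 2 +
     sT x * sS x ^+ 2 * (rho e x - 2 * sT x) ^+ 2) / rho e x ^+ 6).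
Proof.
move=> e0; rewrite sqr_enorm (bigID first_block) /=.
pose k := 4 * sg ^+ 2 * Cn ^+ 2 / rho e x ^+ 6.
have -> : \sum_(i | first_block i) grad (weight sg e) x ord0 i ^+ 2 =
    k * (sT x ^+ 2 * (rho e x - 2 * sS x) ^+ 2) * sS x.
  rewrite [X in _ = _ * X]/sS /sqsum mulr_sumr; apply: eq_bigr => i Pi.
  rewrite mxE partial_weight// Pi /k.
  move: (rho e x) (gt_eqF (rho_gt0 x e0)) => r /negbT r0.
  by field.
have -> : \sum_(i | ~~ first_block i) grad (weight sg e) x ord0 i ^+ 2 =
    k * (sS x ^+ 2 * (rho e x - 2 * sT x) ^+ 2) * sT x.
  rewrite [X in _ = _ * X]/sT /sqsum mulr_sumr; apply: eq_bigr => i /negbTE Pi.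
  rewrite mxE partial_weight// Pi /k.
  move: (rho e x) (gt_eqF (rho_gt0 x e0)) => r /negbT r0.
  by field.
rewrite /k; move: (rho e x) (gt_eqF (rho_gt0 x e0)) => r /negbT r0.
by field.
Qed.

Hypothesis n0 : (0 < n)%N.

Lemma Cn_bounds : 4 < Cn <= 8.
Proof.
have h : 1 <= n%:R :> R by rewrite ler1n.
have h0 : 0 < n%:R :> R by rewrite ltr0n.
by rewrite /Cn ltr_pdivlMr// ler_pdivrMr//; apply/andP; split; lra.
Qed.

Lemma weight_bounds sg e x : 0 < e -> 0 < sg -> 1 - sg <= weight sg e x <= 1 + sg.
Proof.
move=> e0 s0; have /andP[C1 C2] := Cn_bounds.
have r0 := rho_gt0 x e0; have r2 : 0 < rho e x ^+ 2 by rewrite exprn_gt0.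
have h0 : 0 <= Cn * (sS x * sT x) / rho e x ^+ 2.
  rewrite divr_ge0 ?(ltW r2)// mulr_ge0 ?mulr_ge0 ?sqsum_ge0//; lra.
have h1 : Cn * (sS x * sT x) / rho e x ^+ 2 <= 2.
  rewrite ler_pdivrMr//; have := sqr_ge0 (sS x - sT x); rewrite /rho.
  have S0 := sS_ge0 x; have T0 := sT_ge0 x.
  move: (sS x) (sT x) S0 T0 => a b a0 b0 ab.
  have ab0 : 0 <= a * b by exact: mulr_ge0.
  have : Cn * (a * b) <= 8 * (a * b) by exact: ler_wpM2r.
  have : 0 <= (a + b) * e by rewrite mulr_ge0 ?addr_ge0// ltW.
  have := sqr_ge0 e; move: ab; rewrite !expr2 => *; lra.
by rewrite /weight; apply/andP; split; nra.
Qed.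

(** The bound does not depend on [e]: this is the domination of the gradient term
    by [u ^ 2 / |x| ^ 2]. *)
Lemma grad_weight_le (sg e : R) x : 0 < e ->
  enorm (grad (weight sg e) x) ^+ 2 * enorm x ^+ 2 <= sg ^+ 2 * (4 * Cn ^+ 2).
Proof.
move=> e0; rewrite enorm2_grad_weight// -mulrA ler_wpM2l ?sqr_ge0//.
have r0 := rho_gt0 x e0; rewrite mulrAC ler_pdivrMr ?exprn_gt0//.
rewrite -(mulrA (4 * Cn ^+ 2)) ler_wpM2l ?mulr_ge0 ?sqr_ge0// -sSTE.
have S0 := sS_ge0 x; have T0 := sT_ge0 x; move: r0; rewrite /rho.
move: (sS x) (sT x) S0 T0 => a b a0 b0; set r := a + b + e => r0.
have sq (c d : R) : 0 <= c -> 0 <= d -> c + d <= r -> d ^+ 2 * (r - 2 * c) ^+ 2 <= r ^+ 2 * r ^+ 2.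
  move=> c0' d0' cd; apply: ler_pM; rewrite ?sqr_ge0//.
    by rewrite lerXn2r ?nnegrE//; lra.
  by rewrite -[(r - _) ^+ 2]real_normK ?num_real// lerXn2r ?nnegrE//; [lra|rewrite ler_norml; apply/andP; split; lra].
have abr : a + b <= r by rewrite /r; lra.
have h1 := sq a b a0 b0 abr; have h2 := sq b a b0 a0; rewrite addrC in h2; have {}h2 := h2 abr.
have h3 : a * b ^+ 2 * (r - 2 * a) ^+ 2 + b * a ^+ 2 * (r - 2 * b) ^+ 2 <= (a + b) * (r ^+ 2 * r ^+ 2).
  have h1' := ler_wpM2l a0 h1; have h2' := ler_wpM2l b0 h2.
  by rewrite !mulrA in h1' h2'; rewrite !mulrA mulrDl mulrDl; lra.
have -> : r ^+ 6 = r ^+ 2 * (r ^+ 2 * r ^+ 2) by ring.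
have h4 : (a + b) * (a + b) <= r ^+ 2 by rewrite expr2 ler_pM// addr_ge0.
apply: (@le_trans _ _ ((a + b) * ((a + b) * (r ^+ 2 * r ^+ 2)))).
  by rewrite mulrC ler_wpM2l// addr_ge0.
by rewrite mulrA ler_wpM2r// mulr_ge0 ?sqr_ge0.
Qed.

Lemma partial_weight_le sg e x l : 0 < e -> 0 < sg ->
  `|partial l (weight sg e) x| <= 2 * sg * Cn * (1 + e^-1).
Proof.
move=> e0 s0; have r0 := rho_gt0 x e0; have /andP[C1 _] := Cn_bounds.
have S0 := sS_ge0 x; have T0 := sT_ge0 x.
have Cn0 : 0 <= Cn by exact: ltW (lt_trans _ C1).
have k0 : 0 <= 2 * sg * Cn by rewrite mulr_ge0// mulr_ge0// ltW.
rewrite partial_weight// -[in leLHS](mulrA (2 * sg * Cn)) -(mulrA (2 * sg * Cn)).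
rewrite normrM ger0_norm// ler_wpM2l// -(mulrA (x ord0 l)).
set Q := (if _ then _ else _).
have hQ : `|Q| <= rho e x * rho e x.
  rewrite /Q; case: ifP => _; rewrite normrM ler_pM// ler_norml; rewrite /rho in r0 *;
  by apply/andP; split; lra.
rewrite !normrM normfV normrX [ `|rho e x| ]ger0_norm ?(ltW r0)//.
apply: (@le_trans _ _ (`|x ord0 l| * (rho e x * rho e x / rho e x ^+ 3))).
  by rewrite ler_wpM2l// ler_wpM2r// invr_ge0 exprn_ge0// ltW.
have -> : rho e x * rho e x / rho e x ^+ 3 = (rho e x)^-1.
  by field; rewrite gt_eqF.
rewrite ler_pdivrMr//.
have := coor_le_enorm x l; have := sSTE x; have := sqr_ge0 (enorm x - 1).
have e1 : e^-1 * e = 1 by rewrite mulVf// gt_eqF.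
have ei : 0 < e^-1 by rewrite invr_gt0.
have : 0 <= e^-1 * (sS x + sT x) by rewrite mulr_ge0 ?addr_ge0// ltW.
rewrite /rho !mulrDl !mulrDr e1 expr2 => *; nra.
Qed.

Lemma sqsum_block (A B : 'M[R]_n) x : A *m A^T = 1%:M -> B *m B^T = 1%:M ->
  sS (x *m block_mx A 0 0 B) = sS x /\ sT (x *m block_mx A 0 0 B) = sT x.
Proof.
move=> hA hB; have E2 (y : 'rV[R]_n) (M : 'M[R]_n) : M *m M^T = 1%:M ->
    enorm (y *m M) ^+ 2 = enorm y ^+ 2.
  move=> hM; have en (z : 'rV[R]_n) : enorm z ^+ 2 = (z *m z^T) ord0 ord0.
    by rewrite sqr_enorm mxE; apply: eq_bigr => i _; rewrite mxE expr2.
  by rewrite !en trmx_mul mulmxA -(mulmxA y) hM mulmx1.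
have xE : x *m block_mx A 0 0 B = row_mx (lsubmx x *m A) (rsubmx x *m B).
  by rewrite -{1}(hsubmxK x) mul_row_block !mulmx0 addr0 add0r.
by rewrite !sSE !sTE /s_of /t_of xE row_mxKl row_mxKr !E2.
Qed.

Lemma weight_block sg e (A B : 'M[R]_n) x : A *m A^T = 1%:M -> B *m B^T = 1%:M ->
  weight sg e (x *m block_mx A 0 0 B) = weight sg e x.
Proof.
by move=> hA hB; have [eS eT] := sqsum_block x hA hB; rewrite /weight /rho eS eT.
Qed.

Lemma cos_theta x : cos (theta x) = s_of x / enorm x /\
  s_of x ^+ 2 = enorm x ^+ 2 * cos (theta x) ^+ 2.
Proof.
have s_le : s_of x <= enorm x.
  rewrite -ler_sqr ?nnegrE ?sqrtr_ge0//.
  by rewrite -sSE -sSTE lerDl sT_ge0.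
have c : cos (theta x) = s_of x / enorm x.
  rewrite /theta acosK// in_itv/=; apply/andP; split.
    by apply: (@le_trans _ _ 0); rewrite ?lerN10// divr_ge0// sqrtr_ge0.
  have [->|x0] := eqVneq (enorm x) 0; first by rewrite invr0 mulr0.
  by rewrite ler_pdivrMr ?mul1r// lt_neqAle eq_sym x0 enorm_ge0.
split => //; rewrite c; have [x0|x0] := eqVneq (enorm x) 0.
  rewrite x0 expr0n mul0r; apply/eqP; rewrite sqrf_eq0 eq_le sqrtr_ge0.
  by rewrite -x0 s_le.
by rewrite expr_div_n mulrCA divff ?mulr1// expf_neq0.
Qed.

Definition polar_weight (sg e r th : R) : R :=
  1 + sg * (Cn * (r ^+ 4 * (cos th ^+ 2 * sin th ^+ 2)) / (r ^+ 2 + e) ^+ 2 - 1).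

Lemma weight_polar sg e x : weight sg e x = polar_weight sg e (enorm x) (theta x).
Proof.
have [_ s2] := cos_theta x.
have t2 : t_of x ^+ 2 = enorm x ^+ 2 * sin (theta x) ^+ 2.
  by rewrite sin2cos2 mulrBr mulr1 -s2 -sSTE -sSE sTE addrAC subrr add0r.
rewrite /weight /polar_weight /rho sSTE sSE sTE s2 t2.
by congr (1 + sg * (Cn * _ / _ - 1)); ring.
Qed.

Lemma polar_weight_even sg e r th :
  polar_weight sg e r (pi / 2 - th) = polar_weight sg e r th.
Proof.
rewrite /polar_weight -(opprB th) cosN sinN cosBpihalf sinBpihalf opprK.
by rewrite [cos th ^+ 2 * _]mulrC.
Qed.

Lemma theta_lt_pi4 x : 0 < theta x < pi / 4 -> sT x <= sS x.
Proof.
move=> /andP[t0 t4]; have [_ s2] := cos_theta x.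
have : 0 <= cos (theta x *+ 2).
  have pi0 := pi_gt0 R; apply: cos_ge0_pihalf; rewrite mulr2n.
  move: (theta x) (pi : R) pi0 t0 t4 => th q q0 th0 th4.
  have -> : q / (1 + 1) = q / 4 + q / 4 by field.
  by rewrite mulr2n; apply/andP; split; lra.
rewrite cos_mulr2n => c.
have : 0 <= enorm x ^+ 2 * (cos (theta x) ^+ 2 *+ 2 - 1) by rewrite mulr_ge0 ?sqr_ge0.
rewrite mulrBr mulr1 mulr2n mulrDr -s2 -sSTE -sSE; lra.
Qed.

(** The derivative in the direction of the angle is a nonnegative multiple of
    [s t (s ^ 2 - t ^ 2)]. *)
Lemma grad_weight_theta_ge0 sg e x : 0 < e -> 0 < sg -> 0 < theta x < pi / 4 ->
  0 <= dotrV (grad (weight sg e) x) (theta_field x).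
Proof.
move=> e0 sg0 /theta_lt_pi4 ST; have /andP[C1 _] := Cn_bounds.
have r0 := rho_gt0 x e0.
rewrite /dotrV big_split_ord /=.
pose k := 2 * sg * Cn / rho e x ^+ 3.
have -> : \sum_(i < n) grad (weight sg e) x ord0 (lshift n i) * theta_field x ord0 (lshift n i) =
   - (k * sT x * (rho e x - 2 * sS x) * (t_of x / s_of x)) * sS x.
  rewrite [X in _ = _ * X]sS_sum mulr_sumr; apply: eq_bigr => i _.
  rewrite mxE partial_weight// first_block_lshift /theta_field row_mxEl !mxE /k.
  by ring.
have -> : \sum_(i < n) grad (weight sg e) x ord0 (rshift n i) * theta_field x ord0 (rshift n i) =
   (k * sS x * (rho e x - 2 * sT x) * (s_of x / t_of x)) * sT x.
  rewrite [X in _ = _ * X]sT_sum mulr_sumr; apply: eq_bigr => i _.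
  rewrite mxE partial_weight// first_block_rshift /theta_field row_mxEr !mxE /k.
  by ring.
have ts (a b : R) : a / b * b ^+ 2 = a * b.
  by have [->|b0] := eqVneq b 0; [rewrite expr0n !mulr0|field].
have -> : - (k * sT x * (rho e x - 2 * sS x) * (t_of x / s_of x)) * sS x =
    - (k * sT x * (rho e x - 2 * sS x)) * (t_of x * s_of x).
  by rewrite -(ts (t_of x) (s_of x)) sSE; ring.
have -> : (k * sS x * (rho e x - 2 * sT x) * (s_of x / t_of x)) * sT x =
    (k * sS x * (rho e x - 2 * sT x)) * (t_of x * s_of x).
  by rewrite [t_of x * _]mulrC -(ts (s_of x) (t_of x)) sTE; ring.
have k0 : 0 <= k.
  rewrite /k divr_ge0 ?exprn_ge0 ?(ltW r0)//.
  by rewrite mulr_ge0 ?(ltW (lt_trans _ C1))// mulr_ge0// ltW.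
have -> : - (k * sT x * (rho e x - 2 * sS x)) * (t_of x * s_of x) +
   k * sS x * (rho e x - 2 * sT x) * (t_of x * s_of x) =
   k * (t_of x * s_of x) * (rho e x * (sS x - sT x)) by ring.
apply: mulr_ge0; first by rewrite mulr_ge0// mulr_ge0 ?enorm_ge0.
by rewrite mulr_ge0 ?(ltW r0)// subr_ge0.
Qed.


Definition weight_bound (sg e : R) : R := 2 + 2 * sg * Cn * (1 + e^-1).

Lemma weight_multiplier (sg e : R) x : 0 < e -> 0 < sg <= 2^-1 ->
  2^-1 <= weight sg e x <= weight_bound sg e.
Proof.
move=> e0 /andP[s0 s1]; have /andP[a b] := weight_bounds x e0 s0.
have /andP[C1 _] := Cn_bounds.
have : 0 <= 2 * sg * Cn * (1 + e^-1).
  apply: mulr_ge0; last by rewrite addr_ge0// invr_ge0 ltW.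
  by rewrite mulr_ge0 ?(ltW (lt_trans _ C1))// mulr_ge0// ltW.
rewrite /weight_bound; move: (2 * sg * Cn * _) => q q0.
by apply/andP; split; lra.
Qed.

Lemma weight_is_multiplier (sg e : R) : 0 < e -> 0 < sg <= 2^-1 ->
  multiplier (weight sg e) (weight_bound sg e).
Proof.
move=> e0 s; have /andP[s0 _] := s; split; first exact: smooth_weight.
  by move=> x; exact: weight_multiplier.
move=> i x; apply: le_trans (partial_weight_le x i e0 s0) _.
by rewrite /weight_bound lerDr.
Qed.

Section multiplication.
Variables (Omega : set T) (oO : open Omega).

Lemma wgradZ u (k : R) : H10 Omega u ->
  is_wgrad Omega (fun x => k * u x) (fun x => k *: wgrad Omega u x) /\
  ae_in Omega (fun x => wgrad Omega (fun x => k * u x) x = k *: wgrad Omega u x).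
Proof.
move=> Hu; have Lu := H1_L2 Hu; have gu := H10_wgrad Hu.
have kk x : Omega x -> `|(cst k : T -> R) x| <= `|k| by [].
have pk i x : partial i (cst k : T -> R) x = 0.
  by rewrite /partial derive_cst.
have dk i x : Omega x -> `|partial i (cst k : T -> R) x| <= `|k|.
  by move=> _; rewrite pk normr0.
have sk : smooth (cst k : T -> R) by move=> j; exact: Ck_cst.
have h := is_wgradM oO Lu gu sk kk dk.
have gE : (fun x => (cst k : T -> R) x *: wgrad Omega u x + u x *: grad (cst k : T -> R) x) =
    (fun x => k *: wgrad Omega u x).
  apply/funext => x; rewrite (_ : grad _ x = 0) ?scaler0 ?addr0//.
  by apply/rowP => i; rewrite !mxE pk.
rewrite gE in h; split => //; exact: wgradE.
Qed.

Lemma HsqZ u (k : R) : H10 Omega u ->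
  Hsq Omega (fun x => k * u x) = ((k ^+ 2)%:E * Hsq Omega u)%E.
Proof.
move=> Hu; have mO := open_measurable_rV oO.
have [gku aek] := wgradZ k Hu; have gu := H10_wgrad Hu.
have mu2 v : L2 Omega v -> measurable_fun Omega (fun x => v x ^+ 2).
  by move=> [mv _]; apply: measurable_funX.
have m1 := measurable_wgrad gu; have m2 := mu2 _ (H1_L2 Hu).
have m3 := measurable_wgrad (is_wgrad_wgrad gku).
have m4 := mu2 _ (L2Z mO k (H1_L2 Hu)).
rewrite /Hsq -ge0_integralZl_EFin//; first last.
- exact: sqr_ge0.
- by apply/measurable_EFinP; exact: (measurable_funD m1 m2).
- by move=> x _; rewrite lee_fin addr_ge0 ?sqr_ge0.
apply: ge0_ae_eq_integral => //.
- by apply/measurable_EFinP; exact: (measurable_funD m3 m4).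
- apply/measurable_EFinP; apply: measurable_funM; first exact: measurable_cst.
  exact: (measurable_funD m1 m2).
- by move=> x _; rewrite lee_fin addr_ge0 ?sqr_ge0.
- by move=> x _; rewrite -EFinM lee_fin mulr_ge0 ?sqr_ge0// addr_ge0 ?sqr_ge0.
by apply: (ae_inS aek) => x Ox ->; rewrite enorm2Z exprMn -mulrDr.
Qed.

(** For [k = 0] the approximating test function is 0. *)
Lemma H10Z u (k : R) : 0 <= k -> H10 Omega u -> H10 Omega (fun x => k * u x).
Proof.
rewrite le_eqVlt => /predU1P[<-|k0] Hu; last first.
  apply: (H10M (f := cst k) (c := k) (M := k)) => //.
  - by move=> j; exact: Ck_cst.
  - by move=> x; rewrite gt_eqF.
  - by move=> x _; rewrite lexx.
  - by move=> i x _; rewrite /partial derive_cst normr0 ltW.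
have mO := open_measurable_rV oO; have Lu := H1_L2 Hu.
split; first by split; [exact: L2Z|eexists; exact: (wgradZ 0 Hu).1].
move=> e e0; have s0 : [set x : T | (0 : R) != 0] = set0.
  by apply/seteqP; split => x //=; rewrite eqxx.
exists (fun=> 0).
  split; first by move=> j; exact: Ck_cst.
    by rewrite s0 closure0; exact: compact0.
  by rewrite s0 closure0.
apply: H1norm_lt => //.
have -> : ((fun x => (0 * u x)%R) \- (fun=> 0))%R = (fun x => 0 * u x).
  by apply/funext => x; rewrite /= subr0.
by rewrite HsqZ// expr0n/= mul0e lte_fin exprn_gt0.
Qed.

(** The angular derivative of the product is a sum of two products of
    nonnegative functions. *)
Lemma K_plus_weight u (sg e : R) : 0 < e -> 0 < sg <= 2^-1 -> K_plus Omega u ->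
  K_plus Omega (fun x => weight sg e x * u x).
Proof.
move=> e0 s [Hu Gu u0 [U [uU Uev]] uth]; have hm := weight_is_multiplier e0 s.
split; first exact: H10_multiplier oO hm Hu.
- move=> A B hA hB; apply: ae_inS (Gu A B hA hB) _ => x Ox ux.
  by rewrite weight_block// ux.
- apply: ae_inS u0 _ => x Ox ux; rewrite mulr_ge0//.
  exact/ltW/(multiplier_gt0 x hm).
- exists (fun r th => polar_weight sg e r th * U r th); split.
    by apply: ae_inS uU _ => x Ox ux; rewrite weight_polar ux.
  by move=> r th r0 hth; rewrite polar_weight_even Uev.
have [s0 _] := andP s.
apply: ae_inS (ae_inI (ae_inI u0 uth) (wgrad_multiplier oO hm Hu)) _ => x Ox [[ux ut] wx] hth.
have -> : u_theta Omega (fun x => weight sg e x * u x) x =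
   weight sg e x * u_theta Omega u x + u x * dotrV (grad (weight sg e) x) (theta_field x).
  rewrite /u_theta wx /dotrV !mulr_sumr -big_split/=; apply: eq_bigr => i _.
  by rewrite !mxE; ring.
apply: addr_ge0; apply: mulr_ge0; rewrite ?ut ?grad_weight_theta_ge0//.
exact/ltW/(multiplier_gt0 x hm).
Qed.

Lemma K_plusZ u (k : R) : 0 <= k -> K_plus Omega u ->
  K_plus Omega (fun x => k * u x).
Proof.
move=> k0 [Hu Gu u0 [U [uU Uev]] uth]; split.
- exact: H10Z.
- by move=> A B hA hB; apply: ae_inS (Gu A B hA hB) _ => x Ox ->.
- by apply: ae_inS u0 _ => x Ox ux; rewrite mulr_ge0.
- exists (fun r th => k * U r th); split.
    by apply: ae_inS uU _ => x Ox ->.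
  by move=> r th r0 hth; rewrite Uev.
apply: ae_inS (ae_inI uth (wgradZ k Hu).2) _ => x Ox [ut wx] hth.
have -> : u_theta Omega (fun x => k * u x) x = k * u_theta Omega u x.
  by rewrite /u_theta wx /dotrV mulr_sumr; apply: eq_bigr => i _; rewrite !mxE mulrA.
by rewrite mulr_ge0// ut.
Qed.

End multiplication.

End weight.

(** * Passing to the limit in the angular averages *)

Section angular_limit.
Context {R : realType} {n : nat}.
Hypothesis n0 : (0 < n)%N.
Local Notation T := ('rV[R]_(n + n)).
Local Notation mu := (@lebesgue_rV R (n + n)).
Variables (Omega : set T) (D : R -> Prop).
Hypothesis mO : measurable Omega.
Hypothesis OD : forall x, Omega x <-> D (enorm x).

Definition w11 : T -> R := dir_mon first_block 1 1.
Definition w22 : T -> R := dir_mon first_block 2 2.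

Lemma radial_average_in (g w : T -> R) : mu.-integrable Omega (EFin \o g) ->
  (forall x, Omega x -> 0 <= g x) ->
  (exists f : R -> R, ae_in Omega (fun x => g x = f (enorm x))) ->
  measurable_fun setT w -> (forall x, 0 <= w x <= 1) -> homogeneous0 w ->
  \int[mu]_(x in Omega) (g x * w x) = dir_average w * \int[mu]_(x in Omega) g x.
Proof.
move=> ig g0 [f gf] mw w01 hw.
have N0 : (0 < n + n)%N by rewrite addn_gt0 n0.
have mg : measurable_fun setT (g \_ Omega).
  apply/(measurable_restrictT _ mO); apply/measurable_EFinP.
  by case/integrableP : ig.
have g'0 x : 0 <= (g \_ Omega) x.
  by rewrite patchE; case: ifPn => //; rewrite inE => /g0.
pose f' r := if `[< D r >] then f r else 0.
have g'f : {ae mu, forall x, (g \_ Omega) x = f' (enorm x)}.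
  move: gf; rewrite /ae_in; apply: filterS => x H; rewrite /f' patchE.
  case: ifPn => [|]; rewrite ?inE ?notin_setE => Ox.
    by rewrite asboolT ?H//; apply/OD.
  by rewrite asboolF// => /OD.
have := radial_average N0 mg g'0 g'f mw w01 hw.
have -> : (\int[mu]_x ((g \_ Omega) x * w x)%:E = \int[mu]_(x in Omega) (g x * w x)%:E)%E.
  rewrite [RHS]integral_mkcond; apply: eq_integral => x _.
  by rewrite !patchE; case: ifP => // _; rewrite mul0r.
have -> : (\int[mu]_x ((g \_ Omega) x)%:E = \int[mu]_(x in Omega) (g x)%:E)%E.
  rewrite [RHS]integral_mkcond; apply: eq_integral => x _.
  by rewrite !patchE; case: ifP.
by rewrite /Rintegral => ->; rewrite fineM//; exact: integrable_fin_num.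
Qed.

Lemma integrable_bounded_mul (g w : T -> R) (M : R) :
  mu.-integrable Omega (EFin \o g) -> measurable_fun Omega w ->
  (forall x, Omega x -> `|w x| <= M) ->
  mu.-integrable Omega (EFin \o (fun x => g x * w x)).
Proof.
move=> ig mw wM; have mg : measurable_fun Omega g.
  by apply/measurable_EFinP; case/integrableP : ig.
apply: (le_integrable mO _ _ (integrableZl mO M (integrable_abse ig))).
  by apply/measurable_EFinP; exact: measurable_funM.
move=> x Ox; rewrite /= !lee_fin normrM [X in _ <= X]normrM normr_id mulrC.
by rewrite ler_wpM2r// (le_trans (wM x Ox))// ler_norm.
Qed.

(** Dominated convergence, followed by averaging over the directions. *)
Lemma angular_limit (g : T -> R) (w : nat -> T -> R) (c0 c1 c2 M : R) :
  mu.-integrable Omega (EFin \o g) -> (forall x, Omega x -> 0 <= g x) ->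
  (exists f : R -> R, ae_in Omega (fun x => g x = f (enorm x))) ->
  (forall k, measurable_fun Omega (w k)) ->
  (forall k x, Omega x -> `|w k x| <= M) ->
  (forall x, x != 0 -> w ^~ x @ \oo --> c0 + c1 * w11 x + c2 * w22 x) ->
  (fun k => \int[mu]_(x in Omega) (g x * w k x)) @ \oo -->
   (c0 + c1 * (n%:R / (4 * (n%:R + 1))) +
    c2 * (n%:R * (n%:R + 2) / (16 * (n%:R + 1) * (n%:R + 3)))) *
   \int[mu]_(x in Omega) g x.
Proof.
move=> ig g0 gf mw wM wcvg.
have mg : measurable_fun Omega g.
  by apply/measurable_EFinP; case/integrableP : ig.
have mm j : measurable_fun Omega (dir_mon (R := R) first_block j j : T -> R).
  by apply: measurable_funTS; exact: measurable_dir_mon.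
have bm j (x : T) : `|dir_mon first_block j j x| <= 1.
  by have /andP[a b] := dir_mon01 first_block j j x; rewrite ger0_norm.
have i1 : mu.-integrable Omega (EFin \o (fun x => g x * w11 x)).
  exact: (integrable_bounded_mul ig (mm 1%N) (fun x _ => bm 1%N x)).
have i2 : mu.-integrable Omega (EFin \o (fun x => g x * w22 x)).
  exact: (integrable_bounded_mul ig (mm 2%N) (fun x _ => bm 2%N x)).
have [a1 a2] := dir_average_balanced R n0 card_first_block.
have -> : (c0 + c1 * (n%:R / (4 * (n%:R + 1))) +
    c2 * (n%:R * (n%:R + 2) / (16 * (n%:R + 1) * (n%:R + 3)))) *
    \int[mu]_(x in Omega) g x =
    \int[mu]_(x in Omega) (g x * (c0 + c1 * w11 x + c2 * w22 x)).
  have -> : (fun x => g x * (c0 + c1 * w11 x + c2 * w22 x)) =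
    (fun x => (c0 * g x + c1 * (g x * w11 x)) + c2 * (g x * w22 x)).
    by apply/funext => x; ring.
  rewrite RintegralD//; first last.
  - exact: (integrableZl mO c2 i2).
  - exact: (integrableD mO (integrableZl mO c0 ig) (integrableZl mO c1 i1)).
  rewrite RintegralD//; first last.
  - exact: (integrableZl mO c1 i1).
  - exact: (integrableZl mO c0 ig).
  rewrite !RintegralZl// /w11 /w22 !radial_average_in//; first last.
  - exact: dir_mon_homogeneous.
  - exact: dir_mon01.
  - exact: measurable_dir_mon.
  - exact: dir_mon_homogeneous.
  - exact: dir_mon01.
  - exact: measurable_dir_mon.
  by rewrite a1 a2; ring.
have mlim : measurable_fun Omega (fun x => g x * (c0 + c1 * w11 x + c2 * w22 x)).
  apply: measurable_funM => //; apply: measurable_funD; last first.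
    by apply: measurable_funM => //; exact: mm.
  apply: measurable_funD => //; apply: measurable_funM => //; exact: mm.
have := @dominated_convergence _ _ _ mu Omega mO
  (fun k x => (g x * w k x)%:E) (fun x => (g x * (c0 + c1 * w11 x + c2 * w22 x))%:E)
  (fun x => (M%:E * `|(g x)%:E|)%E).
case.
- by move=> k; apply/measurable_EFinP; exact: measurable_funM.
- exact/measurable_EFinP.
- exists [set 0]; split.
  + exact: measurable_rV_set1.
  + case: (n) n0 => // m _; exact: lebesgue_rV_set0.
  + move=> x /= H; apply: contrapT => x0; apply: H => Ox.
    apply/fine_cvgP; split; first exact: nearW.
    by apply: cvgMr; apply: wcvg; exact/eqP.
- exact: (integrableZl mO M (integrable_abse ig)).
- apply: aeW => x k Ox; rewrite -EFinM /= !lee_fin normrM mulrC.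
  by rewrite ler_wpM2r// wM.
move=> il _ h.
have fl : (\int[mu]_(x in Omega) (g x * (c0 + c1 * w11 x + c2 * w22 x))%:E)%E \is a fin_num.
  exact: integrable_fin_num.
move: h; rewrite -(fineK fl) => /fine_cvg; exact.
Qed.

End angular_limit.

(** * The regularised harmonic tends to the harmonic *)

Section harmonic.
Context {R : realType} {n : nat}.
Hypothesis n0 : (0 < n)%N.
Local Notation T := ('rV[R]_(n + n)).
Local Notation Cn := (@Cn R n).

Definition psi (e : R) (x : T) : R := weight 1 e x - 1.

Lemma weightE (sg e : R) x : weight sg e x = 1 + sg * psi e x.
Proof. by rewrite /psi /weight mul1r addrAC subrr add0r. Qed.

Lemma psi_bound (e : R) x : 0 < e -> `|psi e x| <= 1.
Proof.
move=> e0; have /andP[a b] := weight_bounds n0 x e0 (@ltr01 R).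
by rewrite /psi ler_norml; apply/andP; split; lra.
Qed.

Lemma smooth_psi (e : R) : 0 < e -> smooth (psi e).
Proof.
move=> e0 k; apply: (CkD (g := cst (- 1))); last exact: Ck_cst.
exact: smooth_weight.
Qed.

(** This is [|grad (psi e)| ^ 2], since [psi e] and [weight 1 e] differ by a
    constant. *)
Definition psi_energy (e : R) (x : T) : R := enorm (grad (weight 1 e) x) ^+ 2.

Lemma enorm2_grad_weightE (sg e : R) x : 0 < e ->
  enorm (grad (weight sg e) x) ^+ 2 = sg ^+ 2 * psi_energy e x.
Proof. by move=> e0; rewrite /psi_energy !enorm2_grad_weight// expr1n mul1r. Qed.

Lemma measurable_psi_energy (e : R) : 0 < e ->
  measurable_fun setT (psi_energy e).
Proof.
move=> e0; rewrite /psi_energy; under eq_fun do rewrite sqr_enorm.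
apply: measurable_sum => i; apply: measurable_funX; under eq_fun do rewrite mxE.
by apply: smooth_measurable; apply: smooth_partial; exact: smooth_weight.
Qed.

Lemma psi_energy_bound (e : R) x : 0 < e ->
  `|psi_energy e x * enorm x ^+ 2| <= 4 * Cn ^+ 2.
Proof.
move=> e0; rewrite ger0_norm ?mulr_ge0 ?exprn_ge0 ?sqrtr_ge0//.
by have := grad_weight_le 1 x e0; rewrite expr1n mul1r.
Qed.

Let eps (k : nat) : R := k.+1%:R^-1.

Let eps_gt0 k : 0 < eps k. Proof. by rewrite invr_gt0. Qed.

Let eps_cvg0 : eps @ \oo --> 0.
Proof. exact: cvg_harmonic. Qed.

Lemma rhoV_cvg (x : T) : x != 0 -> (fun k => (rho (eps k) x)^-1) @ \oo --> (enorm x ^+ 2)^-1.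
Proof.
move=> x0; have r0 : enorm x ^+ 2 != 0 by rewrite sqrf_eq0 enorm_eq0.
apply: cvgV => //; rewrite -[X in _ --> X]addr0 /rho; under eq_fun do rewrite sSTE.
by apply: cvgD => //; exact: cvg_cst.
Qed.

Lemma dir_monE (x : T) : x != 0 ->
  w11 x = sS x * sT x * (enorm x ^+ 2)^-1 ^+ 2 /\ w22 x = w11 x ^+ 2.
Proof.
by move=> x0; rewrite /w11 /w22 /dir_mon -/(sS x) -/(sT x); split; ring.
Qed.

Lemma psi_cvg (x : T) : x != 0 -> (fun k => psi (eps k) x) @ \oo --> - 1 + Cn * w11 x.
Proof.
move=> x0; have [-> _] := dir_monE x0.
under eq_fun do rewrite /psi /weight mul1r addrAC subrr add0r addrC -exprVn -mulrA.
apply: cvgD; first exact: cvg_cst.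
apply: cvgMr; apply: cvgMr.
have h := rhoV_cvg x0; under eq_fun do rewrite expr2.
by rewrite expr2; apply: cvgM.
Qed.

Lemma psi_energy_cvg (x : T) : x != 0 ->
  (fun k => psi_energy (eps k) x * enorm x ^+ 2) @ \oo -->
    4 * Cn ^+ 2 * (w11 x - 4 * w22 x).
Proof.
move=> x0; have [w1 w2] := dir_monE x0.
have r0 : enorm x ^+ 2 != 0 by rewrite sqrf_eq0 enorm_eq0.
have h := rhoV_cvg x0.
have q0 k : rho (eps k) x != 0 by rewrite gt_eqF// rho_gt0.
pose v k := (rho (eps k) x)^-1.
have -> : (fun k => psi_energy (eps k) x * enorm x ^+ 2) = (fun k =>
    4 * Cn ^+ 2 * enorm x ^+ 2 * (sS x * sT x ^+ 2 * ((1 - 2 * sS x * v k) * (1 - 2 * sS x * v k)) +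
     sT x * sS x ^+ 2 * ((1 - 2 * sT x * v k) * (1 - 2 * sT x * v k))) * ((v k * v k) * (v k * v k))).
  apply/funext => k; rewrite /psi_energy enorm2_grad_weight// /v.
  by move: (rho _ _) (q0 k) => r qr; field.
have -> : 4 * Cn ^+ 2 * (w11 x - 4 * w22 x) =
    4 * Cn ^+ 2 * enorm x ^+ 2 * (sS x * sT x ^+ 2 * ((1 - 2 * sS x * (enorm x ^+ 2)^-1) * (1 - 2 * sS x * (enorm x ^+ 2)^-1)) +
     sT x * sS x ^+ 2 * ((1 - 2 * sT x * (enorm x ^+ 2)^-1) * (1 - 2 * sT x * (enorm x ^+ 2)^-1))) *
     (((enorm x ^+ 2)^-1 * (enorm x ^+ 2)^-1) * ((enorm x ^+ 2)^-1 * (enorm x ^+ 2)^-1)).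
  rewrite w2 w1; move: r0; rewrite -sSTE => r0.
  by move: (sS x) (sT x) r0 => a b r0; field.
have c1 c : (fun k => 1 - c * v k) @ \oo --> 1 - c * (enorm x ^+ 2)^-1.
  by apply: cvgB; [exact: cvg_cst|exact: cvgMr].
apply: cvgM; last by apply: cvgM; exact: cvgM.
apply: cvgMr; apply: cvgD; apply: cvgMr; apply: cvgM; exact: c1.
Qed.

End harmonic.

(** * Inequalities for real powers *)

Section powers.
Context {R : realType}.
Implicit Types (p q x y s t : R).

Lemma powRV x q : 0 <= x -> x^-1 `^ q = (x `^ q)^-1.
Proof. by move=> x0; rewrite -[in LHS]powR_inv1// -powRrM mulN1r powRN. Qed.

(** This is Young's inequality for the product of [x] and 1. *)
Lemma powR_bernoulli q x : 1 <= q -> 0 <= x -> 1 + q * (x - 1) <= x `^ q.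
Proof.
rewrite le_eqVlt => /predU1P[<-|q1] x0; first by rewrite powRr1// mul1r addrC subrK.
have q0 : 0 < q by lra.
have q1' : 0 < q - 1 by lra.
have := @conjugate_powR R x 1 q (q / (q - 1)) x0 ler01 q0 (divr_gt0 q0 q1').
have -> : q^-1 + (q / (q - 1))^-1 = 1 by field; rewrite !gt_eqF.
move=> /(_ erefl); rewrite mulr1 powR1 mul1r invf_div -(ler_pM2l q0).
by rewrite mulrDr !(mulrC q (_ / _)) !divfK ?gt_eqF//; lra.
Qed.

(** The difference of the two sides vanishes to second order at 0 and its
    derivative has the sign of the variable; for negative values this is
    Bernoulli's inequality at the inverse of the base. *)
Lemma powR_taylor2 p (c : R) : 2 < p -> 0 <= c -> 2 * c < p * (p - 1) ->
  exists2 d : R, 0 < d & forall y, `|y| <= d -> 1 + p * y + c * y ^+ 2 <= (1 + y) `^ p.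
Proof.
move=> p2 c0 cp; have p0 : 0 < p by lra.
pose b := 2 * c / p.
have b0 : 0 <= b by rewrite /b divr_ge0 ?(ltW p0)// mulr_ge0.
have bp : b < p - 1 by rewrite /b ltr_pdivrMr// [_ * p]mulrC.
have cb : 2 * c = p * b by rewrite /b [RHS]mulrC divfK// gt_eqF.
have bp2 : 0 <= b * (p - 2) by rewrite mulr_ge0//; lra.
pose d := Num.min 2^-1 ((p - 1 - b) / (b * (p - 2) + 1)).
have d0 : 0 < d.
  rewrite /d lt_min invr_gt0 ltr0n/= divr_gt0//; lra.
have d1 : d <= 2^-1 by rewrite /d ge_min lexx.
have d2 : b * (p - 2) * d <= p - 1 - b.
  apply: (@le_trans _ _ ((b * (p - 2) + 1) * d)).
    by rewrite ler_wpM2r ?(ltW d0)//; lra.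
  rewrite mulrC -ler_pdivlMr; last lra.
  by rewrite /d ge_min lexx orbT.
exists d => // y yd.
pose F x := x `^ p - (1 + p * (x - 1) + c * (x - 1) ^+ 2).
pose dF x := p * x `^ (p - 1) - (p + 2 * c * (x - 1)).
suff F0 : F 1 <= F (1 + y).
  move: F0; rewrite /F powR1 subrr expr0n/= !mulr0 !addr0 subrr subr_ge0.
  by rewrite [1 + y - 1]addrC addKr.
have DF x : 0 < x -> is_derive x 1 F (dF x).
  move=> x0; have h0 := is_derive1_powR p x0.
  have h1 := is_deriveB (is_derive_id x (1 : R)) (is_derive_cst (1 : R) x (1 : R)).
  have h2 := is_deriveM (is_derive_cst p x (1 : R)) h1.
  have h3 := is_deriveM (is_derive_cst c x (1 : R)) (is_deriveX 2 h1).
  have H := is_deriveB h0 (is_deriveD (is_deriveD (is_derive_cst (1 : R) x (1 : R)) h2) h3).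
  apply: is_derive_eq H _.
  by rewrite /dF !fctE /GRing.scale/=; ring.
have cF s t : 0 < s -> {within `[s, t], continuous F}.
  move=> s0; apply: derivable_within_continuous => x; rewrite in_itv/= => /andP[sx _].
  by have [] := DF x (lt_le_trans s0 sx).
have [y0|y0] := leP 0 y.
  have y1 : 1 <= 1 + y by lra.
  have [x|z] := @MVT_segment R F dF 1 (1 + y) y1 _ (cF _ _ ltr01).
    by rewrite in_itv/= => /andP[x1 _]; apply: DF; apply: lt_trans x1.
  rewrite in_itv/= => /andP[z1 _] E; rewrite -subr_ge0 E mulr_ge0//; last lra.
  have := @powR_bernoulli (p - 1) z; rewrite /dF cb.
  have p1 : 1 <= p - 1 by lra.
  have z0 : 0 <= z by lra.
  move=> /(_ p1 z0); move: (z `^ _) => P h.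
  have -> : p * P - (p + p * b * (z - 1)) = p * (P - 1 - b * (z - 1)) by ring.
  rewrite mulr_ge0 ?(ltW p0)//.
  have : b * (z - 1) <= (p - 1) * (z - 1) by rewrite ler_wpM2r//; lra.
  lra.
have yd' : - d <= y by move: yd; rewrite ler_norml => /andP[].
have y1 : 1 + y <= 1 by lra.
have y1' : 0 < 1 + y by lra.
have [x|z] := @MVT_segment R F dF (1 + y) 1 y1 _ (cF _ _ y1').
  by rewrite in_itv/= => /andP[x1 _]; apply: DF; apply: lt_trans x1.
rewrite in_itv/= => /andP[z1 z2] E; rewrite -subr_le0 E mulr_le0_ge0//; last lra.
have z0 : 0 < z by lra.
have p1 : 1 <= p - 1 by lra.
have zi0 : 0 <= z^-1 by rewrite invr_ge0 ltW.
have := powR_bernoulli p1 zi0; rewrite powRV ?(ltW z0)// /dF cb.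
have P0 : 0 < z `^ (p - 1) by exact: powR_gt0.
move: (z `^ _) P0 => P P0 h.
pose w := 1 - z.
have w0 : 0 <= w by rewrite /w; lra.
have wd : w <= d by rewrite /w; lra.
have zE : z = 1 - w by rewrite /w; ring.
have h1 : P * (1 + (p - 2) * w) <= z.
  move: h; rewrite -(ler_pM2l (mulr_gt0 P0 z0)).
  have -> : P * z / P = z by rewrite mulrAC divff ?mul1r// gt_eqF.
  have -> : P * z * (1 + (p - 1) * (z^-1 - 1)) = P * (1 + (p - 2) * w).
    by rewrite zE in z0 *; field; rewrite gt_eqF.
  by [].
have h2 : z <= (1 - b * w) * (1 + (p - 2) * w).
  have h3 : b * (p - 2) * w <= b * (p - 2) * d by rewrite ler_wpM2l.
  have : 0 <= w * ((p - 1 - b) - b * (p - 2) * w) by rewrite mulr_ge0//; lra.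
  by rewrite zE; nra.
have h4 : P <= 1 - b * w.
  have k0 : 0 < 1 + (p - 2) * w by rewrite ltr_pwDl// mulr_ge0//; lra.
  by rewrite -(ler_pM2r k0) (le_trans h1).
have -> : p * P - (p + p * b * (z - 1)) = p * (P - (1 - b * w)) by rewrite zE; ring.
by rewrite mulr_ge0_le0 ?(ltW p0)// subr_le0.
Qed.

(** Bernoulli's inequality at the inverse of [1 + K s] bounds its power from
    above by the inverse of a linear function. *)
Lemma powR_first_order q (K c : R) : 1 <= q -> 0 <= K -> q * K < c ->
  exists2 s0 : R, 0 < s0 & forall s, 0 < s <= s0 -> (1 + K * s) `^ q < 1 + c * s.
Proof.
move=> q1 K0 Kc; pose b := q * K.
have b0 : 0 <= b by rewrite mulr_ge0//; lra.
have c0 : 0 < c by rewrite -/b in Kc; lra.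
have cb : 0 <= c * b by rewrite mulr_ge0// ltW.
exists ((c - b) / (c * b + 1)); first by rewrite divr_gt0//; rewrite -/b in Kc; lra.
move=> s /andP[s0]; rewrite ler_pdivlMr; last lra.
move=> ss; have ss' : c * b * s < c - b by rewrite mulrC; rewrite mulrDr mulr1 in ss; lra.
have Ks : 0 <= K * s by rewrite mulr_ge0// ltW.
have x0 : 0 < 1 + K * s by lra.
have xi0 : 0 <= (1 + K * s)^-1 by rewrite invr_ge0 ltW.
have h := powR_bernoulli q1 xi0.
have h1 : 1 - b * s <= 1 + q * ((1 + K * s)^-1 - 1).
  have -> : 1 + q * ((1 + K * s)^-1 - 1) = 1 - b * s / (1 + K * s).
    by rewrite /b; field; rewrite gt_eqF.
  rewrite lerD2l lerN2 ler_pdivrMr// ler_peMr ?mulr_ge0 ?(ltW s0)//; lra.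
have h2 : 1 < (1 + c * s) * (1 - b * s).
  have : 0 < s * (c - b - c * b * s) by rewrite mulr_gt0//; lra.
  by move=> *; nra.
have cs : 0 < 1 + c * s by rewrite ltr_wpDr// mulr_ge0// ltW.
have h3 : 0 < 1 - b * s by rewrite -(pmulr_rgt0 _ cs); lra.
rewrite -(ltr_pM2r h3); apply: le_lt_trans h2.
apply: (@le_trans _ _ ((1 + K * s) `^ q * (1 + K * s)^-1 `^ q)).
  by rewrite ler_wpM2l ?powR_ge0// (le_trans h1).
by rewrite -powRM ?(ltW x0)// divff ?powR1// gt_eqF.
Qed.

(** The maximum of [t ^ 2 * A / 2 - t ^ p * B / p] is a multiple of
    [(A ^ p / B ^ 2) ^ (1 / (p - 2))]; tangent lines of the power suffice to
    bound it. *)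
Lemma fibering_max p (alpha b I : R) : 2 < p -> 0 < alpha -> 0 < I ->
  alpha `^ (p / 2) < b ->
  exists2 th : R, th < (2^-1 - p^-1) * I & forall A B t, 0 <= t ->
    A <= alpha * I -> b * I <= B -> 2^-1 * (t ^+ 2 * A) - p^-1 * (t `^ p * B) <= th.
Proof.
move=> p2 a0 I0 ab; pose q := p / 2; have pq : p = 2 * q by rewrite /q; field.
have q1 : 1 < q by rewrite /q; lra.
have aq0 : 0 < alpha `^ q by exact: powR_gt0.
have b0 : 0 < b by exact: lt_trans ab.
pose r := alpha `^ q / b; have r0 : 0 < r by exact: divr_gt0.
have r1 : r < 1 by rewrite /r ltr_pdivrMr// mul1r.
have q1' : 0 < q - 1 by lra.
pose z := r `^ (q - 1)^-1.
have z0 : 0 < z by exact: powR_gt0.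
have z1 : z < 1.
  have -> : 1 = 1 `^ (q - 1)^-1 :> R by rewrite powR1.
  by rewrite gt0_ltr_powR ?invr_gt0// nnegrE ltW.
have zr : z `^ (q - 1) = r by rewrite /z -powRrM mulVf ?gt_eqF// powRr1// ltW.
have th0 : 0 < 2^-1 - p^-1 by rewrite subr_gt0 ltf_pV2 ?posrE//; lra.
exists (z * ((2^-1 - p^-1) * I)).
  by rewrite -[ltRHS]mul1r ltr_pM2r// mulr_gt0.
move=> A B t t0 hA hB.
have h1 : t ^+ 2 * A <= t ^+ 2 * (alpha * I) by rewrite ler_wpM2l ?sqr_ge0.
have h2 : t `^ p * (b * I) <= t `^ p * B by rewrite ler_wpM2l ?powR_ge0.
pose y := t ^+ 2 * alpha.
have y0 : 0 <= y by rewrite mulr_ge0 ?sqr_ge0// ltW.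
have h3 : z * (1 - q) + q * y <= t `^ p * b.
  have yz0 : 0 <= y / z by rewrite divr_ge0// ltW.
  have := powR_bernoulli (ltW q1) yz0.
  have -> : t `^ p * b = z * (y / z) `^ q.
    have -> : (y / z) `^ q = y `^ q / z `^ q.
      by rewrite powRM ?invr_ge0 ?(ltW z0)// powRV// ltW.
    have -> : z `^ q = z * r.
      by rewrite -zr mulr_powRB1// ?(ltW z0)//; lra.
    have -> : y `^ q = t `^ p * alpha `^ q.
      by rewrite /y powRM ?sqr_ge0 ?(ltW a0)// -powR_mulrn// -powRrM -pq.
    by rewrite /r; field; rewrite !gt_eqF.
  move=> h; have := ler_wpM2l (ltW z0) h.
  by congr (_ <= _); field; rewrite gt_eqF.
have pV : 0 < p^-1 by rewrite invr_gt0; lra.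
have pq1 : p^-1 * q = 2^-1 by rewrite pq; field; rewrite gt_eqF//; lra.
have h4 := ler_wpM2l (ltW pV) h2.
have h5 : p^-1 * ((z * (1 - q) + q * y) * I) <= p^-1 * (t `^ p * (b * I)).
  by rewrite ler_wpM2l ?(ltW pV)// mulrA ler_wpM2r// ltW.
have E : z * ((2^-1 - p^-1) * I) =
    2^-1 * (t ^+ 2 * (alpha * I)) - p^-1 * ((z * (1 - q) + q * y) * I).
  have -> : p^-1 * ((z * (1 - q) + q * y) * I) = z * (p^-1 - p^-1 * q) * I + p^-1 * q * (y * I) by ring.
  by rewrite pq1 /y; ring.
by rewrite E; lra.
Qed.

End powers.

(** * The equation tested against multiples of the solution *)

Section energy.
Context {R : realType} {n : nat}.
Local Notation T := ('rV[R]_(n + n)).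
Local Notation mu := (@lebesgue_rV R (n + n)).
Variables (Omega : set T) (lambda : R) (a : T -> R) (p : R).
Hypothesis oO : open Omega.
Hypothesis p2 : 2 < p.
Hypothesis ma : measurable_fun Omega a.
Hypothesis a0 : forall x, Omega x -> 0 <= a x.

Let mO : measurable Omega := open_measurable_rV oO.
Let p0 : 0 < p := lt_trans (@ltr0Sn R 1) p2.

Definition density (u : T -> R) (x : T) : R := a x * `|u x| `^ p.

Definition quad (u : T -> R) (x : T) : R :=
  enorm (wgrad Omega u x) ^+ 2 + lambda * u x ^+ 2.

Lemma density_ge0 u x : Omega x -> 0 <= density u x.
Proof. by move=> Ox; rewrite mulr_ge0 ?powR_ge0 ?a0. Qed.

Lemma measurable_density u : measurable_fun Omega u -> measurable_fun Omega (density u).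
Proof.
move=> mf; apply: measurable_funM => //.
apply: (measurableT_comp (measurable_powR p)).
exact: (measurableT_comp (@normr_measurable R setT)).
Qed.

Lemma integrable_ge0 (f : T -> R) : measurable_fun Omega f ->
  (forall x, Omega x -> 0 <= f x) ->
  (\int[mu]_(x in Omega) (f x)%:E < +oo)%E -> mu.-integrable Omega (EFin \o f).
Proof.
move=> mf f0 fo; apply/integrableP; split; first exact/measurable_EFinP.
rewrite (_ : integral _ _ _ = \int[mu]_(x in Omega) (f x)%:E)%E//.
by apply: eq_integral => x; rewrite inE => Ox /=; rewrite ger0_norm// f0.
Qed.

Lemma integrable_density u : V Omega a p u -> mu.-integrable Omega (EFin \o density u).
Proof.
move=> [Hu Wu]; apply: integrable_ge0 => //; last exact: density_ge0.
by apply: measurable_density; case: (H1_L2 Hu).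
Qed.

Lemma weighted_intE u : V Omega a p u ->
  weighted_int Omega a p u = (\int[mu]_(x in Omega) density u x)%:E.
Proof. by move=> Vu; rewrite /Rintegral fineK//; apply: integrable_fin_num => //; exact: integrable_density. Qed.

Lemma weighted_intZ u (k : R) : measurable_fun Omega u ->
  weighted_int Omega a p (fun x => k * u x) =
  ((`|k| `^ p)%:E * weighted_int Omega a p u)%E.
Proof.
move=> mf; rewrite -ge0_integralZl_EFin//; first last.
- by apply/measurable_EFinP; exact: measurable_density.
- by move=> x Ox; rewrite lee_fin; exact: (density_ge0 u Ox).
apply: eq_integral => x _; rewrite -EFinM; congr EFin.
by rewrite normrM powRM//; ring.
Qed.

Lemma integrable_grad2 u : H10 Omega u ->
  mu.-integrable Omega (EFin \o (fun x => enorm (wgrad Omega u x) ^+ 2)).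
Proof.
move=> Hu; have gu := H10_wgrad Hu.
have -> : EFin \o (fun x => enorm (wgrad Omega u x) ^+ 2) =
    (fun x => \sum_(i < n + n) (wgrad Omega u x ord0 i ^+ 2)%:E)%E.
  by apply/funext => x; rewrite /= sqr_enorm sumEFin.
by apply: integrable_sum => // i _; apply: integrable_sqr; case: (gu i).
Qed.

Lemma integrable_quad u : H10 Omega u -> mu.-integrable Omega (EFin \o quad u).
Proof.
move=> Hu; have i1 := integrable_grad2 Hu.
exact: (integrableD mO i1 (integrableZl mO lambda (integrable_sqr (H1_L2 Hu)))).
Qed.

Lemma densityM f u x : density (fun x => f x * u x) x = density u x * `|f x| `^ p.
Proof. by rewrite /density normrM powRM// [_ `^ p * _]mulrC mulrA. Qed.

(** The density of [f u] is the density of [u] times a bounded function. *)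
Lemma V_multiplier f M u : multiplier f M -> V Omega a p u ->
  V Omega a p (fun x => f x * u x).
Proof.
move=> h [Hu Wu]; have [M0 fM] := multiplier_bound h; split.
  exact: H10_multiplier oO h Hu.
have mf := (H1_L2 Hu).1.
have mfu : measurable_fun Omega (fun x => f x * u x).
  by apply: measurable_funM => //; apply: smooth_measurable; case: h.
rewrite /weighted_int.
apply: (@le_lt_trans _ _ ((M `^ p)%:E * \int[mu]_(x in Omega) (density u x)%:E)%E).
  rewrite -ge0_integralZl_EFin//; first last.
  - exact: powR_ge0.
  - by apply/measurable_EFinP; exact: measurable_density.
  - by move=> x Ox; rewrite lee_fin density_ge0.
  apply: ge0_le_integral => //.
  - by move=> x Ox; rewrite lee_fin mulr_ge0 ?powR_ge0 ?a0.
  - by apply/measurable_EFinP; exact: (measurable_density mfu).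
  - apply/measurable_EFinP; apply: measurable_funM => //; exact: measurable_density.
  move=> x Ox; rewrite -EFinM lee_fin -/(density (fun x => f x * u x) x) densityM mulrC.
  rewrite ler_wpM2r ?density_ge0// ge0_ler_powR ?nnegrE ?(ltW M0) ?(ltW p0)//.
by rewrite lte_mul_pinfty ?lee_fin ?powR_ge0.
Qed.

Lemma Rintegral_ae (f g : T -> R) : measurable_fun Omega f -> measurable_fun Omega g ->
  ae_in Omega (fun x => f x = g x) ->
  \int[mu]_(x in Omega) f x = \int[mu]_(x in Omega) g x.
Proof.
move=> mf mg fg; rewrite /Rintegral; congr fine; apply: ae_eq_integral => //.
- exact/measurable_EFinP.
- exact/measurable_EFinP.
- by apply: ae_inS fg _ => x _ ->.
Qed.

Lemma measurable_quad u : H10 Omega u -> measurable_fun Omega (quad u).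
Proof. by move=> Hu; apply/measurable_EFinP; case/integrableP : (integrable_quad Hu). Qed.

Lemma measurable_enorm_grad f : smooth f ->
  measurable_fun Omega (fun x => enorm (grad f x) ^+ 2).
Proof.
move=> sf; under eq_fun do rewrite sqr_enorm.
apply: measurable_sum => i; apply: measurable_funX; under eq_fun do rewrite mxE.
by apply: smooth_measurable; apply: smooth_partial.
Qed.

Lemma integrable_grad_error f M u : multiplier f M -> H10 Omega u ->
  mu.-integrable Omega (EFin \o (fun x => u x ^+ 2 * enorm (grad f x) ^+ 2)).
Proof.
move=> [sf _ df] Hu; have iu := integrable_sqr (H1_L2 Hu).
have bd x : Omega x -> `|enorm (grad f x) ^+ 2| <= (n + n)%:R * M ^+ 2.
  by move=> _; rewrite ger0_norm ?sqr_ge0//; apply: enorm2_grad_le => i; exact: df.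
exact: (integrable_bounded_mul mO iu (measurable_enorm_grad sf) bd).
Qed.

(** The equation is tested with [f ^ 2 u]; the square of the gradient of [f u]
    differs from the resulting integrand by [u ^ 2 |grad f| ^ 2]. *)
Lemma energy_multiplier f M u : multiplier f M -> weak_solution Omega lambda a p u ->
  \int[mu]_(x in Omega) quad (fun x => f x * u x) x =
  \int[mu]_(x in Omega) (density u x * f x ^+ 2) +
  \int[mu]_(x in Omega) (u x ^+ 2 * enorm (grad f x) ^+ 2).
Proof.
move=> h [Vu upos weak]; have Hu := Vu.1.
have Vv := V_multiplier h Vu; have Hv := Vv.1.
have Ve := V_multiplier h Vv; have He := Ve.1.
have sf : smooth f by case: h.
have [M0 fM] := multiplier_bound h.
have mu0 := (H1_L2 Hu).1.
have mf : measurable_fun Omega f by exact: smooth_measurable.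
have ae1 := ae_inI (wgrad_multiplier oO h Hu) (wgrad_multiplier oO h Hv).
have ig := integrable_grad_error h Hu.
have mdot : measurable_fun Omega (fun x =>
    dotrV (wgrad Omega u x) (wgrad Omega (fun x => f x * (f x * u x)) x) +
    lambda * (u x * (f x * (f x * u x)))).
  apply: measurable_funD.
    apply: measurable_sum => i; apply: measurable_funM.
      by have [[]] := H10_wgrad Hu i.
    by have [[]] := H10_wgrad He i.
  apply: measurable_funM => //; apply: measurable_funM => //.
  by apply: measurable_funM => //; apply: measurable_funM.
have E1 : \int[mu]_(x in Omega) (dotrV (wgrad Omega u x) (wgrad Omega (fun x => f x * (f x * u x)) x) +
    lambda * (u x * (f x * (f x * u x)))) =
   \int[mu]_(x in Omega) quad (fun x => f x * u x) x -
   \int[mu]_(x in Omega) (u x ^+ 2 * enorm (grad f x) ^+ 2).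
  rewrite -RintegralB//; last exact: integrable_quad.
  apply: Rintegral_ae => //.
    apply: (measurable_funB (measurable_quad Hv)).
    by apply/measurable_EFinP; case/integrableP : ig.
  apply: ae_inS ae1 _ => x Ox [e1 e2]; rewrite /quad e2 e1 !sqr_enorm.
  rewrite /dotrV mulr_sumr addrAC -sumrB; congr (_ + _); last by ring.
  by apply: eq_bigr => i _; rewrite !mxE; ring.
have E2 : \int[mu]_(x in Omega) (a x * u x `^ (p - 1) * (f x * (f x * u x))) =
    \int[mu]_(x in Omega) (density u x * f x ^+ 2).
  apply: Rintegral_ae.
  - apply: measurable_funM; last by apply: measurable_funM => //; apply: measurable_funM.
    by apply: measurable_funM => //; exact: (measurableT_comp (measurable_powR (p - 1))).
  - by apply: measurable_funM; [exact: measurable_density|exact: measurable_funX].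
  apply: ae_inS upos _ => x Ox ux; rewrite /density gtr0_norm//.
  by rewrite -(mulr_powRB1 (ltW ux) p0); ring.
by rewrite -E2 -(weak _ Ve) E1 subrK.
Qed.

Lemma energy_solution u : weak_solution Omega lambda a p u ->
  \int[mu]_(x in Omega) quad u x = \int[mu]_(x in Omega) density u x.
Proof.
move=> wu; have := energy_multiplier multiplier_cst1 wu.
have -> : (fun x => cst 1 x * u x) = u by apply/funext => x; rewrite mul1r.
under [X in _ = X + _ -> _]eq_Rintegral do rewrite expr1n mulr1.
under [X in _ = _ + X -> _]eq_Rintegral => x _.
  rewrite (_ : grad _ x = 0); last first.
    by apply/rowP => i; rewrite !mxE /partial derive_cst.
  rewrite -[0](scale0r 0) enorm2Z expr0n mul0r mulr0; over.
by rewrite Rintegral_cst// mul0r addr0.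
Qed.

Lemma E_K_multiple u t : 0 <= t -> K_plus Omega u -> V Omega a p u ->
  E_K Omega lambda a p (fun x => t * u x) =
   (2^-1 * (t ^+ 2 * \int[mu]_(x in Omega) quad u x) -
    p^-1 * (t `^ p * \int[mu]_(x in Omega) density u x))%:E.
Proof.
move=> t0 Ku Vu; have Hu := Vu.1; rewrite /E_K asboolT; last exact: K_plusZ.
have [gtu aet] := wgradZ oO t Hu.
have E1 : (\int[mu]_(x in Omega) (enorm (wgrad Omega (fun x => t * u x) x) ^+ 2 +
    lambda * (t * u x) ^+ 2)%:E = (t ^+ 2 * \int[mu]_(x in Omega) quad u x)%:E)%E.
  rewrite -RintegralZl//; last exact: integrable_quad.
  rewrite /Rintegral fineK; last first.
    by apply: integrable_fin_num => //; exact: (integrableZl mO (t ^+ 2) (integrable_quad Hu)).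
  apply: ae_eq_integral => //.
  - by apply/measurable_EFinP; exact: (measurable_quad (H10Z oO t0 Hu)).
  - by apply/measurable_EFinP; apply: measurable_funM => //; exact: measurable_quad.
  by apply: ae_inS aet _ => x Ox ->; rewrite enorm2Z /quad; congr EFin; ring.
have E2 : weighted_int Omega a p (fun x => t * u x) =
    (t `^ p * \int[mu]_(x in Omega) density u x)%:E.
  by rewrite weighted_intZ ?weighted_intE ?ger0_norm//; exact: (H1_L2 Hu).1.
by rewrite E1 E2 -!EFinM -EFinB.
Qed.

End energy.

(** * Perturbing a radial solution *)

Section perturbation.
Context {R : realType} {n : nat}.
Hypothesis n0 : (0 < n)%N.
Local Notation T := ('rV[R]_(n + n)).
Local Notation mu := (@lebesgue_rV R (n + n)).
Local Notation Cn := (@Cn R n).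
Variables (Omega : set T) (lambda : R) (a : T -> R) (p : R) (D : R -> Prop).
Hypothesis oO : open Omega.
Hypothesis OD : forall x, Omega x <-> D (enorm x).
Hypothesis lam0 : 0 <= lambda.
Hypothesis p2 : 2 < p.
Hypothesis ma : measurable_fun Omega a.
Hypothesis a0 : forall x, Omega x -> 0 <= a x.
Hypothesis ar : exists f : R -> R, forall x, Omega x -> a x = f (enorm x).

Let mO : measurable Omega := open_measurable_rV oO.
Let p0 : 0 < p := lt_trans (@ltr0Sn R 1) p2.

Variable u : T -> R.
Hypothesis wu : weak_solution Omega lambda a p u.

Let Vu : V Omega a p u. Proof. by case: wu. Qed.
Let Hu : H10 Omega u := Vu.1.

Let dens := density a p u.

Definition hardy_weight (x : T) : R := u x ^+ 2 / enorm x ^+ 2.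

Let Q := \int[mu]_(x in Omega) quad Omega lambda u x.
Hypothesis Q0 : 0 < Q.

Let QE : Q = \int[mu]_(x in Omega) dens x.
Proof. exact: (energy_solution oO p2 ma a0). Qed.

Lemma measurable_hardy_weight : measurable_fun Omega hardy_weight.
Proof.
apply: measurable_funM; first by apply: measurable_funX; exact: (H1_L2 Hu).1.
apply: (measurableT_comp measurable_inv); apply: measurable_funX.
by apply: measurable_funTS; exact: measurable_enorm.
Qed.

Lemma hardy_weight_ge0 x : 0 <= hardy_weight x.
Proof. by rewrite divr_ge0 ?sqr_ge0. Qed.

Lemma hardy_quotientE : hardy_quotient Omega lambda u =
  (Q%:E / \int[mu]_(x in Omega) (hardy_weight x)%:E)%E.
Proof.
rewrite /hardy_quotient; congr (_ / _)%E; rewrite /Q /Rintegral fineK; last first.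
  exact: (integrable_fin_num mO (integrable_quad lambda oO Hu)).
have m2 : measurable_fun Omega (fun x => u x ^+ 2) by apply: measurable_funX; exact: (H1_L2 Hu).1.
rewrite -ge0_integralZl_EFin//; first last.
- exact/measurable_EFinP.
- by move=> x _; rewrite lee_fin sqr_ge0.
rewrite -ge0_integralD//.
- by move=> x _; rewrite lee_fin sqr_ge0.
- by apply/measurable_EFinP; exact: (measurable_wgrad (H10_wgrad Hu)).
- by move=> x _; rewrite -EFinM lee_fin mulr_ge0 ?sqr_ge0.
- by apply/measurable_EFinP; exact: measurable_funM.
Qed.

Lemma solution_neq0 : ~ ae_in Omega (fun x => u x = 0).
Proof.
move=> u0; move: Q0; rewrite QE (Rintegral_ae oO (g := cst 0)) //.
- by rewrite Rintegral_cst// mul0r ltxx.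
- by apply: measurable_density => //; exact: (H1_L2 Hu).1.
by apply: ae_inS u0 _ => x Ox ux; rewrite /dens /density ux normr0 powR0 ?gt_eqF// mulr0.
Qed.

(** The infimum [beta] is at most the quotient of [u], whose numerator is [Q]. If the
    denominator were infinite, the quotient and [beta] would vanish, and the
    left-hand side of the hypothesis would be infinite. *)
Lemma hardy_bound (c : R) : 0 < c -> (c%:E / beta Omega lambda < (p - 2)%:E)%E ->
  mu.-integrable Omega (EFin \o hardy_weight) /\
  c * \int[mu]_(x in Omega) hardy_weight x < (p - 2) * Q.
Proof.
move=> c0 hb; have p2' : 0 < p - 2 by rewrite subr_gt0.
have b0 : (0 <= beta Omega lambda)%E.
  apply: le_ereal_inf_tmp => _ [v _ <-]; rewrite /hardy_quotient mule_ge0//.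
    rewrite adde_ge0//; first by apply: integral_ge0 => x _; rewrite lee_fin sqr_ge0.
    by rewrite mule_ge0 ?lee_fin//; apply: integral_ge0 => x _; rewrite lee_fin sqr_ge0.
  rewrite inve_ge0; apply: integral_ge0 => x _.
  by rewrite lee_fin divr_ge0 ?sqr_ge0.
have bQ : (beta Omega lambda <= hardy_quotient Omega lambda u)%E.
  by apply: ereal_inf_lbound; exists u => //; split => //; exact: solution_neq0.
rewrite hardy_quotientE in bQ.
have J0 : (0 <= \int[mu]_(x in Omega) (hardy_weight x)%:E)%E.
  by apply: integral_ge0 => x _; rewrite lee_fin hardy_weight_ge0.
have bn0 : beta Omega lambda != 0%E.
  by apply/eqP => b00; move: hb; rewrite b00 inve0 gt0_muley ?lte_fin// ltNge leey.
have Jfin : (\int[mu]_(x in Omega) (hardy_weight x)%:E < +oo)%E.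
  rewrite ltey; apply/eqP => Joo; move: bQ; rewrite Joo invey mule0 => b00.
  by move/eqP: bn0; apply; apply/eqP; rewrite eq_le b00 b0.
have iJ : mu.-integrable Omega (EFin \o hardy_weight).
  apply: integrable_ge0 => //; first exact: measurable_hardy_weight.
  by move=> x _; exact: hardy_weight_ge0.
split => //.
have JE : (\int[mu]_(x in Omega) (hardy_weight x)%:E)%E = (\int[mu]_(x in Omega) hardy_weight x)%:E.
  by rewrite /Rintegral fineK//; apply: integrable_fin_num.
rewrite JE in J0 bQ; move: J0 bQ b0 bn0 hb.
move: (\int[mu]_(x in Omega) hardy_weight x) => j; rewrite lee_fin le_eqVlt => /predU1P[<-|j0].
  by rewrite mulr0 mulr_gt0.
rewrite inver gt_eqF// -EFinM; case: (beta Omega lambda) => [b||]; rewrite ?leeNy_eq//.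
rewrite !lee_fin eqe => bj b0 bn0; have {bn0}b0 : 0 < b by rewrite lt_neqAle eq_sym bn0.
rewrite inver gt_eqF// -EFinM lte_fin ltr_pdivrMr// => h.
rewrite -ltr_pdivlMr// (lt_le_trans h)// -mulrA ler_wpM2l ?(ltW p2')//.
Qed.

Hypothesis ru : radial Omega u.
Hypothesis ih : mu.-integrable Omega (EFin \o hardy_weight).

Let J := \int[mu]_(x in Omega) hardy_weight x.

Let id : mu.-integrable Omega (EFin \o dens).
Proof. exact: (integrable_density ma a0). Qed.

Let dens_radial : exists f : R -> R, ae_in Omega (fun x => dens x = f (enorm x)).
Proof.
case: ru => f uf; case: ar => fa af; exists (fun r => fa r * `|f r| `^ p).
by apply: ae_inS uf _ => x Ox ux; rewrite /dens /density ux af.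
Qed.

Let hardy_radial : exists f : R -> R, ae_in Omega (fun x => hardy_weight x = f (enorm x)).
Proof.
case: ru => f uf; exists (fun r => f r ^+ 2 / r ^+ 2).
by apply: ae_inS uf _ => x Ox ux; rewrite /hardy_weight ux.
Qed.

Let eps (k : nat) : R := k.+1%:R^-1.
Let eps_gt0 k : 0 < eps k. Proof. by rewrite invr_gt0. Qed.

Let m : R := 2 / (n%:R * (n%:R + 3)).

Let n0' : 0 < n%:R :> R. Proof. by rewrite ltr0n. Qed.

Let neq : (n%:R != 0 :> R) * (n%:R + 1 != 0 :> R) * (n%:R + 3 != 0 :> R).
Proof. by rewrite !gt_eqF//; have := n0'; lra. Qed.

(** The constant [Cn] is chosen so that this limit vanishes. *)
Lemma psi_mean : (fun k => \int[mu]_(x in Omega) (dens x * psi (eps k) x)) @ \oo --> 0.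
Proof.
have -> : 0 = (- 1 + Cn * (n%:R / (4 * (n%:R + 1))) +
    0 * (n%:R * (n%:R + 2) / (16 * (n%:R + 1) * (n%:R + 3)))) *
    \int[mu]_(x in Omega) dens x.
  by rewrite mul0r addr0 /Cn; field; rewrite !neq.
apply: (angular_limit n0 mO OD (M := 1) id) => //.
- by move=> x; exact: density_ge0.
- by move=> k; apply: smooth_measurable; exact: smooth_psi.
- by move=> k x _; exact: psi_bound.
- by move=> x x0; rewrite mul0r addr0; exact: psi_cvg.
Qed.

Lemma psi_square : (fun k => \int[mu]_(x in Omega) (dens x * psi (eps k) x ^+ 2)) @ \oo -->
  m * Q.
Proof.
have -> : m * Q = (1 + (- 2 * Cn) * (n%:R / (4 * (n%:R + 1))) +
    Cn ^+ 2 * (n%:R * (n%:R + 2) / (16 * (n%:R + 1) * (n%:R + 3)))) *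
    \int[mu]_(x in Omega) dens x.
  by rewrite QE /m /Cn; field; rewrite !neq.
apply: (angular_limit n0 mO OD (M := 1) id) => //.
- by move=> x; exact: density_ge0.
- by move=> k; apply: measurable_funX; apply: smooth_measurable; exact: smooth_psi.
- move=> k x _; rewrite normrX expr_le1//; exact: psi_bound.
- move=> x x0; have [_ ->] := dir_monE x0.
  have -> : 1 + -2 * Cn * w11 x + Cn ^+ 2 * w11 x ^+ 2 =
    (- 1 + Cn * w11 x) * (- 1 + Cn * w11 x) by ring.
  by under eq_fun do rewrite expr2; apply: cvgM; exact: psi_cvg.
Qed.

(** The ratio of this limit for [J = Q] to the previous one is the eigenvalue
    [4 (N + 2)] of the harmonics of degree 4 on the sphere. *)
Lemma psi_gradient : (fun k => \int[mu]_(x in Omega)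
    (hardy_weight x * (psi_energy (eps k) x * enorm x ^+ 2))) @ \oo -->
  4 * ((n + n)%:R + 2) * m * J.
Proof.
have -> : 4 * ((n + n)%:R + 2) * m * J = (0 + (4 * Cn ^+ 2) * (n%:R / (4 * (n%:R + 1))) +
    (- 16 * Cn ^+ 2) * (n%:R * (n%:R + 2) / (16 * (n%:R + 1) * (n%:R + 3)))) * J.
  by rewrite natrD /m /Cn; field; rewrite !neq.
apply: (angular_limit n0 mO OD (M := 4 * Cn ^+ 2) ih) => //.
- by move=> x _; exact: hardy_weight_ge0.
- move=> k; apply: measurable_funM; first by apply: measurable_funTS; exact: measurable_psi_energy.
  by apply: measurable_funX; apply: measurable_funTS; exact: measurable_enorm.
- by move=> k x _; exact: psi_energy_bound.
- move=> x x0; have -> : 0 + 4 * Cn ^+ 2 * w11 x + -16 * Cn ^+ 2 * w22 x =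
    4 * Cn ^+ 2 * (w11 x - 4 * w22 x) by ring.
  exact: psi_energy_cvg.
Qed.

Lemma integrable_dens_psi k : mu.-integrable Omega (EFin \o (fun x => dens x * psi (eps k) x)).
Proof.
apply: (integrable_bounded_mul mO id (M := 1)).
  by apply: smooth_measurable; exact: smooth_psi.
by move=> x _; exact: psi_bound.
Qed.

Lemma integrable_dens_psi2 k :
  mu.-integrable Omega (EFin \o (fun x => dens x * psi (eps k) x ^+ 2)).
Proof.
apply: (integrable_bounded_mul mO id (M := 1)).
  by apply: measurable_funX; apply: smooth_measurable; exact: smooth_psi.
by move=> x _; rewrite normrX expr_le1//; exact: psi_bound.
Qed.

Lemma integral_quadratic k (c1 c2 : R) :
  mu.-integrable Omega (EFin \o (fun x =>
    dens x * (1 + c1 * psi (eps k) x + c2 * psi (eps k) x ^+ 2))) /\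
  \int[mu]_(x in Omega) (dens x * (1 + c1 * psi (eps k) x + c2 * psi (eps k) x ^+ 2)) =
  Q + c1 * \int[mu]_(x in Omega) (dens x * psi (eps k) x) +
  c2 * \int[mu]_(x in Omega) (dens x * psi (eps k) x ^+ 2).
Proof.
have i1 := integrable_dens_psi k; have i2 := integrable_dens_psi2 k.
have -> : (fun x => dens x * (1 + c1 * psi (eps k) x + c2 * psi (eps k) x ^+ 2)) =
  (fun x => (dens x + c1 * (dens x * psi (eps k) x)) + c2 * (dens x * psi (eps k) x ^+ 2)).
  by apply/funext => x; ring.
have j1 := integrableZl mO c1 i1; have j2 := integrableZl mO c2 i2.
have j3 := integrableD mO id j1.
split; first exact: (integrableD mO j3 j2).
by rewrite (RintegralD mO j3 j2) (RintegralD mO id j1) (RintegralZl c1 mO i1) (RintegralZl c2 mO i2) QE.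
Qed.

(** On the right the gradient term appears as a multiple of [hardy_weight], which
    is possible away from the origin. *)
Lemma quad_weight (sg : R) k : 0 < sg <= 2^-1 ->
  \int[mu]_(x in Omega) quad Omega lambda (fun x => weight sg (eps k) x * u x) x =
  Q + 2 * sg * \int[mu]_(x in Omega) (dens x * psi (eps k) x) +
  sg ^+ 2 * \int[mu]_(x in Omega) (dens x * psi (eps k) x ^+ 2) +
  sg ^+ 2 * \int[mu]_(x in Omega) (hardy_weight x * (psi_energy (eps k) x * enorm x ^+ 2)).
Proof.
move=> s; have h := weight_is_multiplier n0 (eps_gt0 k) s.
rewrite (energy_multiplier oO p2 ma a0 h wu).
have -> : \int[mu]_(x in Omega) (density a p u x * weight sg (eps k) x ^+ 2) =
    \int[mu]_(x in Omega) (dens x * (1 + 2 * sg * psi (eps k) x + sg ^+ 2 * psi (eps k) x ^+ 2)).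
  by apply: eq_Rintegral => x _; rewrite weightE /dens; ring.
rewrite (integral_quadratic k _ _).2; congr (_ + _).
have ip : mu.-integrable Omega (EFin \o (fun x => hardy_weight x * (psi_energy (eps k) x * enorm x ^+ 2))).
  apply: (integrable_bounded_mul mO ih (M := 4 * Cn ^+ 2)).
    apply: measurable_funM; first by apply: measurable_funTS; exact: measurable_psi_energy.
    by apply: measurable_funX; apply: measurable_funTS; exact: measurable_enorm.
  by move=> x _; exact: psi_energy_bound.
rewrite -RintegralZl//; apply: Rintegral_ae => //.
- by apply/measurable_EFinP; case/integrableP : (integrable_grad_error oO h Hu).
- by apply/measurable_EFinP; case/integrableP : (integrableZl mO (sg ^+ 2) ip).
exists [set 0]; split.
- exact: measurable_rV_set1.
- case: (n) n0 => // j _; exact: lebesgue_rV_set0.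
move=> x /= H; apply: contrapT => x0; apply: H => Ox.
have r0 : enorm x != 0 by rewrite enorm_eq0; exact/eqP.
by rewrite enorm2_grad_weightE// /hardy_weight; field.
Qed.

Lemma density_weight (sg c d : R) k : 0 < sg <= 2^-1 -> sg <= d ->
  (forall y, `|y| <= d -> 1 + p * y + c * y ^+ 2 <= (1 + y) `^ p) ->
  Q + p * sg * \int[mu]_(x in Omega) (dens x * psi (eps k) x) +
  c * sg ^+ 2 * \int[mu]_(x in Omega) (dens x * psi (eps k) x ^+ 2) <=
  \int[mu]_(x in Omega) density a p (fun x => weight sg (eps k) x * u x) x.
Proof.
move=> s sd hd; have h := weight_is_multiplier n0 (eps_gt0 k) s.
rewrite -(integral_quadratic k _ _).2; apply: le_Rintegral => //.
- exact: (integral_quadratic k _ _).1.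
- apply: (integrable_density ma a0).
  exact: (V_multiplier oO p2 ma a0 h Vu).
move=> x Ox; rewrite densityM; apply: ler_wpM2l; first exact: (density_ge0 p a0 u Ox).
rewrite ger0_norm ?(ltW (multiplier_gt0 x h))// weightE.
have [s0 _] := andP s.
have := hd (sg * psi (eps k) x); rewrite normrM gtr0_norm// exprMn !mulrA; apply.
by rewrite (le_trans _ sd)// ler_piMr ?(ltW s0)//; exact: psi_bound.
Qed.

(** With [s = m sg ^ 2], as [e] tends to 0 the quadratic form tends to
    [(1 + (1 + kap) s) Q], and the other integral has a lower bound that tends to
    [(1 + c2 s) Q].  The constants satisfy
    [1 + kap < K < p - 1] and [p K / 2 < c1 < c2 < p (p - 1) / 2]: the strict
    gaps leave room for the limit in [e] and for the errors of higher order in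
    [sg]. *)
Lemma perturbation : 4 * ((n + n)%:R + 2) * J < (p - 2) * Q -> K_plus Omega u ->
  exists f M : _, exists alpha b : R,
  [/\ multiplier (f : T -> R) (M : R), K_plus Omega (fun x => f x * u x),
    0 < alpha /\ alpha `^ (p / 2) < b,
    \int[mu]_(x in Omega) quad Omega lambda (fun x => f x * u x) x <= alpha * Q &
    b * Q <= \int[mu]_(x in Omega) density a p (fun x => f x * u x) x].
Proof.
move=> hJ Ku; have m0 : 0 < m.
  by rewrite /m divr_gt0// mulr_gt0//; have := n0'; lra.
pose kap := 4 * ((n + n)%:R + 2) * J / Q.
have kap0 : 0 <= kap.
  rewrite /kap divr_ge0 ?(ltW Q0)// mulr_ge0//.
  by apply: Rintegral_ge0 => x _; exact: hardy_weight_ge0.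
have kap1 : kap < p - 2 by rewrite /kap ltr_pdivrMr.
have kapE : 4 * ((n + n)%:R + 2) * J = kap * Q by rewrite /kap divfK// gt_eqF.
pose K := (kap + p) / 2; have K1 : 1 + kap < K by rewrite /K; lra.
have K2 : K < p - 1 by rewrite /K; lra.
have h1 : p / 2 * K < p / 2 * (p - 1) by rewrite ltr_pM2l//; lra.
pose c1 := (2 * (p / 2 * K) + p / 2 * (p - 1)) / 3.
pose c2 := (p / 2 * K + 2 * (p / 2 * (p - 1))) / 3.
have pK0 : 0 <= p / 2 * K by rewrite mulr_ge0//; lra.
have c12 : c1 < c2 by rewrite /c1 /c2; lra.
have [d d0 hd] : exists2 d : R, 0 < d &
    forall y, `|y| <= d -> 1 + p * y + c2 * y ^+ 2 <= (1 + y) `^ p.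
  apply: powR_taylor2 => //; first by rewrite /c2; lra.
  have -> : p * (p - 1) = 2 * (p / 2 * (p - 1)) by field.
  by rewrite /c2; lra.
have [s0 s00 hs] : exists2 s0 : R, 0 < s0 & forall s, 0 < s <= s0 ->
    (1 + K * s) `^ (p / 2) < 1 + c1 * s.
  apply: powR_first_order; [lra|lra|].
  by rewrite /c1; lra.
pose sg := Num.min 2^-1 (Num.min d (s0 / m)).
have sg0 : 0 < sg by rewrite /sg !lt_min invr_gt0 ltr0n d0 divr_gt0.
have sg1 : sg <= 2^-1 by rewrite /sg ge_min lexx.
have sgd : sg <= d by rewrite /sg !ge_min lexx orbT.
have sgs : sg <= s0 / m by rewrite /sg !ge_min lexx !orbT.
have ssg : 0 < sg <= 2^-1 by rewrite sg0 sg1.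
pose s := m * sg ^+ 2.
have ss : 0 < s <= s0.
  rewrite /s mulr_gt0 ?exprn_gt0//= mulrC -ler_pdivlMr//.
  by rewrite (le_trans _ sgs)// expr2 ler_piMr ?(ltW sg0)//; lra.
have s_gt0 : 0 < s by case/andP: ss.
have cA : (fun k => Q + 2 * sg * \int[mu]_(x in Omega) (dens x * psi (eps k) x) +
  sg ^+ 2 * \int[mu]_(x in Omega) (dens x * psi (eps k) x ^+ 2) +
  sg ^+ 2 * \int[mu]_(x in Omega) (hardy_weight x * (psi_energy (eps k) x * enorm x ^+ 2))) @ \oo -->
  Q + 2 * sg * 0 + sg ^+ 2 * (m * Q) + sg ^+ 2 * (4 * ((n + n)%:R + 2) * m * J).
  apply: cvgD; last by apply: cvgMr; exact: psi_gradient.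
  apply: cvgD; last by apply: cvgMr; exact: psi_square.
  by apply: cvgD; [exact: cvg_cst|apply: cvgMr; exact: psi_mean].
have cB : (fun k => Q + p * sg * \int[mu]_(x in Omega) (dens x * psi (eps k) x) +
  c2 * sg ^+ 2 * \int[mu]_(x in Omega) (dens x * psi (eps k) x ^+ 2)) @ \oo -->
  Q + p * sg * 0 + c2 * sg ^+ 2 * (m * Q).
  apply: cvgD; last by apply: cvgMr; exact: psi_square.
  by apply: cvgD; [exact: cvg_cst|apply: cvgMr; exact: psi_mean].
have lA : Q + 2 * sg * 0 + sg ^+ 2 * (m * Q) + sg ^+ 2 * (4 * ((n + n)%:R + 2) * m * J) <
    (1 + K * s) * Q.
  have -> : Q + 2 * sg * 0 + sg ^+ 2 * (m * Q) + sg ^+ 2 * (4 * ((n + n)%:R + 2) * m * J) =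
    (1 + (1 + kap) * s) * Q.
    transitivity (Q + s * Q + s * (4 * ((n + n)%:R + 2) * J)); first by rewrite /s; ring.
    by rewrite kapE; ring.
  by rewrite ltr_pM2r// ltrD2l ltr_pM2r.
have lB : (1 + c1 * s) * Q < Q + p * sg * 0 + c2 * sg ^+ 2 * (m * Q).
  have -> : Q + p * sg * 0 + c2 * sg ^+ 2 * (m * Q) = (1 + c2 * s) * Q by rewrite /s; ring.
  by rewrite ltr_pM2r// ltrD2l ltr_pM2r.
have [k1 _ H1] := cvgr_lt _ cA _ lA; have [k2 _ H2] := cvgr_gt _ cB _ lB.
pose k := maxn k1 k2.
exists (weight sg (eps k)), (@weight_bound R n sg (eps k)), (1 + K * s), (1 + c1 * s); split.
- exact: weight_is_multiplier.
- exact: K_plus_weight.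
- split; last exact: hs.
  by rewrite ltr_pwDl// mulr_ge0 ?(ltW s_gt0)//; lra.
- by rewrite quad_weight// ltW// H1//=; exact: leq_maxl.
- apply: le_trans (density_weight k ssg sgd hd).
  by rewrite ltW// H2//=; exact: leq_maxr.
Qed.

End perturbation.

(** * A path below the mountain pass level *)

Section path.
Context {R : realType} {n : nat}.
Local Notation T := ('rV[R]_(n + n)).
Local Notation mu := (@lebesgue_rV R (n + n)).
Variables (Omega : set T) (lambda : R) (a : T -> R) (p : R).
Hypothesis oO : open Omega.
Hypothesis p2 : 2 < p.
Hypothesis ma : measurable_fun Omega a.
Hypothesis a0 : forall x, Omega x -> 0 <= a x.

Let p0 : 0 < p := lt_trans (@ltr0Sn R 1) p2.

(** Both parts of the norm are homogeneous of degree 1. *)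
Lemma Vnorm_small v : V Omega a p v ->
  exists2 C : R, 0 < C & forall k e : R, 0 < e -> `|k| * C < e ->
    (Vnorm Omega a p (fun x => k * v x)%R < e%:E)%E.
Proof.
move=> Vv; have Hv := Vv.1.
have WE := weighted_intE oO ma a0 Vv.
have : (Hsq Omega v < +oo)%E.
  have := integrable_quad 1 oO Hv => /integrableP[_].
  apply: le_lt_trans; rewrite le_eqVlt; apply/orP; left; apply/eqP.
  apply: eq_integral => x _; rewrite /= /quad mul1r ger0_norm//.
  by rewrite addr_ge0 ?sqr_ge0.
have := Hsq_ge0 Omega v; case HE : (Hsq Omega v) => [S||]//; rewrite lee_fin => S0 _.
have B0 : 0 <= \int[mu]_(x in Omega) density a p v x.
  by apply: Rintegral_ge0 => x Ox; exact: (density_ge0 p a0 v Ox).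
move: (\int[mu]_(x in Omega) density a p v x) WE B0 => B WE B0.
exists (2 * (S + 1 + B `^ p^-1)).
  by have := powR_ge0 B p^-1; lra.
move=> k e e0; have b0 := powR_ge0 B p^-1; pose b := B `^ p^-1.
rewrite -/b in b0 * => ke; have k0 := normr_ge0 k.
have kS : `|k| * (S + 1) < e / 2.
  by have : 0 <= `|k| * b by [exact: mulr_ge0]; lra.
have kb : `|k| * b <= e / 2.
  have : 0 <= `|k| * (S + 1) by [apply: mulr_ge0 => //; lra].
  by lra.
have e2 : 0 < e / 2 by lra.
have -> : e%:E = ((e / 2)%:E + (e / 2)%:E)%E by rewrite -EFinD -splitr.
rewrite /Vnorm.
have -> : (weighted_int Omega a p (fun x => k * v x)%R `^ p^-1 = (`|k| * b)%:E)%E.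
  have -> : weighted_int Omega a p (fun x => k * v x) = (`|k| `^ p * B)%:E.
    by rewrite EFinM -WE weighted_intZ//; exact: (H1_L2 Hv).1.
  rewrite poweR_EFin powRM ?powR_ge0// -powRrM divff ?gt_eqF// powRr1//.
apply: lte_leD => //.
apply: H1norm_lt => //; rewrite HsqZ// HE -EFinM lte_fin.
have -> : k ^+ 2 * S = `|k| ^+ 2 * S by rewrite real_normK ?num_real.
apply: (@le_lt_trans _ _ ((`|k| * (S + 1)) ^+ 2)).
  rewrite exprMn ler_wpM2l ?sqr_ge0//; nra.
by rewrite ltrXn2r ?nnegrE// ?mulr_ge0//; lra.
Qed.

Lemma segment_Gamma v M : K_plus Omega v -> V Omega a p v -> 0 < M ->
  ~ ae_in Omega (fun x => v x = 0) ->
  (E_K Omega lambda a p (fun x => M * v x)%R <= 0)%E ->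
  Gamma Omega lambda a p (fun tau x => tau * M * v x).
Proof.
move=> Kv Vv M0 v0 EM; split.
- move=> tau; rewrite in_itv/= => /andP[tau0 _].
  have tM : 0 <= tau * M by rewrite mulr_ge0// ltW.
  split; first by apply: H10Z => //; exact: Vv.1.
  rewrite weighted_intZ//; last exact: (H1_L2 Vv.1).1.
  by rewrite lte_mul_pinfty ?lee_fin ?powR_ge0//; exact: Vv.2.
- move=> tau _ e e0; have [C C0 HC] := Vnorm_small Vv.
  exists (e / (C * M)); first by rewrite divr_gt0// mulr_gt0.
  move=> sigma _; rewrite ltr_pdivlMr ?mulr_gt0// => h.
  have -> : ((fun x => sigma * M * v x) \- (fun x => tau * M * v x))%R =
      (fun x => ((sigma - tau) * M) * v x).
    by apply/funext => x; rewrite /=; ring.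
  by apply: HC => //; rewrite normrM (gtr0_norm M0) -mulrA [M * C]mulrC.
- by apply: aeW => x _; rewrite !mul0r.
- move=> h; apply: v0; apply: ae_inS h _ => x _ /eqP.
  by rewrite mul1r mulf_eq0 (gt_eqF M0) => /eqP.
- by rewrite (_ : (fun x => 1 * M * v x) = (fun x => M * v x))//; apply/funext => x; rewrite mul1r.
Qed.

(** The energy along the half-line of [v] is largest at one point and tends
    to minus infinity, so the half-line contains an admissible path. *)
Lemma mountain_pass_level_le v (th : R) : K_plus Omega v -> V Omega a p v ->
  ~ ae_in Omega (fun x => v x = 0) ->
  0 < \int[mu]_(x in Omega) density a p v x ->
  (forall t, 0 <= t -> 2^-1 * (t ^+ 2 * \int[mu]_(x in Omega) quad Omega lambda v x) -
     p^-1 * (t `^ p * \int[mu]_(x in Omega) density a p v x) <= th) ->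
  (mountain_pass_level Omega lambda a p <= th%:E)%E.
Proof.
move=> Kv Vv v0 B0 hth.
have EE t : 0 <= t -> E_K Omega lambda a p (fun x => t * v x) =
   (2^-1 * (t ^+ 2 * \int[mu]_(x in Omega) quad Omega lambda v x) -
    p^-1 * (t `^ p * \int[mu]_(x in Omega) density a p v x))%:E.
  by move=> t0; exact: E_K_multiple.
move: (\int[mu]_(x in Omega) density a p v x)
  (\int[mu]_(x in Omega) quad Omega lambda v x) B0 hth EE => B A B0 hth EE.
pose X := Num.max 1 (p * A / (2 * B)).
have X1 : 1 <= X by rewrite /X le_max lexx.
have X0 : 0 < X by lra.
have XA : p * A <= X * (2 * B).
  by rewrite -ler_pdivrMr ?mulr_gt0// /X le_max lexx orbT.
have p2' : 0 < p - 2 by rewrite subr_gt0.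
pose M := X `^ (p - 2)^-1.
have M0 : 0 < M by exact: powR_gt0.
have MX : M `^ (p - 2) = X by rewrite /M -powRrM mulVf ?gt_eqF// powRr1// ltW.
have Mp : M `^ p = M ^+ 2 * X.
  rewrite -MX -powR_mulrn ?(ltW M0)// -powRD ?(gt_eqF M0) ?implybT//.
  by congr (_ `^ _); ring.
have EM : (E_K Omega lambda a p (fun x => M * v x)%R <= 0)%E.
  rewrite EE ?(ltW M0)// lee_fin Mp.
  have -> : 2^-1 * (M ^+ 2 * A) - p^-1 * (M ^+ 2 * X * B) =
    M ^+ 2 / (2 * p) * (p * A - X * (2 * B)).
    by field; rewrite gt_eqF.
  rewrite mulr_ge0_le0//; first by rewrite divr_ge0 ?sqr_ge0// mulr_ge0// ltW.
  by rewrite subr_le0.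
apply: le_trans (ereal_inf_lbound _) _.
  by exists (fun tau x => tau * M * v x); [exact: segment_Gamma|].
apply: ge_ereal_sup => _ [tau + <-]; rewrite /= in_itv/= => /andP[t0 _].
by rewrite EE ?mulr_ge0 ?(ltW M0)// lee_fin hth// mulr_ge0// ltW.
Qed.

End path.

(** * Symmetry breaking *)

Section symmetry_breaking.
Context {R : realType} {n : nat}.
Local Notation T := ('rV[R]_(n + n)).

(** The case of an abstract radial domain and coefficient, which covers the three
    settings. *)
Lemma ground_state_not_radial (Omega : set T) (lambda : R) (a : T -> R) (p : R)
    (D : R -> Prop) (u : T -> R) : (0 < n)%N ->
  open Omega -> (forall x, Omega x <-> D (enorm x)) -> 0 <= lambda -> 2 < p ->
  measurable_fun Omega a -> (forall x, Omega x -> 0 <= a x) ->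
  (exists f : R -> R, forall x, Omega x -> a x = f (enorm x)) ->
  ground_state Omega lambda a p u ->
  ((4 * ((n + n)%:R + 2))%:E / beta Omega lambda < (p - 2)%:E)%E ->
  ~ radial Omega u.
Proof.
move=> n0 oO OD lam0 p2 ma a0 ar [Ku wu Elev lev0] hb ru.
have Vu : V Omega a p u by case: wu.
have p0 : 0 < p by lra.
have := E_K_multiple lambda oO ma a0 ler01 Ku Vu.
have -> : (fun x => 1 * u x) = u by apply/funext => x; rewrite mul1r.
rewrite expr1n powR1 !mul1r -(energy_solution oO p2 ma a0 wu) -mulrBl Elev => levE.
have half : 0 < 2^-1 - p^-1 by rewrite subr_gt0 ltf_pV2 ?posrE.
have Q0 : 0 < \int[lebesgue_rV (n + n)]_(x in Omega) quad Omega lambda u x.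
  by move: lev0; rewrite levE lte_fin pmulr_rgt0.
have c0 : 0 < 4 * ((n + n)%:R + 2) :> R by rewrite mulr_gt0// ltr_wpDl.
have [ih hJ] := hardy_bound oO lam0 p2 ma a0 wu Q0 c0 hb.
have [f [M [alpha [b [hf Kv [al0 ab] hA hB]]]]] :=
  perturbation n0 oO OD p2 ma a0 ar wu Q0 ru ih hJ Ku.
have [th th1 hth] := fibering_max p2 al0 Q0 ab.
have Vv := V_multiplier oO p2 ma a0 hf Vu.
have b0 : 0 < b by apply: lt_trans ab; exact: powR_gt0.
have : (mountain_pass_level Omega lambda a p <= th%:E)%E.
  apply: (mountain_pass_level_le oO p2 ma a0 Kv Vv).
  - move=> v0; apply: (solution_neq0 oO p2 ma a0 wu Q0).
    apply: ae_inS v0 _ => x _ /eqP; rewrite mulf_eq0.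
    by rewrite (gt_eqF (multiplier_gt0 x hf)) => /eqP.
  - by apply: lt_le_trans hB; exact: mulr_gt0.
  - by move=> t t0; exact: hth.
by rewrite levE lee_fin leNgt th1.
Qed.

Lemma continuous_enorm : continuous (enorm : T -> R).
Proof.
move=> x; apply: (@continuous_comp _ _ _ (fun y : T => \sum_i y ord0 i ^+ 2) Num.sqrt).
  exact: (@smooth_sqsum R n predT 0).
exact: sqrt_continuous.
Qed.

Lemma open_enorm (A : set R) : open A -> open [set x : T | A (enorm x)].
Proof. by move=> oA; apply: open_comp => // x _; exact: continuous_enorm. Qed.

End symmetry_breaking.

Theorem theorem8p1 (R : realType) (n : nat) (n_gt0 : (0 < n)%N) :
  exists k : nat,
  forall (Omega : set 'rV[R]_(n + n)) (lambda : R)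
         (a : 'rV[R]_(n + n) -> R) (p : R),
    setting_a Omega lambda a p k \/ setting_b Omega lambda a p
      \/ setting_c Omega lambda a p ->
  forall u : 'rV[R]_(n + n) -> R,
    ground_state Omega lambda a p u ->
    ((4 * ((n + n)%:R + 2))%:E / beta Omega lambda < (p - 2)%:E)%E ->
    ~ radial Omega u.
Proof.
exists 0%N => Omega lambda a p set u.
have mpow (alpha : R) : measurable_fun Omega (fun x : 'rV[R]_(n + n) => enorm x `^ alpha).
  apply: (measurableT_comp (measurable_powR alpha)).
  by apply: measurable_funTS; exact: measurable_enorm.
case: set => [[[R1 [R2 [R12 OE]]] lE [f af] [apos aC] p2]|[]].
- have oO : open Omega.
    rewrite OE; apply: (open_enorm (A := `]R1, R2[%classic)); exact: itv_open.
  apply: (ground_state_not_radial (D := fun r => R1 < r < R2)) => //.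
  + by move=> x; rewrite OE.
  + by rewrite lE.
  + apply: continuous_measurable_rV => // x Ox.
    have : {within Omega, continuous a}.
      by apply: continuous_subspaceW aC; exact: subset_closure.
    by rewrite continuous_open_subspace// => /(_ x); apply; rewrite inE.
  + by move=> x Ox; rewrite ltW// apos//; exact: subset_closure.
  + by exists f => x Ox; apply: af; exact: subset_closure.
- move=> [_ OE lE [alpha al0 [aE /andP[p2 _]]]].
  have oO : open Omega.
    rewrite OE; apply: (open_enorm (A := [set r | r < 1])); exact: open_lt.
  apply: (ground_state_not_radial (D := fun r => r < 1)) => //.
  + by move=> x; rewrite OE.
  + by rewrite lE.
  + by rewrite aE.
  + by move=> x _; rewrite aE powR_ge0.
  + by exists (fun r => r `^ alpha) => x _; rewrite aE.
- move=> [n4 OE lE [alpha al0 [aE /andP[p2 _]]]].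
  apply: (ground_state_not_radial (D := fun=> True)) => //.
  + by rewrite OE; exact: openT.
  + by move=> x; rewrite OE.
  + by rewrite lE.
  + apply: lt_trans p2; have : 4%:R <= (n + n)%:R :> R by rewrite ler_nat.
    move: ((n + n)%:R : R) => N N4.
    by rewrite ltr_pdivlMr; lra.
  + by rewrite aE.
  + by move=> x _; rewrite aE powR_ge0.
  + by exists (fun r => r `^ alpha) => x _; rewrite aE.
Qed.
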